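(* Consider the control action $$u^{*}(t)=-R^{-1}\big[S^{\intercal}x_t-\zeta+B^{\intercal}(\Pi(t)x_t+s(t))\big],$$ where the deterministic coefficients $\Pi(t)$ and $s(t)$ satisfy on $[0,T]$ the ODEs $$\dot\Pi(t)+\Pi(t)A+A^{\intercal}\Pi(t)-(\Pi(t)B+S)R^{-1}(B^{\intercal}\Pi(t)+S^{\intercal})+Q+\delta\Pi(t)\sigma(t)\sigma^{\intercal}(t)\Pi(t)=0,\quad\Pi(T)=\widehat Q,$$ $$\dot s(t)+\big[A^{\intercal}-\Pi(t)BR^{-1}B^{\intercal}-SR^{-1}B^{\intercal}+\delta\Pi(t)\sigma(t)\sigma^{\intercal}(t)\big]s(t)+\Pi(t)(b(t)+BR^{-1}\zeta)+SR^{-1}\zeta-\eta=0,\quad s(T)=0.$$ Let $$C_T^{*}=\frac\delta2\int_0^T\Big(2\langle s(t),b(t)\rangle-\langle R^{-1}(B^{\intercal}s(t)-\zeta),B^{\intercal}s(t)-\zeta\rangle+\operatorname{tr}(\Pi(t)\sigma(t)\sigma^{\intercal}(t))\Big)dt+\frac{\delta^2}{2}\int_0^T\|\sigma^{\intercal}(t)s(t)\|^2dt+\frac\delta2\langle\Pi(0)x_0,x_0\rangle+\delta\langle s(0),x_0\rangle.$$ Then the random variable $\exp(\delta\Lambda_T(u^{*})-C_T^{*})$ is a Radon-Nikodym derivative $$\frac{d\widehat{\mathbb P}}{d\mathbb P}=\exp\big(\delta\Lambda_T(u^{*})-C_T^{*}\big)$$ defining a probability measure $\widehat{\mathbb P}$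 equivalent to $\mathbb P$. Further, this Radon-Nikodym derivative can be represented as $$\frac{d\widehat{\mathbb P}}{d\mathbb P}=\exp\Big(-\frac{\delta^2}{2}\int_0^T\|\gamma_t\|^2dt+\delta\int_0^T\gamma_t^{\intercal}dw_t\Big),\qquad\gamma_t=\sigma^{\intercal}(t)(\Pi(t)x_t+s(t)),$$ where $x$ is the state process under $u^{*}$.
   Context: Fix $T>0$, $\mathcal{T}=[0,T]$, and a filtered probability space $(\Omega,\mathcal{F},\{\mathcal{F}_t\}_{t\in\mathcal{T}},\mathbb{P})$ carrying a standard $r$-dimensional Wiener process $w$. The state $x_t\in\mathbb{R}^n$, with given initial state $x_0$, is controlled by $u_t\in\mathbb{R}^m$ through $$dx_t=(Ax_t+Bu_t+b(t))\,dt+\sigma(t)\,dw_t,$$ where $A,B$ are constant matrices and $b,\sigma$ are deterministic continuous functions on $\mathcal{T}$, all of compatible dimensions. For a control $u$, $$\Lambda_T(u)=\frac12\int_0^T\Big(\langle Qx_s,x_s\rangle+2\langle Su_s,x_s\rangle+\langle Ru_s,u_s\rangle-2\langle\eta,x_s\rangle-2\langle\zeta,u_s\rangle\Big)ds+\frac12\langle\widehat{Q}x_T,x_T\rangle,$$ with constant matrices $Q,S,R,\widehat{Q}$ ($Q,R,\widehat Q$ symmetric, $R$ invertible) and vectors $\eta,\zeta$ of appropriate dimension; $0<\delta<\infty$ is a constant. *)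

(* Defs.v *)
From mathcomp Require Export all_boot all_order all_algebra.
From mathcomp Require Export all_classical all_reals all_analysis.
Export Order.TTheory GRing.Theory Num.Theory.
Export numFieldNormedType.Exports.

Set Implicit Arguments.
Unset Strict Implicit.
Unset Printing Implicit Defensive.

#[export] Set Implicit Arguments.
#[export] Unset Strict Implicit.
#[export] Unset Printing Implicit Defensive.

Local Open Scope classical_set_scope.
Local Open Scope ring_scope.
Local Open Scope charge_scope.

Definition inner {R : realType} {k : nat} (u v : 'cV[R]_k) : R :=
  \sum_(i < k) u i 0 * v i 0.

(* Squared Euclidean (Frobenius) norm. The library's norm `|M| on matrices is
   the maximum norm, so it cannot be used for this. *)
Definition sqnorm {R : realType} {p q : nat} (M : 'M[R]_(p, q)) : R :=
  \sum_(i < p) \sum_(j < q) M i j ^+ 2.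

Definition path_integral {R : realType} (t : R) (f : R -> R) : R :=
  \int[lebesgue_measure]_(s in `[0, t]) f s.

Definition mx_integral {R : realType} {p q : nat} (t : R)
    (f : R -> 'M[R]_(p, q)) : 'M[R]_(p, q) :=
  \matrix_(i < p, j < q) path_integral t (fun s => f s i j).

(* y solves y' = f(t, y) on [0, T] in the classical sense; since the right-hand
   sides used here extend continuously to [0, T], the one-sided derivatives at
   0 and T then exist and satisfy the equation as well. *)
Definition ode_solution {R : realType} {p q : nat} (T : R)
    (f : R -> 'M[R]_(p, q) -> 'M[R]_(p, q)) (y : R -> 'M[R]_(p, q)) : Prop :=
  {within `[0, T], continuous y} /\
  forall t : R, 0 < t < T -> is_derive t 1 y (f t (y t)).

Section processes.
Context {R : realType} {d : measure_display} {Omega : measurableType d}.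
Variable P : probability Omega R.
Variables (T : R) (F : R -> set (set Omega)).

(* No completeness or right-continuity is required. *)
Definition filtration : Prop :=
  [/\ forall t, 0 <= t <= T -> sigma_algebra setT (F t),
      forall t, 0 <= t <= T -> F t `<=` measurable
    & forall s t, 0 <= s -> s <= t -> t <= T -> F s `<=` F t].

Definition measurable_wrt {p q : nat} (G : set (set Omega))
    (X : Omega -> 'M[R]_(p, q)) : Prop :=
  forall (i : 'I_p) (j : 'I_q) (E : set R),
    measurable E -> G ((fun omega => X omega i j) @^-1` E).

Definition adapted {p q : nat} (t : R) (X : R -> Omega -> 'M[R]_(p, q)) : Prop :=
  forall s, 0 <= s <= t -> measurable_wrt (F s) (X s).

Definition continuous_paths {p q : nat} (t : R)
    (X : R -> Omega -> 'M[R]_(p, q)) : Prop :=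
  forall omega, {within `[0, t], continuous (X ^~ omega)}.

(* The last clause says at once that w_t - w_s is independent of F_s and that
   its law is N(0, (t - s) I_r): take D = setT for the latter. The second
   parameter of normal_prob is the standard deviation. *)
Definition wiener_process {r : nat} (w : R -> Omega -> 'cV[R]_r) : Prop :=
  [/\ adapted T w, continuous_paths T w, {ae P, forall omega, w 0 omega = 0}
    & forall (s t : R) (D : set Omega) (E : 'I_r -> set R),
        0 <= s -> s < t -> t <= T -> F s D -> (forall j, measurable (E j)) ->
        P (D `&` [set omega | forall j, E j (w t omega j 0 - w s omega j 0)]) =
        (P D * \prod_(j < r) normal_prob 0 (Num.sqrt (t - s)) (E j))%E].

Definition cvg_in_probability {V : normedModType R}
    (X : nat -> Omega -> V) (Y : Omega -> V) : Prop :=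
  forall e : R, 0 < e ->
    P [set omega | e <= `|X k omega - Y omega|] @[k --> \oo] --> 0%E.

(* The step process \sum_i 1_(]tau_i, tau_(i+1)]) xi_i, with i < sp_size. *)
Record step_process (p r : nat) := StepProcess {
  sp_size : nat;
  sp_time : nat -> R;
  sp_coef : nat -> Omega -> 'M[R]_(p, r) }.

Definition nonanticipative_step {p r : nat} (t : R)
    (H : step_process p r) : Prop :=
  [/\ sp_time H 0 = 0, sp_time H (sp_size H) = t,
      forall i, (i < sp_size H)%N -> sp_time H i <= sp_time H i.+1
    & forall i, (i < sp_size H)%N ->
        measurable_wrt (F (sp_time H i)) (sp_coef H i)].

Definition step_value {p r : nat} (H : step_process p r) (s : R)
    (omega : Omega) : 'M[R]_(p, r) :=
  \sum_(i < sp_size H)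
    (\1_(`]sp_time H i, sp_time H i.+1]) s : R) *: sp_coef H i omega.

Definition step_integral {r p : nat} (w : R -> Omega -> 'cV[R]_r)
    (H : step_process p r) (omega : Omega) : 'cV[R]_p :=
  \sum_(i < sp_size H)
    sp_coef H i omega *m (w (sp_time H i.+1) omega - w (sp_time H i) omega).

(* I is (a version of) the Ito integral \int_0^t Phi_s dw_s of the continuous
   adapted integrand Phi: the limit in probability of the integrals of
   nonanticipative step processes H_k for which
   \int_0^t |H_k - Phi|^2 ds tends to 0 in probability. As usual, I is
   determined up to P-almost sure equality only. *)
Definition ito_integral {r p : nat} (w : R -> Omega -> 'cV[R]_r) (t : R)
    (Phi : R -> Omega -> 'M[R]_(p, r)) (I : Omega -> 'cV[R]_p) : Prop :=
  [/\ adapted t Phi, continuous_paths t Phi, measurable_wrt measurable I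
    & exists H : nat -> step_process p r,
        [/\ forall k, nonanticipative_step t (H k),
            cvg_in_probability
              (fun k omega => path_integral t (fun s =>
                 sqnorm (step_value (H k) s omega - Phi s omega)) : R^o)
              (fun=> 0)
          & cvg_in_probability (fun k => step_integral w (H k)) I]].

(* Stated for each t separately; since x and the drift integral have
   continuous paths, this is the same as asking it a.s. for all t at once. *)
Definition state_process {r n m : nat} (w : R -> Omega -> 'cV[R]_r)
    (A : 'M[R]_n) (B : 'M[R]_(n, m)) (b : R -> 'cV[R]_n)
    (sigma : R -> 'M[R]_(n, r)) (x0 : 'cV[R]_n)
    (u : R -> Omega -> 'cV[R]_m) (x : R -> Omega -> 'cV[R]_n) : Prop :=
  [/\ adapted T x, continuous_paths T x
    & forall t, 0 <= t <= T ->
        exists2 M : Omega -> 'cV[R]_n,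
          ito_integral w t (fun s _ => sigma s) M
        & {ae P, forall omega,
            x t omega = x0
              + mx_integral t (fun s => A *m x s omega + B *m u s omega + b s)
              + M omega}].

Definition cost {n m : nat} (Q : 'M[R]_n) (S : 'M[R]_(n, m)) (Rm : 'M[R]_m)
    (Qhat : 'M[R]_n) (eta : 'cV[R]_n) (zeta : 'cV[R]_m)
    (u : R -> Omega -> 'cV[R]_m) (x : R -> Omega -> 'cV[R]_n)
    (omega : Omega) : R :=
  2^-1 * path_integral T (fun s =>
     inner (Q *m x s omega) (x s omega)
     + 2 * inner (S *m u s omega) (x s omega)
     + inner (Rm *m u s omega) (u s omega)
     - 2 * inner eta (x s omega) - 2 * inner zeta (u s omega))
  + 2^-1 * inner (Qhat *m x T omega) (x T omega).

Definition equivalent_measures (Phat : probability Omega R) : Prop :=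
  Phat `<< P /\ P `<< Phat.

(* The real random variable Z is (a version of) dPhat/dP. *)
Definition RN_derivative (Phat : probability Omega R) (Z : Omega -> R) : Prop :=
  [/\ measurable_fun setT Z, Phat `<< P
    & ae_eq P setT ('d (charge_of_finite_measure Phat) '/d P) (EFin \o Z)].

End processes.

(* Main.v *)
(* Completing the square with the Riccati and offset equations gives, path by
   path, delta Lambda_T(u^* ) - C_T^* = delta J - delta^2/2 int |gamma|^2, where J
   is the remainder in Ito's formula for 1/2 <Pi x, x> + <s, x>. Two facts
   remain: J is the Ito integral of gamma^T, and the exponential has mean 1.
   Both come from the Euler scheme X^N of the closed loop driven by w. Its
   distance to x at the grid points tends to 0 in probability (discrete Gronwall
   and a Lenglart inequality for step integrals), so along a subsequence almost
   surely; a discrete Ito expansion then identifies the limit of the sums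
   sum_j <gamma_j, dw_j> with J. The discrete densities
   Z^N = exp(delta sum <gamma_j, dw_j> - delta^2/2 sum |gamma_j|^2 dt) have mean 1
   by conditioning on Gaussian increments, and E[Z^N (log Z^N)^+] stays bounded
   because under Z^N the scheme X^N has bounded second moments; uniform
   integrability gives mean 1 in the limit. *)

(* The obstacle is mean 1: gamma is affine in the unbounded state, so it has no uniform bound, and
   Novikov's criterion may fail on the whole of [0, T]. The scheme makes the question
   finite-dimensional. Under Z^N an increment dw_j gains the drift delta gamma_j dt, again affine in
   X^N with bounded coefficients, so the tilted scheme is of the same kind as the original one and
   Gronwall applies to it. Uniform integrability is used in the form E[min(Z^N, e^L)] >= 1 - D / L,
   uniformly in N, a bound that survives dominated convergence. Conditional expectations are
   replaced by freezing: the joint law of the past and an independent increment is a product, so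
   Tonelli's theorem applies. Since the noise is additive, the same sums of sigma dw occur in the
   equation and in the scheme; once these are compared, convergence of X^N is a deterministic
   statement about one path. The Ito expansion uses the symmetry of Pi, which is derived: Pi - Pi^T
   solves a linear homogeneous equation and vanishes at T. *)
From HB Require Import structures.
Require Import Defs.
From mathcomp Require Import measurable_realfun ring lra.

Local Open Scope classical_set_scope.
Local Open Scope ring_scope.

(** * Moments of the normal law *)

Section gaussian.
Context {R : realType}.
Notation mu := (@lebesgue_measure R).

(** The fundamental theorem on [-(n+1), n+1] leaves F(n+1) - F(-(n+1)), which is at most 2C / (n+1);
    dominated convergence with bound |f| passes to the whole line. *)
Lemma integral_is_derive_eq0 (f F : R -> R) (C : R) :
  continuous f -> (forall x : R, is_derive x 1 F (f x)) ->
  mu.-integrable setT (EFin \o f) ->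
  (forall x, `|x| * `|F x| <= C) ->
  (\int[mu]_x (f x)%:E = 0)%E.
Proof.
move=> cf dF intf FC.
have mf : measurable_fun setT f by apply/measurable_EFinP; exact: (measurable_int mu).
pose A (n : nat) := `[- n.+1%:R, n.+1%:R]%classic : set R.
pose g n := (EFin \o f) \_ (A n).
have mg n : measurable_fun setT (g n).
  have mA : measurable (A n : set R) by exact: measurable_itv.
  apply: ((measurable_restrictT (EFin \o f) mA).1 _).
  by apply: measurable_funTS; apply/measurable_EFinP.
have gE n : (\int[mu]_x g n x = (F n.+1%:R - F (- n.+1%:R))%:E)%E.
  rewrite -integral_mkcond /A (@continuous_FTC2 _ _ F) //.
  - by rewrite gtrN.
  - exact: continuous_subspaceT.
  - split.
    + by move=> x _; apply: ex_derive; exact: dF.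
    + by apply: cvg_at_right_filter; apply: differentiable_continuous; apply/derivable1_diffP; apply: ex_derive; exact: dF.
    + by apply: cvg_at_left_filter; apply: differentiable_continuous; apply/derivable1_diffP; apply: ex_derive; exact: dF.
  - by move=> x _; rewrite derive1E; apply: derive_val.
have h1 : {ae mu, forall x, [set: R] x -> g ^~ x n @[n --> \oo] --> (EFin \o f) x}.
  apply: aeW => x _; apply: cvg_near_cst.
  near=> n; rewrite /g patchT// inE /A /= in_itv/= -ler_norml.
  near: n.
  have := @nbhs_infty_ger R `|x|.
  by apply: filterS => n hn; apply: (le_trans hn); rewrite ler_nat.
have h2 : {ae mu, forall (x : R) (n : nat), [set: R] x -> (`|g n x| <= (abse \o (EFin \o f)) x)%E}.
  by apply: aeW => x n _; rewrite /g /patch; case: ifP => //= _; rewrite normr0 lee_fin normr_ge0.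
have [_ _ gf] := @dominated_convergence _ _ _ mu _ measurableT g (EFin \o f) (abse \o (EFin \o f)) mg
   ((measurable_EFinP _ _).2 mf) h1 (integrable_abse intf) h2.
have g0 : (fun n => \int[mu]_x g n x)%E @ \oo --> 0%E.
  have -> : (fun n => \int[mu]_x g n x)%E = EFin \o (fun n => F n.+1%:R - F (- n.+1%:R)).
    by apply/funext => n; rewrite /= gE.
  apply/cvg_EFin; first by apply: nearW.
  have C0 : 0 <= C by apply: le_trans (FC 0); rewrite mulr_ge0.
  have h n : `|F n.+1%:R - F (- n.+1%:R)| <= 2 * C * n.+1%:R^-1.
    apply: (le_trans (ler_normB _ _)).
    have n0 : 0 < n.+1%:R :> R by [].
    have := FC n.+1%:R; have := FC (- n.+1%:R); rewrite normrN ger0_norm; last exact: ltW.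
    rewrite ler_pdivlMr//; lra.
  apply/cvgr0Pnorm_le => e e0; near=> n.
  apply: (le_trans (h n)); rewrite ler_pdivrMr// -ler_pdivrMl// [e^-1 * _]mulrC.
  near: n.
  have := @nbhs_infty_ger R (2 * C / e).
  by apply: filterS => n hn; apply: (le_trans hn); rewrite ler_nat.
exact: (cvg_unique (@ereal_hausdorff R) gf g0).
Unshelve. all: end_near.
Qed.

Section moments.
Variable s : R.
Hypothesis s0 : s != 0.
Let v := s ^+ 2.

Lemma expR_quadratic_ge (u : R) : 0 <= u -> u ^+ 2 / 4 <= expR u.
Proof.
move=> u0; have h := expR_ge1Dx (u / 2).
have -> : expR u = expR (u / 2) ^+ 2 by rewrite -expRM_natl; congr expR; lra.
have := expR_gt0 (u/2); nra.
Qed.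

Let v0 : 0 < v. Proof. by rewrite exprn_even_gt0. Qed.

(** Doubling the standard deviation frees a factor exp(-3 x^2 / (8 v)), which absorbs the
    polynomial. Integrability of quartics thus reduces to that of another normal density. *)
Lemma normal_pdf_quartic_bound : exists2 C : R, 0 <= C &
  forall x, (1 + x ^+ 4) * normal_pdf 0 s x <= C * normal_pdf 0 (2 * s) x.
Proof.
have s20 : 2 * s != 0 by rewrite mulf_neq0.
(* With u = 3 x^2 / (8 v), the quartic is (8 v / 3)^2 u^2, and u^2 <= 4 e^u. *)
pose D := 1 + 4 * (8 * v / 3) ^+ 2.
pose K := normal_peak s / normal_peak (2 * s).
have K0 : 0 <= K by rewrite divr_ge0 ?normal_peak_ge0.
have D0 : 0 <= D by rewrite addr_ge0// mulr_ge0 ?sqr_ge0.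
exists (D * K) => [|x]; first exact: mulr_ge0.
rewrite !normal_pdfE //.
have -> : normal_peak s = K * normal_peak (2 * s).
  by rewrite divfK// gt_eqF// normal_peak_gt0.
have -> : normal_fun 0 s x = expR (- (3 * x ^+ 2 / (8 * v))) * normal_fun 0 (2 * s) x.
  rewrite /normal_fun -expRD; congr expR; rewrite exprMn -/v; field.
  by rewrite gt_eqF.
set N := normal_fun _ _ _; set P := normal_peak _.
have N0 : 0 <= N by exact: normal_fun_ge0.
have P0 : 0 <= P by exact: normal_peak_ge0.
suff h : (1 + x ^+ 4) * expR (- (3 * x ^+ 2 / (8 * v))) <= D.
  have -> : (1 + x ^+ 4) * (K * P * (expR (- (3 * x ^+ 2 / (8 * v))) * N)) =
    ((1 + x ^+ 4) * expR (- (3 * x ^+ 2 / (8 * v)))) * (K * P * N) by ring.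
  have KPN : 0 <= K * P * N by apply: mulr_ge0 => //; exact: mulr_ge0.
  have -> : D * K * (P * N) = D * (K * P * N) by ring.
  exact: ler_wpM2r.
set u := 3 * x ^+ 2 / (8 * v).
have u0 : 0 <= u by rewrite divr_ge0// mulr_ge0// ?sqr_ge0// ltW.
have -> : x ^+ 4 = (8 * v / 3) ^+ 2 * u ^+ 2 by rewrite /u; field; rewrite gt_eqF.
have e1 := expR_quadratic_ge u0.
have e2 : 1 <= expR u by rewrite -expR0 ler_expR.
rewrite expRN ler_pdivrMr ?expR_gt0 // /D.
set L := (8 * v / 3) ^+ 2.
have L0 : 0 <= L by exact: sqr_ge0.
nra.
Qed.

Lemma quartic_bound (c0 c1 c2 c3 c4 x : R) :
  `|c0 + c1 * x + c2 * x ^+ 2 + c3 * x ^+ 3 + c4 * x ^+ 4| <=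
  (`|c0| + `|c1| + `|c2| + `|c3| + `|c4|) * (1 + x ^+ 4).
Proof.
have h (k : nat) : (k <= 4)%N -> `|x| ^+ k <= 1 + x ^+ 4.
  move=> k4; have -> : x ^+ 4 = `|x| ^+ 4 by rewrite -normrX ger0_norm// exprn_even_ge0.
  have [x1|x1] := leP `|x| 1.
    apply: (@le_trans _ _ 1); first by rewrite exprn_ile1.
    by rewrite lerDl exprn_ge0.
  apply: (@le_trans _ _ (`|x| ^+ 4)); last by rewrite lerDr.
  by apply: ler_weXn2l => //; exact: ltW.
rewrite !mulrDl.
apply: (le_trans (ler_normD _ _)); apply: lerD; last by rewrite normrM normrX ler_wpM2l// h.
apply: (le_trans (ler_normD _ _)); apply: lerD; last by rewrite normrM normrX ler_wpM2l// h.
apply: (le_trans (ler_normD _ _)); apply: lerD; last by rewrite normrM normrX ler_wpM2l// h.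
apply: (le_trans (ler_normD _ _)); apply: lerD; last by rewrite normrM ler_wpM2l// (h 1%N).
by rewrite ler_peMr// lerDl exprn_even_ge0.
Qed.

Lemma is_derive_normal_pdf (x : R) :
  is_derive x 1 (normal_pdf 0 s) (- x / v * normal_pdf 0 s x).
Proof.
rewrite normal_pdfE// /normal_fun.
have -> : (fun x : R => normal_peak s * expR (- (x - 0) ^+ 2 / (s ^+ 2 *+ 2))) =
   (fun x : R => normal_peak s *: expR ((- (s ^+ 2 *+ 2)^-1) *: (x ^+ 2))).
  by apply/funext => y /=; rewrite subr0 /GRing.scale /=; congr (_ * expR _); ring.
apply: is_derive_eq.
rewrite /GRing.scale /= -/v subr0.
have -> : - x ^+ 2 / (v *+ 2) = - (v *+ 2)^-1 * (x ^+ 2 ) by ring.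
set E := expR _. field.
by rewrite gt_eqF.
Qed.

Lemma integrable_quartic_normal (c0 c1 c2 c3 c4 : R) :
  mu.-integrable setT (EFin \o (fun x =>
   (c0 + c1 * x + c2 * x ^+ 2 + c3 * x ^+ 3 + c4 * x ^+ 4) * normal_pdf 0 s x)).
Proof.
have [C C0 hC] := normal_pdf_quartic_bound.
apply: (@le_integrable _ _ _ mu _ measurableT _ (fun x => (((`|c0| + `|c1| + `|c2| + `|c3| + `|c4|) * C) * normal_pdf 0 (2 * s) x)%:E)).
- apply/measurable_EFinP; apply: measurable_funM; last exact: measurable_normal_pdf.
  by repeat (apply: measurable_funD; last (by apply: measurable_funM => //; apply: measurable_funX)).
- move=> x _ /=; rewrite lee_fin normrM.
  rewrite [leRHS]ger0_norm; last by rewrite !mulr_ge0 ?normal_pdf_ge0// ?addr_ge0.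
  rewrite (ger0_norm (normal_pdf_ge0 _ _ _)).
  apply: (le_trans (ler_wpM2r (normal_pdf_ge0 _ _ _) (quartic_bound _ _ _ _ _ _))).
  by rewrite -!mulrA ler_wpM2l// ?addr_ge0.
- under eq_fun do rewrite EFinM.
  by apply: integrableZl => //; exact: integrable_normal_pdf.
Qed.

(* The integrand minus its claimed mean is the derivative of
   [q x * normal_pdf 0 s x] for a suitable cubic polynomial q. *)
Lemma integral_quadratic_sqr_normal_pdf (a b k : R) :
  (\int[mu]_x ((a + b * x + k * (x ^+ 2 - v)) ^+ 2 * normal_pdf 0 s x)%:E =
   (a ^+ 2 + b ^+ 2 * v + 2 * k ^+ 2 * v ^+ 2)%:E)%E.
Proof.
set m := _ + 2 * _ * _.
(* The coefficients of q solve q' - x q / v = (a + b x + k (x^2 - v))^2 - m from the top degree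
   down; the constant term then forces the value of m. *)
pose q3 := - v * k ^+ 2.
pose q2 := - 2 * v * b * k.
pose q1 := - v * (v * k ^+ 2 + b ^+ 2 + 2 * a * k).
pose q0 := - v * (2 * v * b * k + 2 * a * b).
pose F x := (q0 + q1 * x + q2 * x ^+ 2 + q3 * x ^+ 3) * normal_pdf 0 s x.
pose f x := ((a + b * x + k * (x ^+ 2 - v)) ^+ 2 - m) * normal_pdf 0 s x.
have fE : f = fun x => (((a - k * v) ^+ 2 - m) + (2 * b * (a - k * v)) * x + (b ^+ 2 + 2 * k * (a - k * v)) * x ^+ 2 + (2 * b * k) * x ^+ 3 + k ^+ 2 * x ^+ 4) * normal_pdf 0 s x.
  by apply/funext => x; rewrite /f; congr (_ * _); ring.
have intf : mu.-integrable setT (EFin \o f) by rewrite fE; exact: integrable_quartic_normal.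
have f0 : (\int[mu]_x (f x)%:E = 0)%E.
  have [C C0 hC] := normal_pdf_quartic_bound.
  have s20 : 2 * s != 0 by rewrite mulf_neq0.
  apply: (@integral_is_derive_eq0 f F ((`|0| + `|q0| + `|q1| + `|q2| + `|q3|) * (C * normal_peak (2 * s)))); [| |exact: intf|].
  - move=> x; have dp := is_derive_normal_pdf x; rewrite fE.
    by apply: differentiable_continuous; apply/derivable1_diffP; apply: ex_derive.
  - move=> x; have dp := is_derive_normal_pdf x.
    have dq : is_derive x 1 (fun x => q0 + q1 * x + q2 * x ^+ 2 + q3 * x ^+ 3) (q1 + q2 * (2 * x) + q3 * (3 * x ^+ 2)).
      by apply: is_derive_eq; rewrite /GRing.scale /=; ring.
    rewrite /F; apply: is_derive_eq.
    rewrite /f /GRing.scale /= /m /q0 /q1 /q2 /q3; field; rewrite gt_eqF //.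
  - move=> x; rewrite /F normrM (ger0_norm (normal_pdf_ge0 _ _ _)) mulrA -normrM.
    have -> : x * (q0 + q1 * x + q2 * x ^+ 2 + q3 * x ^+ 3) = 0 + q0 * x + q1 * x ^+ 2 + q2 * x ^+ 3 + q3 * x ^+ 4 by ring.
    apply: (le_trans (ler_wpM2r (normal_pdf_ge0 _ _ _) (quartic_bound _ _ _ _ _ _))).
    rewrite -mulrA; apply: ler_wpM2l; first by rewrite !addr_ge0.
    apply: (le_trans (hC x)).
    by rewrite ler_wpM2l//; exact: normal_pdf_ub.
have -> : (fun x => ((a + b * x + k * (x ^+ 2 - v)) ^+ 2 * normal_pdf 0 s x)%:E) =
  (fun x => (f x)%:E + (m * normal_pdf 0 s x)%:E)%E.
  by apply/funext => x; rewrite -EFinD /f; congr EFin; ring.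
rewrite integralD//; last first.
  under eq_fun do rewrite EFinM.
  by apply: integrableZl => //; exact: integrable_normal_pdf.
rewrite f0 add0e; under eq_integral do rewrite EFinM.
by rewrite integralZl ?integral_normal_pdf ?mule1//; exact: integrable_normal_pdf.
Qed.

(** The Radon-Nikodym derivative of the normal law equals [normal_pdf] almost everywhere, both
    having the same integral over every measurable set. *)
Lemma ge0_integral_normal_prob (c : R) (f : R -> R) :
  measurable_fun setT f -> (forall x, 0 <= f x) ->
  (\int[normal_prob c s]_x (f x)%:E = \int[mu]_x (f x * normal_pdf c s x)%:E)%E.
Proof.
move=> mf f0.
have dom := normal_prob_dominates c s.
have mf' : measurable_fun setT (EFin \o f) by exact/measurable_EFinP.
rewrite -(Radon_Nikodym_SigmaFinite.change_of_variables dom) => [||//|//]; last first.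
  by move=> x; rewrite lee_fin.
under [RHS]eq_integral do rewrite EFinM.
apply: ae_eq_integral => //.
- apply: emeasurable_funM; first exact/measurable_EFinP.
  exact: measurable_int (Radon_Nikodym_SigmaFinite.f_integrable dom).
- apply: emeasurable_funM; first exact/measurable_EFinP.
  by apply/measurable_EFinP; exact: measurable_normal_pdf.
- apply: ae_eqe_mul2l; apply: integral_ae_eq => //.
  + exact: Radon_Nikodym_SigmaFinite.f_integrable.
  + by apply/measurable_EFinP; exact: measurable_normal_pdf.
  + by move=> A _ mA; rewrite -Radon_Nikodym_SigmaFinite.f_integral.
Qed.

Lemma integral_normal_prob_quadratic_sqr (a b k : R) :
  (\int[normal_prob 0 s]_x ((a + b * x + k * (x ^+ 2 - v)) ^+ 2)%:E =
   (a ^+ 2 + b ^+ 2 * v + 2 * k ^+ 2 * v ^+ 2)%:E)%E.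
Proof.
rewrite ge0_integral_normal_prob ?integral_quadratic_sqr_normal_pdf //.
- apply: measurable_funX; apply: measurable_funD.
    by apply: measurable_funD => //; exact: measurable_funM.
  by apply: measurable_funM => //; apply: measurable_funD => //; exact: measurable_funX.
- by move=> x; exact: sqr_ge0.
Qed.

(* Completing the square turns the tilted density into that of N(al v, v). *)
Lemma integral_normal_prob_tilt (al y c : R) :
  (\int[normal_prob 0 s]_x (expR (al * x - al ^+ 2 * v / 2) * (y + c * x) ^+ 2)%:E =
   ((y + c * al * v) ^+ 2 + c ^+ 2 * v)%:E)%E.
Proof.
rewrite ge0_integral_normal_prob; last 2 first.
- apply: measurable_funM; last by apply: measurable_funX; apply: measurable_funD => //; exact: measurable_funM.
  by apply: measurableT_comp => //; apply: measurable_funD => //; exact: measurable_funM.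
- by move=> x; rewrite mulr_ge0 ?expR_ge0// sqr_ge0.
pose G x := (y + c * x) ^+ 2 * normal_pdf (al * v) s x.
have GE x : expR (al * x - al ^+ 2 * v / 2) * (y + c * x) ^+ 2 * normal_pdf 0 s x = G x.
  rewrite /G !normal_pdfE// /normal_fun.
  have -> : expR (- (x - al * v) ^+ 2 / (s ^+ 2 *+ 2)) = expR (al * x - al ^+ 2 * v / 2) * expR (- (x - 0) ^+ 2 / (s ^+ 2 *+ 2)).
    by rewrite -expRD; congr expR; rewrite -/v; field; rewrite gt_eqF.
  by ring.
under eq_integral do rewrite GE.
have dF (x : R) : is_derive x 1 (fun x : R => x + al * v) 1.
  by apply: is_derive_eq; rewrite addr0.
have dFE : (fun x : R => x + al * v)^`()%classic = cst 1.
  by apply/funext => x; rewrite derive1E; apply: derive_val.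
rewrite (@increasing_ge0_integration_by_substitutionT _ (fun x => x + al * v) G) ?dFE//.
- rewrite -[RHS]/(_)%:E.
  (* Adds the vanishing term that makes this the case k = 0 of
     [integral_quadratic_sqr_normal_pdf]. *)
  have -> : ((y + c * al * v) ^+ 2 + c ^+ 2 * v)%:E = ((y + c * al * v) ^+ 2 + c ^+ 2 * v + 2 * 0 ^+ 2 * v ^+ 2)%:E by congr EFin; ring.
  rewrite -integral_quadratic_sqr_normal_pdf; apply: eq_integral => x _.
  congr EFin; rewrite /G /= !fctE /= mulr1 !normal_pdfE// /normal_fun.
  by congr (_ * (_ * expR _)); ring.
- by move=> x z; rewrite ltrD2r.
- by move=> x; apply: cvg_cst.
- exact: is_cvg_cst.
- exact: is_cvg_cst.
- exact: cvg_addrr_Ny.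
- exact: cvg_addrr.
- move=> x; rewrite /continuous_at /G; apply: cvgM; rewrite -/(continuous_at x _).
    have : derivable (fun x : R => (y + c * x) ^+ 2) x 1 by apply: ex_derive.
    by move=> /derivable1_diffP /differentiable_continuous.
  exact: continuous_normal_pdf.
- by move=> x; rewrite /G mulr_ge0 ?sqr_ge0// normal_pdf_ge0.
Qed.

End moments.
End gaussian.

(** Stated through the measurable type generated by [G], so that closure under arithmetic is
    inherited from measurable functions. When [G] is itself a sigma-algebra, [smeasP] recovers the
    condition on preimages used in [measurable_wrt]. *)
Definition smeas {Omega : pointedType} {R : realType} (G : set (set Omega)) (f : Omega -> R) : Prop :=
  @measurable_fun _ _ (g_sigma_algebraType G) R setT f.

Section smeas_theory.
Context {d} {Omega : measurableType d} {R : realType}.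
Implicit Types (G : set (set Omega)) (f g : Omega -> R).

Lemma smeasP G f : sigma_algebra setT G ->
  smeas G f <-> (forall E, measurable E -> G (f @^-1` E)).
Proof.
move=> sG; have GE : G.-sigma.-measurable = G by exact: sigma_algebra_id.
split=> [mf E mE|h].
  by have := mf measurableT E mE; rewrite setTI GE.
by move=> _ E mE; rewrite setTI GE; exact: h.
Qed.

Lemma smeas_sub G G' f : G `<=` <<s G' >> -> smeas G f -> smeas G' f.
Proof.
move=> GG' mf _ E mE; have := mf measurableT E mE.
rewrite setTI => h.
by apply: (smallest_sub _ GG' h); exact: smallest_sigma_algebra.
Qed.

Lemma smeas_measurable G f : G `<=` measurable -> smeas G f -> measurable_fun setT f.
Proof.
move=> GG' mf _ E mE; have := mf measurableT E mE.
rewrite setTI => h.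
by apply: (smallest_sub _ GG' h); exact: sigma_algebra_measurable.
Qed.

Lemma smeas_cst G (c : R) : smeas G (fun=> c).
Proof. exact: measurable_cst. Qed.

Lemma smeasD G f g : smeas G f -> smeas G g -> smeas G (fun x => f x + g x).
Proof. exact: measurable_funD. Qed.

Lemma smeasB G f g : smeas G f -> smeas G g -> smeas G (fun x => f x - g x).
Proof. exact: measurable_funB. Qed.

Lemma smeasM G f g : smeas G f -> smeas G g -> smeas G (fun x => f x * g x).
Proof. exact: measurable_funM. Qed.

Lemma smeasX G f n : smeas G f -> smeas G (fun x => f x ^+ n).
Proof. exact: measurable_funX. Qed.

Lemma smeas_expR G f : smeas G f -> smeas G (fun x => expR (f x)).
Proof. by move=> mf; exact: measurableT_comp. Qed.

Lemma smeas_sum_in G (I : eqType) (r : seq I) (f : I -> Omega -> R) :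
  (forall i, i \in r -> smeas G (f i)) -> smeas G (fun x => \sum_(i <- r) f i x).
Proof.
move=> mf; under [X in smeas _ X]eq_fun do rewrite big_seq big_mkcond.
apply: (@measurable_sum _ (g_sigma_algebraType G)) => i.
by have := mf i; case: (i \in r) => h; [exact: h|exact: smeas_cst].
Qed.

Lemma smeas_sum G (I : Type) (r : seq I) (f : I -> Omega -> R) :
  (forall i, smeas G (f i)) -> smeas G (fun x => \sum_(i <- r) f i x).
Proof. by move=> mf; exact: measurable_sum. Qed.

Lemma smeas_prod G (I : Type) (r : seq I) (f : I -> Omega -> R) :
  (forall i, smeas G (f i)) -> smeas G (fun x => \prod_(i <- r) f i x).
Proof.
move=> mf; elim: r => [|i r IH].
  by under [X in smeas _ X]eq_fun do rewrite big_nil; exact: smeas_cst.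
by under [X in smeas _ X]eq_fun do rewrite big_cons; exact: smeasM.
Qed.

Lemma smeas_prod_in G (I : eqType) (r : seq I) (f : I -> Omega -> R) :
  (forall i, i \in r -> smeas G (f i)) -> smeas G (fun x => \prod_(i <- r) f i x).
Proof.
move=> mf; under [X in smeas _ X]eq_fun do rewrite big_seq big_mkcond.
apply: smeas_prod => i.
by have := mf i; case: (i \in r) => h; [exact: h|exact: smeas_cst].
Qed.

Lemma smeas_indic_le G f (c : R) : smeas G f ->
  smeas G (fun x => (f x <= c)%R%:R : R).
Proof.
move=> mf; have mA : <<s G >> [set x | f x <= c].
  have := mf measurableT `]-oo, c]%classic (measurable_itv _).
  rewrite setTI; congr (<<s G >> _); apply/seteqP; split=> x /=; by rewrite in_itv.
have -> : (fun x => (f x <= c)%R%:R : R) = \1_[set x | f x <= c].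
  by apply/funext => x; rewrite indicE mem_setE.
exact: (@measurable_indic _ (g_sigma_algebraType G)).
Qed.

Lemma smeas_indic_lt G f (c : R) : smeas G f ->
  smeas G (fun x => (f x < c)%R%:R : R).
Proof.
move=> mf; have mA : <<s G >> [set x | f x < c].
  have := mf measurableT `]-oo, c[%classic (measurable_itv _).
  rewrite setTI; congr (<<s G >> _); apply/seteqP; split=> x /=; by rewrite in_itv.
have -> : (fun x => (f x < c)%R%:R : R) = \1_[set x | f x < c].
  by apply/funext => x; rewrite indicE mem_setE.
exact: (@measurable_indic _ (g_sigma_algebraType G)).
Qed.

End smeas_theory.

(** * Integration against an independent Gaussian increment *)

Section freezing.
Context {d d'} {Omega : measurableType d} {V : measurableType d'} {R : realType}.
Variables (P : probability Omega R) (G : set (set Omega)) (N : probability V R).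
Variable z : Omega -> V.
Hypothesis G_meas : G `<=` measurable.
Hypothesis z_meas : measurable_fun setT z.
Hypothesis setI_G : setI_closed G.
Hypothesis G_setT : G setT.
Hypothesis indep : forall C E, G C -> measurable E ->
  P (C `&` z @^-1` E) = (P C * N E)%E.

Let OG := g_sigma_algebraType G.

Let sG_meas (C : set Omega) : <<s G >> C -> measurable C.
Proof. by apply: smallest_sub => //; exact: sigma_algebra_measurable. Qed.

Let id_meas : measurable_fun setT (id : Omega -> OG).
Proof. by move=> _ E mE; rewrite setTI; exact: sG_meas. Qed.

(** For fixed E both sides are finite measures in C that agree on the pi-system [G], hence on the
    sigma-algebra it generates. *)
Lemma indep_g_sigma_algebra C E : <<s G >> C -> measurable E ->
  P (C `&` z @^-1` E) = (P C * N E)%E.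
Proof.
move=> GC mE.
have mzE : measurable (z @^-1` E) by rewrite -[_ @^-1` _]setTI; exact: z_meas.
have NE0 : (0 <= fine (N E))%R by exact: fine_ge0.
pose m1 := mrestr P mzE.
pose m2 := mscale (NngNum NE0) P.
have -> : P (C `&` z @^-1` E) = m1 C by [].
have -> : (P C * N E)%E = m2 C.
  by rewrite /m2 /mscale /= fineK ?fin_num_measure// muleC.
have indep' A : G A -> m1 A = m2 A.
  by move=> GA; rewrite /m1 /m2 /mrestr /mscale /= indep// fineK ?fin_num_measure// muleC.
apply: (@g_sigma_algebra_measure_unique _ _ _ G G_meas (fun=> setT)) => //.
- by rewrite bigcup_const//; exists 0%N.
- move=> _; apply: (@le_lt_trans _ _ (P (setT `&` z @^-1` E))); first by [].
  by rewrite setTI (le_lt_trans (probability_le1 _ _)) ?ltry.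
Qed.

(** The substitute for conditional expectation: by independence the joint law of (w, z w), the first
    component seen only through [G], is a product measure, and Tonelli's theorem integrates z out
    with w frozen. *)
Lemma integral_freezing (f : Omega * V -> \bar R) :
  @measurable_fun _ _ (OG * V)%type _ setT f -> (forall u, 0 <= f u)%E ->
  (\int[P]_w f (w, z w) = \int[P]_w \int[N]_x f (w, x))%E.
Proof.
move=> mf f0.
pose h (w : Omega) : OG * V := (w, z w).
have mh : measurable_fun setT h by exact/measurable_fun_pair.
pose Mi := isMeasurableFun.Build _ _ _ _ _ id_meas.
pose Mh := isMeasurableFun.Build _ _ _ _ _ mh.
pose idm : {mfun Omega >-> OG} := HB.pack (id : Omega -> OG) Mi.
pose hm : {mfun Omega >-> (OG * V)%type} := HB.pack h Mh.
(* The restriction of P to the smaller sigma-algebra, obtained as the law of the identity map. *)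
pose PG : probability OG R := distribution P idm.
pose PH : probability (OG * V)%type R := distribution P hm.
have PHE X : measurable X -> (PG \x N)%E X = PH X.
  have PHX (A : set OG) (B : set V) : measurable A -> measurable B -> PH (A `*` B) = (PG A * N B)%E.
    by move=> mA mB; exact: indep_g_sigma_algebra.
  exact: (@product_measure_unique _ _ OG V R PG N PH PHX).
transitivity (\int[PH]_u f u)%E.
  by rewrite ge0_integral_pushforward.
transitivity (\int[PG \x N]_u f u)%E.
  by apply: eq_measure_integral => A mA _; apply/esym; exact: PHE.
rewrite fubini_tonelli1//.
rewrite ge0_integral_pushforward//.
  exact: measurable_fun_fubini_tonelli_F.
by move=> y _; exact: integral_ge0.
Qed.

End freezing.

Section gaussian_block.
Context {d} {Omega : measurableType d} {R : realType}.
Variables (P : probability Omega R) (G : set (set Omega)) (r : nat) (s : R).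
Variable z : 'I_r -> Omega -> R.
Hypothesis G_sigma : sigma_algebra setT G.
Hypothesis G_meas : G `<=` measurable.
Hypothesis z_meas : forall j, measurable_fun setT (z j).
Hypothesis s_neq0 : s != 0.
Hypothesis indep : forall (D : set Omega) (E : 'I_r -> set R), G D ->
  (forall j, measurable (E j)) ->
  P (D `&` [set w | forall j, E j (z j w)]) =
  (P D * \prod_(j < r) normal_prob 0 s (E j))%E.

Let v := s ^+ 2.
Let v0 : 0 < v. Proof. by rewrite exprn_even_gt0. Qed.

(* Generates the information carried by G and by all coordinates but the a-th. *)
Let H (a : 'I_r) : set (set Omega) := [set C | exists D E,
  [/\ G D, forall j, measurable (E j : set R), E a = setT &
      C = D `&` [set w | forall j, E j (z j w)] ] ].

Let G_setT : G setT.
Proof. by have := sigma_algebra_id G_sigma => <-; exact: (@measurableT _ (g_sigma_algebraType G)). Qed.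

Let cylinder_measurable (E : 'I_r -> set R) :
  (forall j, measurable (E j)) -> measurable [set w | forall j, E j (z j w)].
Proof.
move=> mE; have -> : [set w | forall j, E j (z j w)] = \bigcap_(j in [set: 'I_r]) (z j @^-1` E j).
  by apply/seteqP; split=> w /= h j; [move=> _|]; exact: h.
apply: fin_bigcap_measurable => // j _.
by rewrite -[X in measurable X]setTI; exact: z_meas.
Qed.

Let H_meas a : H a `<=` measurable.
Proof.
move=> _ [D [E [GD mE _ ->]]]; apply: measurableI; first exact: G_meas.
exact: cylinder_measurable.
Qed.

Let setI_H a : setI_closed (H a).
Proof.
move=> _ _ [D [E [GD mE Ea ->]]] [D' [E' [GD' mE' Ea' ->]]].
exists (D `&` D'), (fun j => E j `&` E' j); split.
- have h := sigma_algebra_id G_sigma; move: GD GD'; rewrite -h; exact: (@measurableI _ (g_sigma_algebraType G)).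
- by move=> j; exact: measurableI.
- by rewrite Ea Ea' setTI.
- apply/seteqP; split => w /=.
    by move=> [[? h] [? h']]; split=> [//|j]; split; [exact: h|exact: h'].
  by move=> [[? ?] h]; split; split=> // j; have [] := h j.
Qed.

Let H_setT a : H a setT.
Proof.
exists setT, (fun=> setT); split => //.
by apply/seteqP; split.
Qed.

(** The a-th slot, left free in every member of [H a], receives E, and the product of normal
    probabilities factors. *)
Let indep_H a C E : H a C -> measurable E ->
  P (C `&` z a @^-1` E) = (P C * normal_prob 0 s E)%E.
Proof.
move=> [D [E' [GD mE' Ea ->]]] mE.
have -> : D `&` [set w | forall j, E' j (z j w)] `&` z a @^-1` E =
   D `&` [set w | forall j, (if j == a then E else E' j) (z j w)].
  apply/seteqP; split => w /=.
    by move=> [[? h] ?]; split=> // j; case: eqP => [->|].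
  move=> [? h]; split; last by have := h a; rewrite eqxx.
  by split => // j; have := h j; case: eqP => // ->; rewrite Ea.
have mE2 (j : 'I_r) : measurable (if j == a then E else E' j) by case: eqP.
rewrite (indep GD mE2) (indep GD mE').
rewrite -muleA; congr (_ * _)%E.
rewrite (bigD1 a)//= eqxx [in RHS](bigD1 a)//= Ea probability_setT mul1e muleC.
congr (_ * _)%E; apply: eq_bigr => j ja.
by rewrite (negbTE ja).
Qed.

Let smeas_GH a (f : Omega -> R) : smeas G f -> smeas (H a) f.
Proof.
apply: smeas_sub => D GD; apply: sub_sigma_algebra.
exists D, (fun=> setT); split => //.
by apply/seteqP; split => [w Dw|w []].
Qed.

Let smeas_zH a b : b != a -> smeas (H a) (z b).
Proof.
move=> ba _ E mE; rewrite setTI; apply: sub_sigma_algebra.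
exists setT, (fun j => if j == b then E else setT); split => //.
- by move=> j; case: eqP.
- by rewrite eq_sym (negbTE ba).
- apply/seteqP; split => [w /= Ew|w /= [_ h]].
    by split => // j; case: eqP => // ->.
  by have := h b; rewrite eqxx.
Qed.

Let integral_tilt1 a (Y al y c : Omega -> R) :
  smeas (H a) Y -> smeas (H a) al -> smeas (H a) y -> smeas (H a) c ->
  (forall w, 0 <= Y w) ->
  (\int[P]_w (Y w * expR (al w * z a w - al w ^+ 2 * v / 2) * (y w + c w * z a w) ^+ 2)%:E =
   \int[P]_w (Y w * ((y w + c w * al w * v) ^+ 2 + c w ^+ 2 * v))%:E)%E.
Proof.
move=> mY mal my mc Y0.
pose f (u : Omega * R) := (Y u.1 * (expR (al u.1 * u.2 - al u.1 ^+ 2 * v / 2) * (y u.1 + c u.1 * u.2) ^+ 2))%:E.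
have mfst (g : Omega -> R) : smeas (H a) g -> @measurable_fun _ _ (g_sigma_algebraType (H a) * R)%type _ setT (g \o fst).
  move=> mg; exact: (measurableT_comp (mg : @measurable_fun _ _ (g_sigma_algebraType (H a)) R setT g) (@measurable_fst _ _ _ _)).
have mf : @measurable_fun _ _ (g_sigma_algebraType (H a) * R)%type _ setT f.
  apply/measurable_EFinP; apply: measurable_funM; first exact: mfst.
  have malz : @measurable_fun _ _ (g_sigma_algebraType (H a) * R)%type R setT (fun u : Omega * R => al u.1 * u.2).
    by apply: measurable_funM; [exact: mfst|exact: measurable_snd].
  have mcz : @measurable_fun _ _ (g_sigma_algebraType (H a) * R)%type R setT (fun u : Omega * R => c u.1 * u.2).
    by apply: measurable_funM; [exact: mfst|exact: measurable_snd].
  apply: measurable_funM.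
    apply: measurableT_comp => //; apply: measurable_funB => //.
    apply: measurable_funM => //; apply: measurable_funM => //.
    by apply: measurable_funX; exact: mfst.
  by apply: measurable_funX; apply: measurable_funD => //; exact: mfst.
have f0 u : (0 <= f u)%E by rewrite lee_fin mulr_ge0// mulr_ge0 ?expR_ge0 ?sqr_ge0.
transitivity (\int[P]_w f (w, z a w))%E.
  by apply: eq_integral => w _; rewrite /f /= mulrA.
rewrite (@integral_freezing _ _ _ _ _ P (H a) (normal_prob 0 s) (z a) (@H_meas a) (z_meas a) (@setI_H a) (@H_setT a) (@indep_H a) f mf f0).
apply: eq_integral => w _; rewrite /f /=.
under eq_integral do rewrite EFinM.
rewrite ge0_integralZl//=; last 3 first.
- apply/measurable_EFinP; apply: measurable_funM.
    by apply: measurableT_comp => //; apply: measurable_funB => //; exact: measurable_funM.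
  by apply: measurable_funX; apply: measurable_funD => //; exact: measurable_funM.
- by move=> x _; rewrite lee_fin mulr_ge0 ?expR_ge0 ?sqr_ge0.
- by rewrite lee_fin.
by rewrite integral_normal_prob_tilt// EFinM.
Qed.

Let integral_quadratic1 a (k : R) (A B : Omega -> R) :
  smeas (H a) A -> smeas (H a) B ->
  (\int[P]_w ((A w + B w * z a w + k * (z a w ^+ 2 - v)) ^+ 2)%:E =
   \int[P]_w (A w ^+ 2 + B w ^+ 2 * v + 2 * k ^+ 2 * v ^+ 2)%:E)%E.
Proof.
move=> mA mB.
pose f (u : Omega * R) := ((A u.1 + B u.1 * u.2 + k * (u.2 ^+ 2 - v)) ^+ 2)%:E.
have mfst (g : Omega -> R) : smeas (H a) g -> @measurable_fun _ _ (g_sigma_algebraType (H a) * R)%type _ setT (g \o fst).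
  move=> mg; exact: (measurableT_comp (mg : @measurable_fun _ _ (g_sigma_algebraType (H a)) R setT g) (@measurable_fst _ _ _ _)).
have mf : @measurable_fun _ _ (g_sigma_algebraType (H a) * R)%type _ setT f.
  apply/measurable_EFinP; apply: measurable_funX; apply: measurable_funD.
    apply: measurable_funD; first exact: mfst.
    by apply: measurable_funM; [exact: mfst|exact: measurable_snd].
  apply: measurable_funM => //; apply: measurable_funB => //.
  by apply: measurable_funX; exact: measurable_snd.
have f0 u : (0 <= f u)%E by rewrite lee_fin sqr_ge0.
transitivity (\int[P]_w f (w, z a w))%E; first by [].
rewrite (@integral_freezing _ _ _ _ _ P (H a) (normal_prob 0 s) (z a) (@H_meas a) (z_meas a) (@setI_H a) (@H_setT a) (@indep_H a) f mf f0).
by apply: eq_integral => w _; rewrite /f /= integral_normal_prob_quadratic_sqr.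
Qed.

(** Coordinates are integrated out one at a time, the others being frozen. Each step gives a shifted
    square plus a term c^2 v, and both have the shape required by the induction. The case al = 0 is
    the Ito isometry of one step; y = 1 with c = 0 says that the exponential weight has conditional
    mean 1. *)
Lemma integral_gaussian_tilt (S : seq 'I_r) (Y y : Omega -> R) (al c : 'I_r -> Omega -> R) :
  uniq S -> smeas G Y -> smeas G y -> (forall j, smeas G (al j)) -> (forall j, smeas G (c j)) ->
  (forall w, 0 <= Y w) ->
  (\int[P]_w (Y w * \prod_(j <- S) expR (al j w * z j w - al j w ^+ 2 * v / 2)
      * (y w + \sum_(j <- S) c j w * z j w) ^+ 2)%:E =
   \int[P]_w (Y w * ((y w + \sum_(j <- S) c j w * al j w * v) ^+ 2
      + \sum_(j <- S) c j w ^+ 2 * v))%:E)%E.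
Proof.
elim: S Y y c => [|a S IH] Y y c /=.
  move=> _ mY my mal mc Y0; apply: eq_integral => w _; congr EFin.
  by rewrite !big_nil mulr1 !addr0.
move=> /andP[aS uS] mY my mal mc Y0.
have zH j : j \in S -> smeas (H a) (z j).
  by move=> jS; apply: smeas_zH; apply: contraNneq aS => <-.
pose Y' w := Y w * \prod_(j <- S) expR (al j w * z j w - al j w ^+ 2 * v / 2).
pose y' w := y w + \sum_(j <- S) c j w * z j w.
have mY' : smeas (H a) Y'.
  apply: smeasM; first exact: smeas_GH.
  apply: smeas_prod_in => j jS; apply: smeas_expR; apply: smeasB.
    by apply: smeasM; [exact: smeas_GH|exact: zH].
  apply: smeas_GH; apply: smeasM; last exact: smeas_cst.
  by apply: smeasM; [exact: smeasX|exact: smeas_cst].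
have my' : smeas (H a) y'.
  apply: smeasD; first exact: smeas_GH.
  by apply: smeas_sum_in => j jS; apply: smeasM; [exact: smeas_GH|exact: zH].
have Y'0 w : 0 <= Y' w by rewrite mulr_ge0// prodr_ge0// => j _; exact: expR_ge0.
transitivity (\int[P]_w (Y' w * expR (al a w * z a w - al a w ^+ 2 * v / 2) * (y' w + c a w * z a w) ^+ 2)%:E)%E.
  apply: eq_integral => w _; congr EFin; rewrite /Y' /y' !big_cons.
  by congr (_ * _ ^+ 2); ring.
rewrite integral_tilt1//; [|exact: smeas_GH..].
have msG (f : Omega -> R) : smeas G f -> measurable_fun setT f by exact: smeas_measurable.
have msH (f : Omega -> R) : smeas (H a) f -> measurable_fun setT f by exact: smeas_measurable.
(* The factor (1 + sum of 0 z_j)^2 in the second integral is 1; it lets the induction hypothesis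
   apply to that integral as well. *)
transitivity (\int[P]_w (Y w * \prod_(j <- S) expR (al j w * z j w - al j w ^+ 2 * v / 2) *
     ((y w + c a w * al a w * v) + \sum_(j <- S) c j w * z j w) ^+ 2)%:E +
   \int[P]_w ((Y w * (c a w ^+ 2 * v)) * \prod_(j <- S) expR (al j w * z j w - al j w ^+ 2 * v / 2) * (1 + \sum_(j <- S) 0 * z j w) ^+ 2)%:E)%E.
  rewrite -ge0_integralD//.
  - apply: eq_integral => w _; rewrite -EFinD; congr EFin; rewrite /Y' /y'.
    have -> : \sum_(j <- S) 0 * z j w = 0 by rewrite big1// => j _; rewrite mul0r.
    by ring.
  - by move=> w _; rewrite lee_fin mulr_ge0 ?sqr_ge0// Y'0.
  - apply/measurable_EFinP/msH; apply: smeasM => //; apply: smeasX.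
    have -> : (fun w => y w + c a w * al a w * v + \sum_(j <- S) c j w * z j w) =
       (fun w => y' w + c a w * al a w * v) by apply/funext => w; rewrite /y'; ring.
    by apply: smeasD => //; apply: smeas_GH; apply: smeasM; [exact: smeasM|exact: smeas_cst].
  - move=> w _; rewrite lee_fin mulr_ge0 ?sqr_ge0// mulr_ge0//; last by rewrite prodr_ge0// => j _; exact: expR_ge0.
    by rewrite mulr_ge0// mulr_ge0 ?sqr_ge0// ltW.
  - apply/measurable_EFinP/msH.
    have -> : (fun w => (Y w * (c a w ^+ 2 * v)) * \prod_(j <- S) expR (al j w * z j w - al j w ^+ 2 * v / 2) * (1 + \sum_(j <- S) 0 * z j w) ^+ 2) = (fun w => Y' w * (c a w ^+ 2 * v)).
      apply/funext => w; rewrite /Y'.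
      have -> : \sum_(j <- S) 0 * z j w = 0 by rewrite big1// => j _; rewrite mul0r.
      by ring.
    by apply: smeasM => //; apply: smeas_GH; apply: smeasM; [exact: smeasX|exact: smeas_cst].
have m1 : smeas G (fun w => c a w ^+ 2 * v) by apply: smeasM; [exact: smeasX|exact: smeas_cst].
have m2 : smeas G (fun w => c a w * al a w * v) by apply: smeasM; [exact: smeasM|exact: smeas_cst].
rewrite IH//; last exact: smeasD.
rewrite (IH (fun w => Y w * (c a w ^+ 2 * v)) (fun=> 1) (fun _ _ => 0))//; last 4 first.
- exact: smeasM.
- exact: smeas_cst.
- by move=> j; exact: smeas_cst.
- by move=> w; rewrite mulr_ge0// mulr_ge0 ?sqr_ge0// ltW.
rewrite -ge0_integralD//.
- apply: eq_integral => w _; rewrite -EFinD; congr EFin.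
  rewrite !big_cons.
  have -> : \sum_(j <- S) 0 * al j w * v = 0 by rewrite big1// => j _; rewrite !mul0r.
  have -> : \sum_(j <- S) 0 ^+ 2 * v = 0 by rewrite big1// => j _; rewrite expr0n mul0r.
  by ring.
- move=> w _; rewrite lee_fin mulr_ge0// addr_ge0 ?sqr_ge0// sumr_ge0// => j _.
  by rewrite mulr_ge0 ?sqr_ge0// ltW.
- apply/measurable_EFinP/msG; apply: smeasM => //; apply: smeasD.
    apply: smeasX; apply: smeasD; first exact: smeasD.
    by apply: smeas_sum => j; apply: smeasM; [exact: smeasM|exact: smeas_cst].
  by apply: smeas_sum => j; apply: smeasM; [exact: smeasX|exact: smeas_cst].
- move=> w _; rewrite lee_fin mulr_ge0//; first by rewrite mulr_ge0// mulr_ge0 ?sqr_ge0// ltW.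
  by rewrite addr_ge0 ?sqr_ge0// sumr_ge0// => j _; rewrite mulr_ge0 ?sqr_ge0// ltW.
- apply/measurable_EFinP/msG; apply: smeasM; first exact: smeasM.
  apply: smeasD; first (apply: smeasX; apply: smeasD; first exact: smeas_cst).
    apply: smeas_sum => j; apply: smeasM; last exact: smeas_cst.
    by apply: smeasM => //; exact: smeas_cst.
  by apply: smeas_sum => j; exact: smeas_cst.
Qed.

(** Adding a coordinate a turns the sum into A + B z_a + K_aa (z_a^2 - v) with A and B free of z_a.
    The polynomials 1, z_a and z_a^2 - v are orthogonal for the normal law, so only squares
    remain. *)
Lemma integral_gaussian_quadratic (S : seq 'I_r) (K : 'I_r -> 'I_r -> R) (S0 : Omega -> R) :
  uniq S -> (forall i j, K i j = K j i) -> smeas G S0 ->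
  (\int[P]_w ((S0 w + \sum_(i <- S) \sum_(j <- S) K i j * (z i w * z j w - (i == j)%:R * v)) ^+ 2)%:E =
   \int[P]_w (S0 w ^+ 2 + 2 * v ^+ 2 * \sum_(i <- S) \sum_(j <- S) K i j ^+ 2)%:E)%E.
Proof.
move=> + Ksym mS0; elim: S => [|a S IH] /=.
  by move=> _; apply: eq_integral => w _; rewrite !big_nil addr0 mulr0 addr0.
move=> /andP[aS uS].
have zH j : j \in S -> smeas (H a) (z j).
  by move=> jS; apply: smeas_zH; apply: contraNneq aS => <-.
pose A w := S0 w + \sum_(i <- S) \sum_(j <- S) K i j * (z i w * z j w - (i == j)%:R * v).
pose B w := \sum_(j <- S) 2 * K a j * z j w.
have mA : smeas (H a) A.
  apply: smeasD; first exact: smeas_GH.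
  apply: smeas_sum_in => i iS; apply: smeas_sum_in => j jS.
  apply: smeasM; first exact: smeas_cst.
  by apply: smeasB; [apply: smeasM; exact: zH|exact: smeas_cst].
have mB : smeas (H a) B.
  by apply: smeas_sum_in => j jS; apply: smeasM; [exact: smeas_cst|exact: zH].
transitivity (\int[P]_w ((A w + B w * z a w + K a a * (z a w ^+ 2 - v)) ^+ 2)%:E)%E.
  apply: eq_integral => w _; congr (_ ^+ 2)%:E; rewrite /A /B.
  under [X in _ + X = _]eq_bigr do rewrite big_cons.
  rewrite [X in _ + X = _]big_cons big_split/= eqxx.
  have h1 : \sum_(j <- S) K a j * (z a w * z j w - (a == j)%:R * v) = \sum_(j <- S) K a j * (z a w * z j w).
    apply: eq_big_seq => j jS; case: eqP => [aj|_]; last by rewrite mul0r subr0.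
    by rewrite aj jS in aS.
  have h2 : \sum_(i <- S) K i a * (z i w * z a w - (i == a)%:R * v) = \sum_(j <- S) K a j * (z a w * z j w).
    apply: eq_big_seq => j jS; case: eqP => [aj|_]; first by rewrite -aj jS in aS.
    by rewrite mul0r subr0 Ksym (mulrC (z j w)).
  rewrite h1 h2; under [X in _ = _ + X * _ + _]eq_bigr do rewrite -mulrA.
  have -> : (\sum_(j <- S) 2 * (K a j * z j w)) * z a w = 2 * \sum_(j <- S) K a j * (z a w * z j w).
    rewrite -mulr_sumr -mulrA; congr (2 * _); rewrite mulr_suml; apply: eq_bigr => j _; ring.
  have -> : (true%:R : R) = 1 by [].
  by ring.
rewrite integral_quadratic1//.
have msH (f : Omega -> R) : smeas (H a) f -> measurable_fun setT f by exact: smeas_measurable.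
have msG (f : Omega -> R) : smeas G f -> measurable_fun setT f by exact: smeas_measurable.
have int_cst (c : R) : (\int[P]_w c%:E = c%:E)%E.
  by rewrite integral_cst//= (@probability_setT _ _ _ P) mule1.
(* B is linear in the remaining coordinates; its second moment is the tilt formula with zero
   tilt. *)
have BE : (\int[P]_w (B w ^+ 2 * v)%:E = (4 * v ^+ 2 * \sum_(j <- S) K a j ^+ 2)%:E)%E.
  have := @integral_gaussian_tilt S (fun=> v) (fun=> 0) (fun _ _ => 0) (fun j _ => 2 * K a j) uS
    (@smeas_cst _ _ _ G _) (@smeas_cst _ _ _ G _) (fun j => @smeas_cst _ _ _ G _) (fun j => @smeas_cst _ _ _ G _) (fun=> ltW v0).
  have -> : (4 * v ^+ 2 * \sum_(j <- S) K a j ^+ 2)%:E = (\int[P]_w (v * ((0 + \sum_(j <- S) 2 * K a j * 0 * v) ^+ 2 + \sum_(j <- S) (2 * K a j) ^+ 2 * v))%:E)%E.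
    rewrite int_cst; congr EFin; rewrite [\sum_(j <- S) 2 * K a j * 0 * v]big1; last by move=> j _; rewrite mulr0 mul0r.
    rewrite -mulr_suml; under [in RHS]eq_bigr do rewrite exprMn.
    by rewrite -mulr_sumr; ring.
  move=> <-; apply: eq_integral => w _; congr EFin; rewrite add0r /B.
  rewrite [\prod_(j <- S) _]big1; last by move=> j _; rewrite mul0r expr0n !mul0r subr0 expR0.
  by ring.
transitivity (\int[P]_w (A w ^+ 2)%:E + \int[P]_w (B w ^+ 2 * v)%:E + \int[P]_w (2 * K a a ^+ 2 * v ^+ 2)%:E)%E.
  rewrite -!ge0_integralD//.
  - by move=> w _; rewrite -EFinD lee_fin addr_ge0 ?sqr_ge0// mulr_ge0 ?sqr_ge0// ltW.
  - apply/measurable_EFinP/msH; apply: smeasD; first exact: smeasX.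
    by apply: smeasM; [exact: smeasX|exact: smeas_cst].
  - by move=> w _; rewrite lee_fin mulr_ge0 ?sqr_ge0// mulr_ge0 ?sqr_ge0.
  - by move=> w _; rewrite lee_fin sqr_ge0.
  - by apply/measurable_EFinP/msH; exact: smeasX.
  - by move=> w _; rewrite lee_fin mulr_ge0 ?sqr_ge0// ltW.
  - by apply/measurable_EFinP/msH; apply: smeasM; [exact: smeasX|exact: smeas_cst].
rewrite IH// BE int_cst -addeA -EFinD.
rewrite -(int_cst (_ + _)) -ge0_integralD//.
- apply: eq_integral => w _; rewrite -EFinD; congr EFin.
  under [in RHS]eq_bigr do rewrite big_cons.
  rewrite [X in _ = _ + _ * X]big_cons big_split/=.
  have -> : \sum_(i <- S) K i a ^+ 2 = \sum_(i <- S) K a i ^+ 2 by apply: eq_bigr => i _; rewrite Ksym.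
  by ring.
- move=> w _; rewrite lee_fin addr_ge0 ?sqr_ge0// mulr_ge0//; first by rewrite mulr_ge0 ?sqr_ge0.
  apply: sumr_ge0 => i _.
  by rewrite sumr_ge0// => j _; exact: sqr_ge0.
- by apply/measurable_EFinP/msG; apply: smeasD; [exact: smeasX|exact: smeas_cst].
- move=> w _; rewrite lee_fin addr_ge0//.
    by apply: mulr_ge0; [rewrite mulr_ge0 ?sqr_ge0|apply: sumr_ge0 => i _; exact: sqr_ge0].
  by rewrite mulr_ge0 ?sqr_ge0// mulr_ge0 ?sqr_ge0.
Qed.

End gaussian_block.

(** * Step processes *)

Section clip.
Context {R : realType}.
Implicit Types (a b c d x : R) (f : R -> R).

(** The point of [a, b] nearest to x when a <= b. Clipping the times of one partition to a cell of
    another cuts that cell along the first partition. *)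
Definition clip x a b := Num.min (Num.max x a) b.

Lemma clip_le x y a b : x <= y -> clip x a b <= clip y a b.
Proof.
move=> xy; rewrite /clip le_min !ge_min lexx orbT andbT.
by rewrite ge_max !le_max xy lexx !orbT.
Qed.

Lemma clip_l x a b : a <= b -> x <= a -> clip x a b = a.
Proof. by move=> ab xa; rewrite /clip max_r// min_l. Qed.

Lemma clip_r x a b : a <= b -> b <= x -> clip x a b = b.
Proof. by move=> ab xb; rewrite /clip max_l ?(le_trans ab)// min_r. Qed.

Lemma clip_ge x a b : a <= b -> a <= clip x a b.
Proof. by move=> ab; rewrite /clip le_min ab le_max lexx orbT. Qed.

(** A nondegenerate cell of the refinement starts no earlier than the unclipped time x. This is what
    keeps the refined step process nonanticipative. *)
Lemma clip_lt_ge x y a b : clip x a b < clip y a b -> x <= clip x a b.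
Proof.
rewrite /clip lt_min => /andP[_]; rewrite gt_min => /orP[h|h].
  by rewrite min_l ?(ltW h)// le_max lexx.
by rewrite ltxx in h.
Qed.

(* Both sides are the increment of [f] over ]a, b] `&` ]c, d]. *)
Lemma clip_swap f a b c d : a <= b -> c <= d ->
  f (clip d a b) - f (clip c a b) = f (clip b c d) - f (clip a c d).
Proof.
move=> ab cd; rewrite /clip.
have [bc|cb] := leP b c.
  rewrite (@max_l _ _ c a) ?(le_trans ab)// (@min_r _ _ c b)// .
  rewrite (@max_l _ _ d a) ?(le_trans ab (le_trans bc cd))// (@min_r _ _ d b) ?(le_trans bc)//.
  by rewrite (@min_l _ _ c d)// (@max_r _ _ a c) ?(le_trans ab)// (@min_l _ _ c d)// !subrr.
have [da|ad] := leP d a.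
  rewrite (@max_r _ _ c a) ?(le_trans cd)// (@min_l _ _ a b)//.
  by rewrite (@min_r _ _ b d) ?(le_trans da)// (@max_l _ _ a c) ?(le_trans cd)// (@min_r _ _ a d)// !subrr.
rewrite (maxC c a) (minC b d).
rewrite (@min_l _ _ (Num.max a c) b); last by rewrite ge_max ab ltW.
by rewrite (@min_l _ _ (Num.max a c) d)// ge_max cd ltW.
Qed.

End clip.

Lemma sum_divmod (V : nmodType) (n m : nat) (f : nat -> nat -> V) : (0 < m)%N ->
  \sum_(k < n * m) f (k %/ m)%N (k %% m)%N = \sum_(i < n) \sum_(j < m) f i j.
Proof.
move=> m0; elim: n => [|n IH]; first by rewrite mul0n !big_ord0.
rewrite big_ord_recr/= -IH -!(big_mkord xpredT (fun k => f (k %/ m)%N (k %% m)%N)).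
rewrite mulSnr (@big_cat_nat _ _ _ (n * m))//=; last by rewrite leq_addr.
congr (_ + _); rewrite -{1}[(n * m)%N]add0n big_addn addnC addnK big_mkord.
apply: eq_bigr => j _; rewrite addnC divnMDl// modnMDl divn_small ?ltn_ord// modn_small ?ltn_ord//.
by rewrite addn0.
Qed.

Section step_sub.
Context {R : realType} {d : measure_display} {Omega : measurableType d}.
Variables (T : R) (F : R -> set (set Omega)).
Hypothesis F_filtration : filtration T F.
Context {p r : nat}.
Implicit Types H K : @step_process R d Omega p r.

Lemma sp_time_le (t : R) H i j : nonanticipative_step F t H ->
  (i <= j)%N -> (j <= sp_size H)%N -> sp_time H i <= sp_time H j.
Proof.
move=> [_ _ h _]; elim: j => [|j IH]; first by rewrite leqn0 => /eqP ->.
rewrite leq_eqVlt => /orP[/eqP -> //|ij] jn.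
by apply: (le_trans (IH ij (ltnW jn))); exact: h.
Qed.

Lemma sp_time_ge0 (t : R) H i : nonanticipative_step F t H ->
  (i <= sp_size H)%N -> 0 <= sp_time H i.
Proof. by move=> hH ih; have [<- _ _ _] := hH; exact: (sp_time_le hH). Qed.

Lemma sp_time_le_end (t : R) H i : nonanticipative_step F t H ->
  (i <= sp_size H)%N -> sp_time H i <= t.
Proof. by move=> hH ih; have [_ <- _ _] := hH; exact: (sp_time_le hH). Qed.

Definition grid_cell (H K : @step_process R d Omega p r) (i j : nat) : R :=
  clip (sp_time K j) (sp_time H i) (sp_time H i.+1).

(** The difference H - K on the common refinement: each cell of H is cut by the times of K, and the
    pairs (i, j) are flattened to k = i m + j. Many of these cells are empty, and there the
    coefficient is set to 0 because the coefficient of K may not yet be known at that time. The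
    index n m, one past the last pair, gets the final time t. *)
Definition step_sub (t : R) (H K : @step_process R d Omega p r) : @step_process R d Omega p r :=
  let m := sp_size K in
  StepProcess (sp_size H * m)
    (fun k => if (k < sp_size H * m)%N then grid_cell H K (k %/ m) (k %% m) else t)
    (fun k omega => if grid_cell H K (k %/ m) (k %% m) < grid_cell H K (k %/ m) (k %% m).+1
       then sp_coef H (k %/ m) omega - sp_coef K (k %% m) omega else 0).

(** Also valid when k closes a row: the last clipped time of row i is the end of the i-th cell of H,
    where row i + 1 begins. *)
Lemma step_sub_time_succ (t : R) H K k : nonanticipative_step F t H -> nonanticipative_step F t K ->
  (k < sp_size H * sp_size K)%N ->
  sp_time (step_sub t H K) k.+1 = grid_cell H K (k %/ sp_size K) (k %% sp_size K).+1.
Proof.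
move=> hH hK; set m := sp_size K; set n := sp_size H => kn.
have m0 : (0 < m)%N by case: (posnP m) kn => [->|//]; rewrite muln0.
have iN : (k %/ m < n)%N by rewrite ltn_divLR.
have jm : (k %% m < m)%N by rewrite ltn_pmod.
have hi : sp_time H (k %/ m) <= sp_time H (k %/ m).+1 by apply: (sp_time_le hH).
rewrite /step_sub /= -/m -/n.
have [jm1|jm1] := ltnP (k %% m).+1 m.
  have e1 : (k.+1 %/ m = k %/ m)%N.
    by rewrite [X in (X.+1 %/ m)%N](divn_eq k m) -addnS divnMDl// (divn_small jm1) addn0.
  have e2 : (k.+1 %% m = (k %% m).+1)%N.
    by rewrite [X in (X.+1 %% m)%N](divn_eq k m) -addnS modnMDl modn_small.
  have -> : (k.+1 < n * m)%N by rewrite -ltn_divLR// e1.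
  by rewrite e1 e2.
have e : (k %% m).+1 = m by apply/eqP; rewrite eqn_leq jm jm1.
have k1 : (k.+1 = (k %/ m).+1 * m)%N by rewrite [X in (X.+1 = _)%N](divn_eq k m) -addnS e mulSn addnC.
have -> : grid_cell H K (k %/ m) (k %% m).+1 = sp_time H (k %/ m).+1.
  rewrite e /grid_cell clip_r//; have [_ -> _ _] := hK.
  exact: (sp_time_le_end hH).
have [kk|kk] := ltnP k.+1 (n * m).
  rewrite k1 mulnK// modnMl /grid_cell clip_l//.
    by apply: (sp_time_le hH) => //; rewrite -(ltn_pmul2r m0) -k1.
  have [-> _ _ _] := hK; apply: (sp_time_ge0 hH) => //.
have -> : (k %/ m).+1 = n.
  by apply/eqP; rewrite eqn_leq iN -(leq_pmul2r m0) -k1.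
by have [_ -> _ _] := hH.
Qed.

Lemma step_sub_time (t : R) H K k : 
  (k < sp_size H * sp_size K)%N ->
  sp_time (step_sub t H K) k = grid_cell H K (k %/ sp_size K) (k %% sp_size K).
Proof. by rewrite /step_sub /= => ->. Qed.

(** The integrator f is arbitrary in order to serve twice: the indicator of s <= u gives the values
    of the step processes, a coordinate of w gives their integrals. *)
Lemma step_sub_sum (t : R) H K (omega : Omega) (f : R -> R) a b :
  nonanticipative_step F t H -> nonanticipative_step F t K ->
  \sum_(k < sp_size (step_sub t H K)) sp_coef (step_sub t H K) k omega a b *
    (f (sp_time (step_sub t H K) k.+1) - f (sp_time (step_sub t H K) k)) =
  \sum_(i < sp_size H) sp_coef H i omega a b * (f (sp_time H i.+1) - f (sp_time H i)) -
  \sum_(j < sp_size K) sp_coef K j omega a b * (f (sp_time K j.+1) - f (sp_time K j)).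
Proof.
move=> hH hK.
set n := sp_size H; set m := sp_size K.
(* A step process without cells runs from 0 to t in no step, so t = 0 and every increment of H
   vanishes too. *)
have [m0|m0] := posnP m.
  have t0 : t = 0 by have [h0 hm _ _] := hK; rewrite -hm -/m m0 h0.
  rewrite [X in X = _]big1; last first.
    by move=> [k +] _; rewrite /step_sub /= -/m m0 muln0.
  rewrite [X in _ = _ - X]big1; last by move=> [k +] _; rewrite -/m m0.
  rewrite subr0 big1// => i _.
  have hi x : (x <= n)%N -> sp_time H x = 0.
    by move=> xn; apply/eqP; rewrite eq_le (sp_time_ge0 hH)// -t0 (sp_time_le_end hH).
  by rewrite !hi ?subrr ?mulr0// ltnW.
pose g i j := (sp_coef H i omega a b - sp_coef K j omega a b) *
   (f (grid_cell H K i j.+1) - f (grid_cell H K i j)).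
transitivity (\sum_(k < n * m) g (k %/ m)%N (k %% m)%N).
  apply: eq_bigr => k _; have kn : (k < sp_size H * sp_size K)%N := ltn_ord k.
  rewrite (step_sub_time_succ hH hK kn) (step_sub_time t kn) [sp_coef (step_sub _ _ _) _ _]/= -/m.
  rewrite /g; case: ltP => [_|h].
    by rewrite !mxE.
  rewrite mxE mul0r; have -> : grid_cell H K (k %/ m) (k %% m).+1 = grid_cell H K (k %/ m) (k %% m).
    apply/eqP; rewrite eq_le h/=; apply: clip_le.
    by apply: (sp_time_le hK) => //; rewrite ltn_pmod.
  by rewrite subrr mulr0.
rewrite sum_divmod//.
transitivity (\sum_(i < n) \sum_(j < m) sp_coef H i omega a b * (f (grid_cell H K i j.+1) - f (grid_cell H K i j)) -
   \sum_(i < n) \sum_(j < m) sp_coef K j omega a b * (f (grid_cell H K i j.+1) - f (grid_cell H K i j))).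
  rewrite -sumrB; apply: eq_bigr => i _; rewrite -sumrB; apply: eq_bigr => j _.
  by rewrite /g mulrBl.
congr (_ - _).
  apply: eq_bigr => i _; rewrite -mulr_sumr; congr (_ * _).
  rewrite -(big_mkord xpredT (fun j => f (grid_cell H K i j.+1) - f (grid_cell H K i j))).
  rewrite telescope_sumr// /grid_cell.
  have hi : sp_time H i <= sp_time H i.+1 by apply: (sp_time_le hH).
  rewrite clip_r//; last by have [_ -> _ _] := hK; exact: (sp_time_le_end hH).
  by rewrite clip_l//; have [-> _ _ _] := hK; apply: (sp_time_ge0 hH); rewrite ltnW.
rewrite exchange_big/=; apply: eq_bigr => j _; rewrite -mulr_sumr; congr (_ * _).
have hj : sp_time K j <= sp_time K j.+1 by apply: (sp_time_le hK).
(* For the coefficients of K the roles are exchanged: the same increments are read as times of H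
   clipped to the j-th cell of K, and they telescope in i. *)
under eq_bigr => i _ do rewrite /grid_cell clip_swap ?(sp_time_le hH)//.
rewrite -(big_mkord xpredT (fun i => f (clip (sp_time H i.+1) (sp_time K j) (sp_time K j.+1)) - f (clip (sp_time H i) (sp_time K j) (sp_time K j.+1)))).
rewrite (telescope_sumr (fun i => f (clip (sp_time H i) (sp_time K j) (sp_time K j.+1))))//.
rewrite clip_r//; last by have [_ -> _ _] := hH; exact: (sp_time_le_end hK).
by rewrite clip_l//; have [-> _ _ _] := hH; apply: (sp_time_ge0 hK); rewrite ltnW.
Qed.

Lemma step_sub_nonanticipative (t : R) H K : 0 <= t -> t <= T ->
  nonanticipative_step F t H -> nonanticipative_step F t K ->
  nonanticipative_step F t (step_sub t H K).
Proof.
move=> t_ge0 tT hH hK; set n := sp_size H; set m := sp_size K.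
have [sF mF leF] := F_filtration.
split.
- rewrite /step_sub /= -/n -/m; case: ltnP => [nm|].
    rewrite div0n mod0n /grid_cell; have [h1 _ _ _] := hH; have [h2 _ _ _] := hK.
    rewrite h1 h2 clip_l//; rewrite -h1; apply: (sp_time_le hH) => //.
    by rewrite -/n; case: (posnP n) nm => [->|//]; rewrite mul0n.
  rewrite leqn0 muln_eq0 => /orP[/eqP h|/eqP h].
    by have [h0 ht _ _] := hH; rewrite -ht -/n h h0.
  by have [h0 ht _ _] := hK; rewrite -ht -/m h h0.
- by rewrite /step_sub /= ltnn.
- move=> k kn; rewrite (step_sub_time_succ hH hK kn) (step_sub_time t kn).
  apply: clip_le; apply: (sp_time_le hK) => //; rewrite ltn_pmod//.
  by case: (posnP (sp_size K)) kn => [h|//]; rewrite /= h muln0.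
- move=> k kn i j E mE; rewrite (step_sub_time t kn).
  have m0 : (0 < m)%N by case: (posnP m) kn => [h|//]; rewrite /= -/m h muln0.
  have iN : (k %/ m < n)%N by rewrite ltn_divLR.
  have jm : (k %% m < m)%N by rewrite ltn_pmod.
  rewrite [sp_coef (step_sub _ _ _) _]/=  -/m.
  set c := grid_cell H K (k %/ m) (k %% m).
  have c0t : 0 <= c <= T.
    rewrite /c /grid_cell; apply/andP; split.
      apply: (le_trans (sp_time_ge0 hH (ltnW iN))); apply: clip_ge; exact: (sp_time_le hH).
    apply: (le_trans _ tT); rewrite /clip ge_min; apply/orP; right.
    exact: (sp_time_le_end hH).
  have sFc := sF _ c0t.
  case: ltP => [h|h]; last first.
    have : smeas (F c) (fun=> (0 : 'M[R]_(p, r)) i j) by exact: smeas_cst.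
    by move/(smeasP _ sFc); apply.
  apply: (iffLR (smeasP _ sFc)) mE.
  have -> : (fun omega : Omega => (sp_coef H (k %/ m) omega - sp_coef K (k %% m) omega) i j) =
    (fun omega => sp_coef H (k %/ m) omega i j - sp_coef K (k %% m) omega i j).
    by apply/funext => o; rewrite !mxE.
  have /andP[c0 cT] := c0t.
  have hc : sp_time H (k %/ m) <= c by rewrite /c /grid_cell; apply: clip_ge; exact: (sp_time_le hH).
  have kc : sp_time K (k %% m) <= c by exact: clip_lt_ge h.
  have hH0 := sp_time_ge0 hH (ltnW iN); have hK0 := sp_time_ge0 hK (ltnW jm).
  apply: smeasB.
    apply: (@smeas_sub _ _ _ (F (sp_time H (k %/ m)))).
      by move=> A FA; apply: sub_sigma_algebra; apply: (leF (sp_time H (k %/ m))).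
    apply/smeasP; first by apply: sF; rewrite hH0 (le_trans hc).
    by have [_ _ _] := hH; apply.
  apply: (@smeas_sub _ _ _ (F (sp_time K (k %% m)))).
    by move=> A FA; apply: sub_sigma_algebra; apply: (leF (sp_time K (k %% m))).
  apply/smeasP; first by apply: sF; rewrite hK0 (le_trans kc).
  by have [_ _ _] := hK; apply.
Qed.

(** Writing the indicator of a cell as an increment of u -> 1(s <= u) brings the value into the form
    of [step_sub_sum]. *)
Lemma step_valueE (t : R) H s omega a b : nonanticipative_step F t H ->
  step_value H s omega a b =
  \sum_(i < sp_size H) sp_coef H i omega a b *
    ((s <= sp_time H i.+1)%R%:R - (s <= sp_time H i)%R%:R).
Proof.
move=> hH; rewrite /step_value summxE; apply: eq_bigr => i _.
rewrite mxE mulrC; congr (_ * _).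
have hi : sp_time H i <= sp_time H i.+1 by apply: (sp_time_le hH).
rewrite indicE; have [si|si] := leP s (sp_time H i).
  rewrite (le_trans si hi) subrr memNset//= in_itv/= => /andP[].
  by rewrite ltNge si.
rewrite subr0; have [si1|si1] := leP s (sp_time H i.+1).
  by rewrite mem_set//= in_itv/= si si1.
by rewrite memNset//= in_itv/= si /= leNgt si1.
Qed.

Lemma step_integralE (w : R -> Omega -> 'cV[R]_r) H omega a :
  step_integral w H omega a 0 =
  \sum_(b < r) \sum_(i < sp_size H) sp_coef H i omega a b *
    (w (sp_time H i.+1) omega b 0 - w (sp_time H i) omega b 0).
Proof.
rewrite /step_integral summxE exchange_big/=; apply: eq_bigr => i _.
by rewrite mxE; apply: eq_bigr => b _; rewrite !mxE.
Qed.

Lemma step_sub_value (t : R) H K s omega : 0 <= t -> t <= T ->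
  nonanticipative_step F t H -> nonanticipative_step F t K ->
  step_value (step_sub t H K) s omega = step_value H s omega - step_value K s omega.
Proof.
move=> t0 tT hH hK; have hD := step_sub_nonanticipative t0 tT hH hK.
apply/matrixP => a b; rewrite !mxE (step_valueE _ _ _ _ hD) (step_valueE _ _ _ _ hH) (step_valueE _ _ _ _ hK).
exact: (step_sub_sum omega (fun u => (s <= u)%R%:R) a b hH hK).
Qed.

Lemma step_sub_integral (t : R) (w : R -> Omega -> 'cV[R]_r) H K omega :
  nonanticipative_step F t H -> nonanticipative_step F t K ->
  step_integral w (step_sub t H K) omega = step_integral w H omega - step_integral w K omega.
Proof.
move=> hH hK; apply/matrixP => a j; rewrite (ord1 j) !mxE !step_integralE.
rewrite -sumrB; apply: eq_bigr => b _.
exact: (step_sub_sum omega (fun u => w u omega b 0) a b hH hK).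
Qed.

Definition step_energy H (k : nat) (omega : Omega) : R :=
  \sum_(i < k) sqnorm (sp_coef H i omega) * (sp_time H i.+1 - sp_time H i).

Lemma sqnorm0 q q' : sqnorm (0 : 'M[R]_(q, q')) = 0.
Proof. by rewrite /sqnorm big1// => i _; rewrite big1// => j _; rewrite mxE expr0n. Qed.

Lemma sqnorm_ge0 q q' (M : 'M[R]_(q, q')) : 0 <= sqnorm M.
Proof. by rewrite sumr_ge0// => i _; rewrite sumr_ge0// => j _; exact: sqr_ge0. Qed.

(** The cells are disjoint, so at most one term of the sum is nonzero and the square has no cross
    terms. *)
Lemma sqnorm_step_value (t : R) H s omega : nonanticipative_step F t H ->
  sqnorm (step_value H s omega) =
  \sum_(i < sp_size H) sqnorm (sp_coef H i omega) * \1_(`]sp_time H i, sp_time H i.+1]%classic) s.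
Proof.
move=> hH; rewrite /step_value.
have [[i si]|no] := pselect (exists i : 'I_(sp_size H), `]sp_time H i, sp_time H i.+1]%classic s); last first.
  have z (i : 'I_(sp_size H)) : \1_(`]sp_time H i, sp_time H i.+1]%classic) s = 0 :> R.
    by rewrite indicE memNset// => si; apply: no; exists i.
  rewrite big1; last by move=> i _; rewrite z scale0r.
  by rewrite sqnorm0 big1// => i _; rewrite z mulr0.
have z (j : 'I_(sp_size H)) : j != i -> \1_(`]sp_time H j, sp_time H j.+1]%classic) s = 0 :> R.
  move=> ji; rewrite indicE memNset// /= => sj.
  move: si sj; rewrite /= !in_itv/= => /andP[a1 a2] /andP[b1 b2].
  have [ij|ij|ij] := ltngtP j i; last by move/eqP: ji; apply; exact: val_inj.
    have := sp_time_le hH ij (ltnW (ltn_ord i)); lra.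
  have := sp_time_le hH ij (ltnW (ltn_ord j)); lra.
have o : \1_(`]sp_time H i, sp_time H i.+1]%classic) s = 1 :> R by rewrite indicE mem_set.
rewrite (bigD1 i)//= [RHS](bigD1 i)//= big1 ?addr0; last by move=> j ji; rewrite z// scale0r.
by rewrite o scale1r mulr1 big1 ?addr0// => j ji; rewrite z// mulr0.
Qed.

Lemma path_integral_step (t : R) H omega : nonanticipative_step F t H ->
  path_integral t (fun s => sqnorm (step_value H s omega)) = step_energy H (sp_size H) omega.
Proof.
move=> hH; rewrite /path_integral /Rintegral.
under eq_integral do rewrite (sqnorm_step_value _ _ hH) -sumEFin.
rewrite ge0_integral_sum//=; last 2 first.
- by move=> i; apply/measurable_EFinP; apply: measurable_funM.
- by move=> i s _; rewrite lee_fin mulr_ge0 ?sqnorm_ge0.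
rewrite /step_energy -[RHS]/(fine (\sum_(i < sp_size H) sqnorm (sp_coef H i omega) * (sp_time H i.+1 - sp_time H i))%:E) -sumEFin.
congr fine; apply: eq_bigr => i _.
under eq_integral do rewrite EFinM.
rewrite ge0_integralZl//=; last 2 first.
- by apply/measurable_EFinP; exact: measurable_indic.
- by rewrite lee_fin sqnorm_ge0.
rewrite EFinM; congr (_ * _)%E.
rewrite integral_indic//.
have -> : `]sp_time H i, sp_time H i.+1]%classic `&` `[0, t]%classic = `]sp_time H i, sp_time H i.+1]%classic.
  apply/seteqP; split => s /=; first by case.
  rewrite !in_itv/= => /andP[a b]; split; first by rewrite a b.
  rewrite (le_trans (sp_time_ge0 hH (ltnW (ltn_ord i))) (ltW a)).
  by rewrite (le_trans b (sp_time_le_end hH _)).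
apply: (eq_trans (lebesgue_measure_itv `]sp_time H i, sp_time H i.+1])); rewrite /= lte_fin.
case: ltP => [_|h]; first by rewrite EFinB.
have hi : sp_time H i <= sp_time H i.+1 by apply: (sp_time_le hH).
by have -> : sp_time H i.+1 - sp_time H i = 0 by apply/eqP; rewrite subr_eq0 eq_le h hi.
Qed.

End step_sub.

Section wiener_step.
Context {R : realType} {d : measure_display} {Omega : measurableType d}.
Variables (P : probability Omega R) (T : R) (F : R -> set (set Omega)).
Context {r : nat}.
Variable w : R -> Omega -> 'cV[R]_r.
Hypothesis F_filtration : filtration T F.
Hypothesis w_wiener : wiener_process P T F w.

Lemma filtration_smeas_le (a b : R) (f : Omega -> R) :
  0 <= a -> a <= b -> b <= T -> smeas (F a) f -> smeas (F b) f.
Proof.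
have [_ _ leF] := F_filtration => a0 ab bT; apply: smeas_sub => A FA.
by apply: sub_sigma_algebra; exact: (leF a).
Qed.

Lemma filtration_smeas_measurable (a : R) (f : Omega -> R) :
  0 <= a <= T -> smeas (F a) f -> measurable_fun setT f.
Proof. by have [_ mF _] := F_filtration => /mF; exact: smeas_measurable. Qed.

Lemma adapted_smeas {p q : nat} (t a : R) (X : R -> Omega -> 'M[R]_(p, q)) i j :
  adapted F t X -> 0 <= a -> a <= t -> t <= T -> smeas (F a) (fun o => X a o i j).
Proof.
have [sF _ _] := F_filtration => hX a0 at_ tT.
apply/smeasP; first by apply: sF; rewrite a0 (le_trans at_).
by move=> E mE; apply: hX => //; rewrite a0.
Qed.

Lemma wiener_smeas (a : R) j : 0 <= a <= T -> smeas (F a) (fun o => w a o j 0).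
Proof. by move=> /andP[a0 aT]; have [aw _ _ _] := w_wiener; exact: (adapted_smeas j 0 aw). Qed.

(** Girsanov's theorem for one increment: under the exponential weight, w_b - w_a keeps its
    covariance and gains the mean (b - a) al, where al is known at time a. *)
Lemma integral_wiener_tilt (a b : R) (Y y : Omega -> R) (al c : 'I_r -> Omega -> R) :
  0 <= a -> a <= b -> b <= T ->
  smeas (F a) Y -> smeas (F a) y -> (forall j, smeas (F a) (al j)) -> (forall j, smeas (F a) (c j)) ->
  (forall o, 0 <= Y o) ->
  (\int[P]_o (Y o * expR (\sum_j (al j o * (w b o j 0 - w a o j 0) - al j o ^+ 2 * (b - a) / 2))
      * (y o + \sum_j c j o * (w b o j 0 - w a o j 0)) ^+ 2)%:E =
   \int[P]_o (Y o * ((y o + (b - a) * \sum_j c j o * al j o) ^+ 2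
      + (b - a) * \sum_j c j o ^+ 2))%:E)%E.
Proof.
move=> a0 ab bT mY my mal mc Y0; have [sF mF leF] := F_filtration.
have aT : 0 <= a <= T by rewrite a0 (le_trans ab).
have b0T : 0 <= b <= T by rewrite (le_trans a0 ab).
(* An increment over an interval of length 0 is treated apart, since the Gaussian computation
   divides by the variance. *)
move: ab; rewrite le_eqVlt => /orP[/eqP <-|ab].
  apply: eq_integral => o _; congr EFin.
  rewrite big1; last by move=> j _; rewrite !subrr !mulr0 mul0r subrr.
  rewrite [\sum_j c j o * _]big1; last by move=> j _; rewrite !subrr mulr0.
  by rewrite expR0 subrr !mul0r; ring.
have sE : Num.sqrt (b - a) ^+ 2 = b - a by rewrite sqr_sqrtr// subr_ge0 ltW.
have s0 : Num.sqrt (b - a) != 0 by rewrite gt_eqF// sqrtr_gt0 subr_gt0.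
have mz j : measurable_fun setT (fun o => w b o j 0 - w a o j 0).
  by apply: measurable_funB; apply: filtration_smeas_measurable (wiener_smeas j _).
have [_ _ _ indep] := w_wiener.
have := @integral_gaussian_tilt _ _ _ P (F a) r (Num.sqrt (b - a)) (fun j o => w b o j 0 - w a o j 0)
   (sF _ aT) (mF _ aT) mz s0 (fun D E GD mE => indep a b D E a0 ab bT GD mE)
   (index_enum 'I_r) Y y al c (index_enum_uniq _) mY my mal mc Y0.
rewrite sE => h.
transitivity (\int[P]_w0 (Y w0 *
             \prod_(j <- index_enum 'I_r) expR (al j w0 * (w b w0 j 0 - w a w0 j 0) - al j w0 ^+ 2 * (b - a) / 2) *
             (y w0 + \sum_(j <- index_enum 'I_r) c j w0 * (w b w0 j 0 - w a w0 j 0)) ^+ 2)%:E)%E.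
  by apply: eq_integral => o _; rewrite expR_sum.
rewrite h; apply: eq_integral => o _; congr (_ * (_ ^+ 2 + _))%:E.
  by congr (_ + _); rewrite mulr_sumr; apply: eq_bigr => j _; rewrite mulrC.
by rewrite mulr_sumr; apply: eq_bigr => j _; rewrite mulrC.
Qed.

Lemma integral_wiener_quadratic (a b : R) (K : 'I_r -> 'I_r -> R) (S0 : Omega -> R) :
  0 <= a -> a <= b -> b <= T -> (forall i j, K i j = K j i) -> smeas (F a) S0 ->
  (\int[P]_o ((S0 o + \sum_i \sum_j K i j * ((w b o i 0 - w a o i 0) * (w b o j 0 - w a o j 0)
      - (i == j)%:R * (b - a))) ^+ 2)%:E =
   \int[P]_o (S0 o ^+ 2 + 2 * (b - a) ^+ 2 * \sum_i \sum_j K i j ^+ 2)%:E)%E.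
Proof.
move=> a0 ab bT Ksym mS0; have [sF mF leF] := F_filtration.
have aT : 0 <= a <= T by rewrite a0 (le_trans ab).
have b0T : 0 <= b <= T by rewrite (le_trans a0 ab).
move: ab; rewrite le_eqVlt => /orP[/eqP <-|ab].
  apply: eq_integral => o _; congr EFin.
  rewrite big1; last by move=> i _; rewrite big1// => j _; rewrite !subrr !mulr0 subrr mulr0.
  by rewrite subrr; ring.
have sE : Num.sqrt (b - a) ^+ 2 = b - a by rewrite sqr_sqrtr// subr_ge0 ltW.
have s0 : Num.sqrt (b - a) != 0 by rewrite gt_eqF// sqrtr_gt0 subr_gt0.
have mz j : measurable_fun setT (fun o => w b o j 0 - w a o j 0).
  by apply: measurable_funB; apply: filtration_smeas_measurable (wiener_smeas j _).
have [_ _ _ indep] := w_wiener.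
have := @integral_gaussian_quadratic _ _ _ P (F a) r (Num.sqrt (b - a)) (fun j o => w b o j 0 - w a o j 0)
   (sF _ aT) (mF _ aT) mz s0 (fun D E GD mE => indep a b D E a0 ab bT GD mE)
   (index_enum 'I_r) K S0 (index_enum_uniq _) Ksym mS0.
by rewrite sE.
Qed.

End wiener_step.

Lemma measurable_ge_set {R : realType} {d} {Omega : measurableType d} (f : Omega -> R) (c : R) :
  measurable_fun setT f -> measurable [set o | c <= f o].
Proof.
move=> mf; rewrite -[X in measurable X]setTI.
have -> : [set o | c <= f o] = f @^-1` `[c, +oo[.
  by apply/seteqP; split => o /=; rewrite in_itv/= andbT.
exact: mf.
Qed.

Lemma markov_ge0 {R : realType} {d} {Omega : measurableType d} (P : probability Omega R)
    (f : Omega -> R) (c M : R) :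
  measurable_fun setT f -> (forall o, 0 <= f o) -> 0 < c ->
  (\int[P]_o (f o)%:E <= M%:E)%E -> (P [set o | c <= f o]%R <= (M / c)%:E)%E.
Proof.
move=> mf f0 c0 hM.
have := @le_integral_abse _ _ _ P setT measurableT (EFin \o f) c ((measurable_EFinP _ _).2 mf) c0.
have -> : setT `&` [set x | (c%:E <= `|(EFin \o f) x|)%E] = [set o | c <= f o].
  by rewrite setTI; apply/seteqP; split => o /=; rewrite lee_fin ger0_norm.
under eq_integral do rewrite /= ger0_norm//.
move=> h; have h2 : (c%:E * P [set o | (c <= f o)%R] <= M%:E)%E := le_trans h hM.
move: h2 => {h hM}.
have mA := measurable_ge_set c mf.
have fin : P [set o | c <= f o] \is a fin_num by exact: fin_num_measure.
move: fin; case: (P _) => [x| |]// _.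
by rewrite -EFinM !lee_fin ler_pdivlMr// mulrC.
Qed.

(** * Lenglart's inequality for step integrals *)

Section lenglart.
Context {R : realType} {d : measure_display} {Omega : measurableType d}.
Variables (P : probability Omega R) (T : R) (F : R -> set (set Omega)).
Context {p r : nat}.
Variable w : R -> Omega -> 'cV[R]_r.
Hypothesis F_filtration : filtration T F.
Hypothesis w_wiener : wiener_process P T F w.
Variables (t : R) (H : @step_process R d Omega p r).
Hypothesis tT : t <= T.
Hypothesis H_step : nonanticipative_step F t H.

Definition step_psum (k : nat) (o : Omega) : 'cV[R]_p :=
  \sum_(i < k) sp_coef H i o *m (w (sp_time H i.+1) o - w (sp_time H i) o).

Section stopping.
Variables (e eta : R).

(** A martingale transform: cell i is kept while the energy including that cell is at most eta and
    the sum so far lies in the ball. Both conditions are known at the start of the cell, and neither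
    holds again once it has failed. *)
Fixpoint stopped_psum (k : nat) (o : Omega) : 'cV[R]_p :=
  if k is i.+1 then
    stopped_psum i o + ((step_energy H i.+1 o <= eta)%R && (sqnorm (stopped_psum i o) < e ^+ 2)%R)%:R *:
      (sp_coef H i o *m (w (sp_time H i.+1) o - w (sp_time H i) o))
  else 0.

Let chi i o : R := ((step_energy H i.+1 o <= eta)%R && (sqnorm (stopped_psum i o) < e ^+ 2)%R)%:R.

Let time_itv i : (i <= sp_size H)%N -> 0 <= sp_time H i <= T.
Proof.
by move=> iH; rewrite (sp_time_ge0 H_step iH) (le_trans (sp_time_le_end H_step iH)).
Qed.

Let time_lt i : (i < sp_size H)%N -> sp_time H i <= sp_time H i.+1.
Proof. by move=> iH; exact: (sp_time_le H_step). Qed.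

Let coef_smeas i a b : (i < sp_size H)%N -> smeas (F (sp_time H i)) (fun o => sp_coef H i o a b).
Proof.
move=> iH; have [sF _ _] := F_filtration.
apply/smeasP; first by apply: sF; apply: time_itv; exact: ltnW.
by have [_ _ _] := H_step; apply.
Qed.

Lemma smeas_sqnorm q q' (G : set (set Omega)) (M : Omega -> 'M[R]_(q, q')) :
  (forall i j, smeas G (fun o => M o i j)) -> smeas G (fun o => sqnorm (M o)).
Proof.
by move=> mM; apply: smeas_sum => i; apply: smeas_sum => j; exact: smeasX.
Qed.

Lemma step_energy_smeas i : (i < sp_size H)%N -> smeas (F (sp_time H i)) (step_energy H i.+1).
Proof.
elim: i => [|i IH] iH.
  rewrite /step_energy; under [X in smeas _ X]eq_fun do rewrite big_ord_recr big_ord0.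
  apply: smeasD; first exact: smeas_cst.
  by apply: smeasM; [apply: smeas_sqnorm => a b; exact: coef_smeas|exact: smeas_cst].
have -> : step_energy H i.+2 = fun o => step_energy H i.+1 o + sqnorm (sp_coef H i.+1 o) * (sp_time H i.+2 - sp_time H i.+1).
  by apply/funext => o; rewrite /step_energy big_ord_recr.
have /andP[a0 _] := time_itv (ltnW (ltnW iH)); have /andP[_ bT] := time_itv (ltnW iH).
apply: smeasD; last by apply: smeasM; [apply: smeas_sqnorm => a b; exact: coef_smeas|exact: smeas_cst].
apply: (@filtration_smeas_le _ _ _ T F F_filtration (sp_time H i)) => //; first exact: (time_lt (ltnW iH)).
exact: (IH (ltnW iH)).
Qed.

Let stopped_smeas i a : (i <= sp_size H)%N -> smeas (F (sp_time H i)) (fun o => stopped_psum i o a 0).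
Proof.
elim: i a => [|i IH] a iH.
  by under [X in smeas _ X]eq_fun do rewrite /= mxE; exact: smeas_cst.
have /andP[a0 aT] := time_itv (ltnW iH); have /andP[b0 bT] := time_itv iH.
have up (f : Omega -> R) : smeas (F (sp_time H i)) f -> smeas (F (sp_time H i.+1)) f.
  by apply: (@filtration_smeas_le _ _ _ T F F_filtration); [|exact: time_lt|].
under [X in smeas _ X]eq_fun do rewrite /= !mxE.
apply: smeasD; first by apply: up; apply: IH; exact: ltnW.
apply: smeasM.
  apply: up; under [X in smeas _ X]eq_fun do rewrite -mulnb natrM.
  apply: smeasM; first by apply: smeas_indic_le; exact: step_energy_smeas.
  apply: smeas_indic_lt; apply: smeas_sqnorm => a' j; rewrite (ord1 j); apply: IH; exact: ltnW.
apply: smeas_sum => j; apply: smeasM; first by apply: up; exact: coef_smeas.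
under [X in smeas _ X]eq_fun do rewrite !mxE.
apply: smeasB; first by apply: (wiener_smeas F_filtration w_wiener); rewrite b0.
by apply: up; apply: (wiener_smeas F_filtration w_wiener); rewrite a0.
Qed.

Let chi_smeas i : (i < sp_size H)%N -> smeas (F (sp_time H i)) (chi i).
Proof.
move=> iH; rewrite /chi; under [X in smeas _ X]eq_fun do rewrite -mulnb natrM.
apply: smeasM; first by apply: smeas_indic_le; exact: step_energy_smeas.
by apply: smeas_indic_lt; apply: smeas_sqnorm => a' j; rewrite (ord1 j); apply: stopped_smeas; exact: ltnW.
Qed.

Let stopped_energy k o := \sum_(i < k) chi i o * (sqnorm (sp_coef H i o) * (sp_time H i.+1 - sp_time H i)).

(** If the last cell is kept, the full energy up to it is at most eta and dominates the stopped one;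
    otherwise nothing is added. *)
Let stopped_energy_le k o : 0 <= eta -> (k <= sp_size H)%N -> stopped_energy k o <= eta.
Proof.
move=> eta0; have term i : (i < sp_size H)%N -> 0 <= sqnorm (sp_coef H i o) * (sp_time H i.+1 - sp_time H i).
  by move=> iH; rewrite mulr_ge0 ?sqnorm_ge0// subr_ge0 time_lt.
elim: k => [|k IH] kH; first by rewrite /stopped_energy big_ord0.
rewrite /stopped_energy big_ord_recr /=; rewrite {2}/chi.
case: andP => [[h _]|_]; last by rewrite mul0r addr0; exact: IH (ltnW kH).
rewrite mul1r; apply: le_trans h; rewrite /step_energy big_ord_recr/= lerD2r.
apply: ler_sum => i _; rewrite ler_piMl//; first by apply: term; exact: ltn_trans kH.
by rewrite /chi lern1 leq_b1.
Qed.

Let stopped_energy_meas k : (k <= sp_size H)%N -> measurable_fun setT (stopped_energy k).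
Proof.
move=> kH; apply: measurable_sum => i.
have iH : (i < sp_size H)%N := leq_trans (ltn_ord i) kH.
apply: (filtration_smeas_measurable F_filtration (time_itv (ltnW iH))).
apply: smeasM; first exact: chi_smeas.
by apply: smeasM; [apply: smeas_sqnorm => a j; exact: coef_smeas|exact: smeas_cst].
Qed.

Lemma sum_sqnorm_cV (v : 'cV[R]_p) : sqnorm v = \sum_(a < p) v a 0 ^+ 2.
Proof. by apply: eq_bigr => a _; rewrite big_ord1. Qed.

(** The Ito isometry for the stopped sum, cell by cell: each coordinate is an instance of
    [integral_wiener_tilt] with weight 1 and no tilt. *)
Let integral_stopped k : (k <= sp_size H)%N ->
  (\int[P]_o (sqnorm (stopped_psum k o))%:E = \int[P]_o (stopped_energy k o)%:E)%E.
Proof.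
have ge0 i o : (i < sp_size H)%N -> 0 <= chi i o * (sqnorm (sp_coef H i o) * (sp_time H i.+1 - sp_time H i)).
  by move=> iH; rewrite !mulr_ge0 ?sqnorm_ge0 ?ler0n// subr_ge0 time_lt.
elim: k => [|k IH] kH.
  by apply: eq_integral => o _; rewrite /= sqnorm0 /stopped_energy big_ord0.
have kH' := ltnW kH.
have /andP[a0 aT] := time_itv kH'; have /andP[b0 bT] := time_itv kH.
have ms (f : Omega -> R) : smeas (F (sp_time H k)) f -> measurable_fun setT f.
  by apply: (filtration_smeas_measurable F_filtration); rewrite a0.
have mcoef (a : 'I_p) j : smeas (F (sp_time H k)) (fun o => chi k o * sp_coef H k o a j).
  by apply: smeasM; [exact: chi_smeas|exact: coef_smeas].
have hl := time_lt kH.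
have step (a : 'I_p) : (\int[P]_o ((stopped_psum k.+1 o a 0) ^+ 2)%:E =
   \int[P]_o ((stopped_psum k o a 0) ^+ 2 + (sp_time H k.+1 - sp_time H k) * \sum_j (chi k o * sp_coef H k o a j) ^+ 2)%:E)%E.
  have := @integral_wiener_tilt _ _ _ P T F r w F_filtration w_wiener (sp_time H k) (sp_time H k.+1)
     (fun=> 1) (fun o => stopped_psum k o a 0) (fun _ _ => 0) (fun j o => chi k o * sp_coef H k o a j)
     a0 hl bT (@smeas_cst _ _ _ _ _) (stopped_smeas a kH') (fun=> @smeas_cst _ _ _ _ _) (mcoef a) (fun=> ler01).
  move=> h; transitivity (\int[P]_o (1 * expR (\sum_j (0 * (w (sp_time H k.+1) o j 0 - w (sp_time H k) o j 0) - 0 ^+ 2 * (sp_time H k.+1 - sp_time H k) / 2))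
      * (stopped_psum k o a 0 + \sum_j chi k o * sp_coef H k o a j * (w (sp_time H k.+1) o j 0 - w (sp_time H k) o j 0)) ^+ 2)%:E)%E.
    apply: eq_integral => o _; congr EFin; rewrite big1; last by move=> j _; rewrite expr0n !mul0r subrr.
    rewrite expR0 !mul1r /= !mxE -/(chi k o) mulr_sumr; congr ((_ + _) ^+ 2).
    by apply: eq_bigr => j _; rewrite !mxE mulrA.
  rewrite h; apply: eq_integral => o _; congr EFin; rewrite mul1r.
  by rewrite [\sum_j _ * 0]big1 ?mulr0 ?addr0// => j _; rewrite mulr0.
transitivity (\int[P]_o (\sum_(a < p) ((stopped_psum k.+1 o a 0) ^+ 2)%:E))%E.
  by apply: eq_integral => o _; rewrite sumEFin sum_sqnorm_cV.
rewrite ge0_integral_sum//; last 2 first.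
- move=> a; apply/measurable_EFinP; apply: (filtration_smeas_measurable F_filtration (a := sp_time H k.+1)); first by rewrite b0.
  by apply: smeasX; exact: stopped_smeas.
- by move=> a o _; rewrite lee_fin sqr_ge0.
under eq_bigr do rewrite step.
rewrite -ge0_integral_sum//; last 2 first.
- move=> a; apply/measurable_EFinP; apply: ms; apply: smeasD; first by apply: smeasX; exact: stopped_smeas.
  by apply: smeasM; [exact: smeas_cst|apply: smeas_sum => j; exact: smeasX].
- move=> a o _; rewrite lee_fin addr_ge0 ?sqr_ge0// mulr_ge0 ?subr_ge0// sumr_ge0// => j _; exact: sqr_ge0.
transitivity (\int[P]_o ((sqnorm (stopped_psum k o))%:E + (chi k o * (sqnorm (sp_coef H k o) * (sp_time H k.+1 - sp_time H k)))%:E))%E.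
  apply: eq_integral => o _; rewrite sumEFin -EFinD; congr EFin.
  rewrite big_split/= sum_sqnorm_cV; congr (_ + _).
  rewrite -mulr_sumr mulrA [RHS]mulrC; congr (_ * _); rewrite /sqnorm mulr_sumr.
  apply: eq_bigr => a _; rewrite mulr_sumr; apply: eq_bigr => j _.
  by rewrite exprMn; congr (_ * _); rewrite /chi; case: andP => _; rewrite ?expr1n ?expr0n.
rewrite ge0_integralD//; last 4 first.
- by move=> o _; rewrite lee_fin sqnorm_ge0.
- apply/measurable_EFinP; apply: ms; apply: smeas_sqnorm => a j; rewrite (ord1 j); exact: stopped_smeas.
- by move=> o _; rewrite lee_fin ge0.
- apply/measurable_EFinP; apply: ms; apply: smeasM; first exact: chi_smeas.
  by apply: smeasM; [apply: smeas_sqnorm => a j; exact: coef_smeas|exact: smeas_cst].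
rewrite IH// -ge0_integralD//.
- by apply: eq_integral => o _; rewrite -EFinD /stopped_energy big_ord_recr.
- by move=> o _; rewrite lee_fin sumr_ge0// => i _; apply: ge0; exact: ltn_trans kH.
- by apply/measurable_EFinP; exact: stopped_energy_meas (ltnW kH).
- by move=> o _; rewrite lee_fin ge0.
- apply/measurable_EFinP; apply: ms; apply: smeasM; first exact: chi_smeas.
  by apply: smeasM; [apply: smeas_sqnorm => a j; exact: coef_smeas|exact: smeas_cst].
Qed.

(** When the total energy is at most eta, only leaving the ball can stop the sum, and the sum then
    stays frozen outside the ball. One bound on the final stopped value therefore controls all
    partial sums. *)
Let stopped_dichotomy k o : (k <= sp_size H)%N -> step_energy H (sp_size H) o <= eta ->
  (stopped_psum k o = step_psum k o /\ forall i, (i < k)%N -> sqnorm (step_psum i o) < e ^+ 2)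
  \/ e ^+ 2 <= sqnorm (stopped_psum k o).
Proof.
move=> + hE; elim: k => [|k IH] kH; first by left; split => //; rewrite /step_psum big_ord0.
have le : step_energy H k.+1 o <= eta.
  apply: le_trans hE; rewrite /step_energy -!(big_mkord xpredT (fun i => sqnorm (sp_coef H i o) * (sp_time H i.+1 - sp_time H i))).
  rewrite (big_cat_nat _ kH)//= lerDl big_nat sumr_ge0// => i /andP[_ iH].
  by rewrite mulr_ge0 ?sqnorm_ge0// subr_ge0 time_lt.
have [h|h] := ltP (sqnorm (stopped_psum k o)) (e ^+ 2); last first.
  by right; rewrite /= le ltNge h /= scale0r addr0.
have [[eq IHk]|] := IH (ltnW kH); last by rewrite leNgt h.
left; split; first by rewrite /= le h /= scale1r eq /step_psum big_ord_recr.
move=> i; rewrite ltnS leq_eqVlt => /orP[/eqP ->|]; last exact: IHk.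
by rewrite -eq.
Qed.

(* Stopped when the energy is about to exceed eta or the partial sum has left
   the ball of radius e, the sum has second moment at most eta. *)
Lemma lenglart_stopped : 0 < e -> 0 <= eta -> exists A, [/\ measurable A, (P A <= (eta / e ^+ 2)%:E)%E &
  forall o, ~ A o -> step_energy H (sp_size H) o <= eta ->
    forall i, (i <= sp_size H)%N -> sqnorm (step_psum i o) < e ^+ 2].
Proof.
move=> e0 eta0; set q := sp_size H.
have tq := time_itv (leqnn q).
have mS : measurable_fun setT (fun o => sqnorm (stopped_psum q o)).
  apply: (filtration_smeas_measurable F_filtration tq).
  by apply: smeas_sqnorm => a j; rewrite (ord1 j); exact: stopped_smeas.
exists [set o | e ^+ 2 <= sqnorm (stopped_psum q o)]; split.
- exact: measurable_ge_set.
- apply: markov_ge0 => //; [by move=> o; exact: sqnorm_ge0|by rewrite exprn_gt0|].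
  rewrite integral_stopped//; apply: (@le_trans _ _ (\int[P]_o eta%:E)%E); last first.
    by rewrite integral_cst//= (@probability_setT _ _ _ P) mule1.
  apply: ge0_le_integral => //.
  + move=> o _; rewrite lee_fin sumr_ge0// => i _.
    by rewrite !mulr_ge0 ?sqnorm_ge0 ?ler0n// subr_ge0 time_lt.
  + apply/measurable_EFinP; exact: stopped_energy_meas.
  + by move=> o _; rewrite lee_fin; exact: stopped_energy_le.
- move=> o /= nA hE i; rewrite leq_eqVlt => /orP[/eqP ->|iq].
    by have [[<- _]|//] := stopped_dichotomy (leqnn q) hE; rewrite ltNge; apply/negP.
  by have [[_ h]|//] := stopped_dichotomy (leqnn q) hE; exact: h.
Qed.

End stopping.
End lenglart.

(** * Continuous functions and Riemann sums *)

Section continuity_on_segment.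
Context {R : realType}.
Implicit Types (t : R) (f g : R -> R).

Definition cont t f := {within `[0, t], continuous f}.

Lemma contD t f g : cont t f -> cont t g -> cont t (fun s => f s + g s).
Proof. by move=> cf cg x; apply: cvgD; [exact: cf|exact: cg]. Qed.

Lemma contM t f g : cont t f -> cont t g -> cont t (fun s => f s * g s).
Proof. by move=> cf cg x; apply: cvgM; [exact: cf|exact: cg]. Qed.

Lemma cont_cst t (c : R) : cont t (fun=> c).
Proof. by move=> x; exact: cvg_cst. Qed.

Lemma contN t f : cont t f -> cont t (fun s => - f s).
Proof. by move=> cf x; apply: cvgN; exact: cf. Qed.

Lemma contB t f g : cont t f -> cont t g -> cont t (fun s => f s - g s).
Proof. by move=> cf cg; apply: contD => //; exact: contN. Qed.

Lemma cont_sum t (I : Type) (r : seq I) (f : I -> R -> R) :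
  (forall i, cont t (f i)) -> cont t (fun s => \sum_(i <- r) f i s).
Proof.
move=> cf; elim: r => [|i r IH].
  by under eq_fun do rewrite big_nil; exact: cont_cst.
by under eq_fun do rewrite big_cons; exact: contD.
Qed.

Lemma cont_le t t' f : t' <= t -> cont t f -> cont t' f.
Proof.
move=> tt; apply: continuous_subspaceW => x /=; rewrite !in_itv/= => /andP[-> /le_trans]; exact.
Qed.

Lemma mx_norm_ltP p q (M : 'M[R]_(p, q)) (e : R) : 0 < e ->
  reflect (forall i j, `|M i j| < e) (`|M| < e).
Proof.
move=> e0; rewrite -[`|M|]/(mx_norm M) mx_normrE.
apply: (iffP idP) => [/bigmax_ltP[_ h] i j|h]; first exact: (h (i, j)).
by apply/bigmax_ltP; split => // -[i j] _; exact: h.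
Qed.

Lemma mx_norm_entry p q (M : 'M[R]_(p, q)) i j : `|M i j| <= `|M|.
Proof.
rewrite -[`|M|]/(mx_norm M) mx_normrE.
exact: (le_bigmax _ (fun ij : 'I_p * 'I_q => `|M ij.1 ij.2|) (i, j)).
Qed.

Lemma mx_cont p q t (y : R -> 'M[R]_(p, q)) :
  {within `[0, t], continuous y} <-> (forall i j, cont t (fun s => y s i j)).
Proof.
split=> [cy i j x|cy x].
  apply/cvgrPdist_lt => e e0; have /cvgrPdist_lt/(_ _ e0) := cy x.
  apply: filterS => z; apply: le_lt_trans.
  by have := mx_norm_entry (y x - y z) i j; rewrite !mxE.
apply/cvgrPdist_lt => e e0.
have h : \forall z \near nbhs (x : subspace `[0, t]), forall ij : 'I_p * 'I_q, `|y x ij.1 ij.2 - y z ij.1 ij.2| < e.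
  by apply: filter_forall => -[i j] /=; have /cvgrPdist_lt/(_ _ e0) := cy i j x.
apply: filterS h => z h; apply/mx_norm_ltP => // i j.
by have := h (i, j); rewrite !mxE.
Qed.

(** Compactness is used as a near-covering property: each x has a neighbourhood on which all small
    enough moduli work, and one modulus then serves the whole segment. *)
Lemma heine t f : cont t f -> forall e, 0 < e -> exists2 dl, 0 < dl &
  forall x y, 0 <= x <= t -> 0 <= y <= t -> `|x - y| < dl -> `|f x - f y| < e.
Proof.
move=> /subspace_continuousP cf e e0.
have := @segment_compact R 0 t; move/compact_near_coveringP => nc.
have := nc R ((0 : R)^'+) (fun dl x => 0 <= x <= t -> forall y, 0 <= y <= t -> `|x - y| < dl -> `|f x - f y| < e) _.
case.
  move=> x xA; have := cf x xA; move/cvgrPdist_lt => /(_ (e / 2)).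
  rewrite divr_gt0// => /(_ isT); rewrite near_withinE => /nbhs_ballP[eta eta0 h].
  have eta20 : 0 < eta / 2 by rewrite divr_gt0.
  exists (ball x (eta / 2), [set dl | dl < eta / 2]).
    by split; [exact: nbhsx_ballx|exact: nbhs_right_lt].
  move=> [x' dl] /= [bx' dle] x'A y yA xy.
  have hx' : `|f x - f x'| < e / 2.
    apply: h; last by rewrite /= in_itv.
    by apply: lt_trans bx' _; rewrite ltr_pdivrMr// ltr_pMr// ltrDl.
  have hy : `|f x - f y| < e / 2.
    apply: h; last by rewrite /= in_itv.
    apply: (le_lt_trans (ler_distD x' _ _)).
    have := lt_trans xy dle; move: bx'; rewrite /ball/=; lra.
  apply: (le_lt_trans (ler_distD (f x) _ _)).
  move: hx' hy; rewrite (distrC (f x) (f x')); lra.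
move=> dl /= dl0 h.
have dl20 : 0 < dl / 2 by rewrite divr_gt0.
exists (dl / 2) => // x y xA yA xy.
have b2 : ball_ [eta Num.Def.normr] 0 dl (dl / 2).
  by rewrite /= sub0r normrN gtr0_norm// ltr_pdivrMr// ltr_pMr// ltrDl.
have xA' : `[0, t]%classic x by rewrite /= in_itv.
exact: (h _ b2 dl20 x xA' xA y yA xy).
Qed.

Lemma cont_bounded t f : cont t f -> exists2 C, 0 <= C & forall s, 0 <= s <= t -> `|f s| <= C.
Proof.
move=> cf; have := continuous_compact cf (@segment_compact R 0 t).
move/compact_bounded => [M [_ hM]].
exists (`|M| + 1) => [|s sA]; first by rewrite addr_ge0.
apply: (hM (`|M| + 1)); first by rewrite (le_lt_trans (ler_norm _))// ltrDl.
by exists s => //=; rewrite in_itv.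
Qed.

Lemma cont_integrable t f : cont t f ->
  (@lebesgue_measure R).-integrable `[0, t] (EFin \o f).
Proof. by move=> cf; apply: continuous_compact_integrable => //; exact: segment_compact. Qed.

Lemma path_integralD t f g : cont t f -> cont t g ->
  path_integral t (fun s => f s + g s) = path_integral t f + path_integral t g.
Proof. by move=> cf cg; rewrite /path_integral RintegralD//; exact: cont_integrable. Qed.

Lemma path_integralZ t (c : R) f : cont t f ->
  path_integral t (fun s => c * f s) = c * path_integral t f.
Proof. by move=> cf; rewrite /path_integral RintegralZl//; exact: cont_integrable. Qed.

Lemma eq_path_integral t f g : (forall s, 0 <= s <= t -> f s = g s) ->
  path_integral t f = path_integral t g.
Proof. by move=> fg; apply: eq_Rintegral => s; rewrite inE/= in_itv/=; exact: fg. Qed.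

Definition node t (N j : nat) : R := t * j%:R / N%:R.

Lemma node_ge0 t N j : 0 <= t -> 0 <= node t N j.
Proof. by move=> t0; rewrite /node divr_ge0// mulr_ge0. Qed.

Lemma node_le t N i j : 0 <= t -> (i <= j)%N -> node t N i <= node t N j.
Proof. by move=> t0 ij; rewrite /node ler_wpM2r ?invr_ge0// ler_wpM2l// ler_nat. Qed.

Lemma node0 t N : node t N 0 = 0.
Proof. by rewrite /node mulr0 mul0r. Qed.

Lemma nodeN t N : (0 < N)%N -> node t N N = t.
Proof. by move=> N0; rewrite /node mulfK// pnatr_eq0 -lt0n. Qed.

Lemma node_itv t N j : 0 <= t -> (j <= N)%N -> 0 <= node t N j <= t.
Proof.
move=> t0 jN; rewrite node_ge0//=; have [->|N0] := posnP N.
  by rewrite /node invr0 mulr0.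
by rewrite -[leRHS](nodeN t N0) node_le.
Qed.

Lemma nodeS t N j : node t N j.+1 - node t N j = t / N%:R.
Proof. by rewrite /node -mulrBl -mulrBr -natrB// subSnn mulr1. Qed.

Lemma near_mesh_lt t (dl : R) : 0 <= t -> 0 < dl ->
  exists N0, forall N, (N0 <= N)%N -> t / N%:R < dl.
Proof.
move=> t0 dl0; have := @nbhs_infty_gtr R (t / dl).
rewrite nearE /= => -[N0 _ h]; exists N0.+1 => N NN.
have N1 : 0 < N%:R :> R by rewrite ltr0n (leq_trans _ NN).
rewrite ltr_pdivrMr// mulrC -ltr_pdivrMr//; apply: h => /=.
exact: ltnW.
Qed.

Lemma path_integral_local t f a b (c e : R) : cont t f -> 0 <= a -> a <= b -> b <= t ->
  (forall s, a <= s <= b -> `|f s - c| <= e) ->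
  `|path_integral b f - path_integral a f - c * (b - a)| <= e * (b - a).
Proof.
move=> cf a0 ab bt h.
have intb : (@lebesgue_measure R).-integrable `[0, b] (EFin \o f) by apply: cont_integrable; exact: cont_le cf.
have sub : `]a, b]%classic `<=` `[0, b]%classic.
  by move=> s /=; rewrite !in_itv/= => /andP[/ltW as_ ->]; rewrite (le_trans a0 as_).
have intab : (@lebesgue_measure R).-integrable `]a, b] (EFin \o f).
  refine (@integrableS _ _ R (@lebesgue_measure R) `[0, b]%classic `]a, b]%classic (EFin \o f) (measurable_itv _) (measurable_itv _) sub intb).
have intc (k : R) : (@lebesgue_measure R).-integrable `]a, b] (EFin \o cst k).
  refine (@integrableS _ _ R (@lebesgue_measure R) `[0, b]%classic `]a, b]%classic (EFin \o cst k) (measurable_itv _) (measurable_itv _) sub _).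
  by apply: cont_integrable; exact: cont_cst.
have lab : fine (@lebesgue_measure R `]a, b]%classic) = b - a.
  rewrite lebesgue_measure_itv/= lte_fin; case: ltP => [_|ba]//=.
  by apply/esym/eqP; rewrite subr_eq0 eq_le ba ab.
have -> : path_integral b f - path_integral a f - c * (b - a) = \int[lebesgue_measure]_(s in `]a, b]) (f s - c).
  rewrite /path_integral (@Rintegral_itvB _ f (BLeft 0) (BRight b) a)//.
  have hB := @RintegralB _ _ R (@lebesgue_measure R) `]a, b]%classic f (cst c) (measurable_itv _) intab (intc c).
  have hc := @Rintegral_cst _ _ R (@lebesgue_measure R) `]a, b]%classic (measurable_itv _) c.
  by rewrite [RHS]hB hc lab.
have intd : (@lebesgue_measure R).-integrable `]a, b] (EFin \o (fun s => f s - c)).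
  by have := @integrableB _ _ R (@lebesgue_measure R) `]a, b]%classic (measurable_itv _) _ _ intab (intc c); apply: eq_integrable.
apply: (le_trans (le_normr_Rintegral _ _)) => //.
apply: (@le_trans _ _ (\int[lebesgue_measure]_(s in `]a, b]) e)).
  apply: le_Rintegral => //.
  - exact: (integrable_abse intd).
  - exact: (intc e).
  - by move=> s /=; rewrite in_itv/= => /andP[/ltW as_ sb]; apply: h; rewrite as_ sb.
by rewrite Rintegral_cst// lab.
Qed.

(** The threshold is uniform in the upper node j, as Gronwall's inequality requires later. The error
    over the first j cells is bounded proportionally to the length of [0, node j]. *)
Lemma riemann_sum t f : 0 <= t -> cont t f -> forall e, 0 < e ->
  exists N0, forall N, (0 < N)%N -> (N0 <= N)%N -> forall j, (j <= N)%N ->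
  `|path_integral (node t N j) f - \sum_(i < j) f (node t N i) * (t / N%:R)| <= e.
Proof.
move=> t0 cf e e0.
(* Dividing by t + 1 rather than t covers t = 0. *)
have e'0 : 0 < e / (t + 1) by rewrite divr_gt0// ltr_wpDl.
have [dl dl0 hdl] := heine cf e'0.
have [N0 hN0] := near_mesh_lt t0 dl0.
exists N0 => N Npos NN j jN.
suff : `|path_integral (node t N j) f - \sum_(i < j) f (node t N i) * (t / N%:R)| <= e / (t + 1) * node t N j.
  move/le_trans; apply; have /andP[n0 nt] := node_itv t0 jN.
  rewrite mulrAC ler_pdivrMr ?ltr_wpDl// ler_wpM2l ?(ltW e0)//.
  by rewrite (le_trans nt)// lerDl.
elim: j jN => [|j IH] jN.
  rewrite big_ord0 subr0 node0 mulr0 /path_integral set_itv1 Rintegral_set1 normr0//.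
rewrite big_ord_recr/=; have IHj := IH (ltnW jN).
have /andP[a0 aT] := node_itv t0 (ltnW jN); have /andP[b0 bT] := node_itv t0 jN.
have h : forall s, node t N j <= s <= node t N j.+1 -> `|f s - f (node t N j)| <= e / (t + 1).
  move=> s /andP[s1 s2]; apply: ltW; apply: hdl; rewrite ?a0 ?aT ?(le_trans a0)// ?(le_trans s2)//.
  rewrite ger0_norm ?subr_ge0//; apply: le_lt_trans (hN0 _ NN).
  by rewrite -(nodeS t N j) lerD2r.
have := path_integral_local cf a0 (node_le N t0 (leqnSn j)) bT h.
rewrite nodeS => h2.
have -> : e / (t + 1) * node t N j.+1 = e / (t + 1) * node t N j + e / (t + 1) * (t / N%:R).
  by rewrite -mulrDr -(nodeS t N j); congr (_ * _); rewrite addrC subrK.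
apply: le_trans (lerD IHj h2); apply: le_trans (ler_normD _ _).
rewrite le_eqVlt; apply/orP; left; apply/eqP; congr `|_|; ring.
Qed.

End continuity_on_segment.

(** * Convergence in probability *)

Section convergence_in_probability.
Context {R : realType} {d : measure_display} {Omega : measurableType d}.
Variable P : probability Omega R.
Implicit Types X Y : nat -> Omega -> R.

(* Convergence in probability to 0, phrased with exceptional events so that it
   makes sense without measurability of [X n]. *)
Definition cvgp X : Prop := forall e : R, 0 < e -> exists N, forall n, (N <= n)%N ->
  exists A, [/\ measurable A, (P A <= e%:E)%E & forall o, ~ A o -> `|X n o| <= e].

Lemma cvgp_le X Y : cvgp X -> (exists N, forall n, (N <= n)%N -> forall o, `|Y n o| <= `|X n o|) -> cvgp Y.
Proof.
move=> hX [N hY] e e0; have [N' hN'] := hX e e0.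
exists (maxn N N') => n; rewrite geq_max => /andP[nN nN'].
have [A [mA PA hA]] := hN' n nN'; exists A; split => // o nAo.
by apply: le_trans (hA o nAo); exact: hY.
Qed.

Lemma cvgpD X Y : cvgp X -> cvgp Y -> cvgp (fun n o => X n o + Y n o).
Proof.
move=> hX hY e e0; have e20 : 0 < e / 2 by rewrite divr_gt0.
have [N hN] := hX _ e20; have [N' hN'] := hY _ e20.
exists (maxn N N') => n; rewrite geq_max => /andP[nN nN'].
have [A [mA PA hA]] := hN n nN; have [B [mB PB hB]] := hN' n nN'.
exists (A `|` B); split; first exact: measurableU.
  apply: (le_trans (measureU2 _ mA mB)); apply: (le_trans (leeD PA PB)).
  by rewrite -EFinD lee_fin; lra.
move=> o nAB; apply: (le_trans (ler_normD _ _)).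
have hAo := hA o (fun h => nAB (or_introl h)); have hBo := hB o (fun h => nAB (or_intror h)).
by move: hAo hBo; lra.
Qed.

Lemma cvgpZ (c : R) X : cvgp X -> cvgp (fun n o => c * X n o).
Proof.
move=> hX e e0.
have k0 : 0 < Num.min e (e / (`|c| + 1)) by rewrite lt_min e0 divr_gt0// ltr_wpDl.
have [N hN] := hX _ k0; exists N => n nN; have [A [mA PA hA]] := hN n nN.
exists A; split => //.
  by apply: (le_trans PA); rewrite lee_fin ge_min lexx.
move=> o nA; rewrite normrM; have := hA o nA; rewrite le_min => /andP[_].
rewrite ler_pdivlMr ?ltr_wpDl// mulrDr mulr1 mulrC => h.
by apply: le_trans h; rewrite lerDl.
Qed.

(** Borel-Cantelli: the k-th chosen index has an exceptional event of probability at most 2^-(k+1),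
    so almost surely only finitely many of them occur. The bound n <= phi n makes meshes indexed
    along phi still tend to 0. *)
Lemma cvgp_subseq X : cvgp X -> exists2 phi : nat -> nat, (forall n, (n <= phi n)%N) &
  {ae P, forall o, X (phi n) o @[n --> \oo] --> (0 : R)}.
Proof.
move=> hX.
have h k : exists N, (k <= N)%N /\ exists A, [/\ measurable A, (P A <= (1 / (2 ^ k.+1)%:R)%:E)%E & forall o, ~ A o -> `|X N o| <= 1 / (2 ^ k.+1)%:R].
  have e0 : 0 < 1 / (2 ^ k.+1)%:R :> R by rewrite divr_gt0// ltr0n expn_gt0.
  have [N hN] := hX _ e0; exists (maxn N k); split; first exact: leq_maxr.
  by apply: hN; exact: leq_maxl.
have [phi hphi] := choice h.
have [A hA] := choice (fun k => (hphi k).2).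
exists phi => [n|]; first by have [] := hphi n.
have sA : P (lim_sup_set A) = 0%E.
  apply: lim_sup_set_cvg0 => [k|]; first by have [] := hA k.
  apply: (@le_lt_trans _ _ (1%:E)%E); last exact: ltry.
  apply: le_trans (epsilon_trick0 xpredT (ler01 : (0:R) <= 1)).
  by apply: lee_nneseries => // k _; have [] := hA k.
exists (lim_sup_set A); split => //.
  apply: bigcap_measurable => // k _; apply: bigcup_measurable => j _.
  by have [] := hA j.
move=> o /= no; apply: contrapT => nlim; apply: no.
have : exists n, forall j, (n <= j)%N -> ~ A j o.
  apply: contrapT => /forallNP nex; apply: nlim => n _.
  have := nex n => /existsNP[j /not_implyP[nj /contrapT Aj]].
  by exists j.
move=> [n hn]; apply/cvgrPdist_le => e e0.
have := @nbhs_infty_gtr R (1 / e); rewrite nearE => -[M _ hM].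
exists (maxn n M) => // j /=; rewrite geq_max => /andP[nj Mj].
rewrite sub0r normrN; have [_ _ /(_ o (hn j nj))] := hA j.
move/le_trans; apply; have e1 := hM j Mj.
rewrite ler_pdivrMr ?ltr0n ?expn_gt0// -ler_pdivrMl//.
rewrite mulr1; move: e1; rewrite /= div1r => /ltW/le_trans; apply.
by rewrite ler_nat; apply: ltnW; apply: (ltn_trans (ltnSn j)); exact: ltn_expl.
Qed.

Lemma cvgp_cst_eq0 (Z : Omega -> R) : cvgp (fun=> Z) -> {ae P, forall o, Z o = 0}.
Proof.
move=> /cvgp_subseq[phi _]; apply: filterS => o h.
by rewrite -(cvg_lim (@Rhausdorff R) h) lim_cst.
Qed.

(** The event that |X k| >= e infinitely often is null; continuity from above makes the tail unions
    small, and a tail union is the exceptional event. *)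
Lemma ae_cvgp X : (forall n, measurable_fun setT (X n)) ->
  {ae P, forall o, X n o @[n --> \oo] --> (0 : R)} -> cvgp X.
Proof.
move=> mX hX e e0.
pose Fk k := [set o | e <= `|X k o|].
have mF k : measurable (Fk k) by apply: measurable_ge_set; exact: measurableT_comp.
have lim0 : P (lim_sup_set Fk) = 0%E.
  have [N [mN PN hN]] := hX.
  have mL : measurable (lim_sup_set Fk).
    by apply: bigcap_measurable => // k _; apply: bigcup_measurable => j _.
  apply/eqP; rewrite eq_le measure_ge0 andbT -PN; apply: le_measure; rewrite ?inE//.
  move=> o hL; apply: hN => /= /cvgrPdist_lt/(_ _ e0); rewrite nearE => -[n _ hn].
  have [j /= nj] := hL n I; rewrite /Fk /=.
  by have := hn j nj; rewrite /= sub0r normrN ltNge => /negP.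
have cv := lim_sup_set_cvg P Fk mF.
have /fine_cvgP[_ /cvgrPdist_lt/(_ _ e0)] : P (\bigcup_(k in [set k | (n <= k)%N]) Fk k) @[n --> \oo] --> 0%E.
  rewrite -lim0; apply: cv; apply: (le_lt_trans (probability_le1 _ _)); last exact: ltry.
  exact: bigcup_measurable.
rewrite nearE => -[N _ hN]; exists N => n Nn.
have mA : measurable (\bigcup_(k in [set k | (N <= k)%N]) Fk k) by exact: bigcup_measurable.
exists (\bigcup_(k in [set k | (N <= k)%N]) Fk k); split => //.
  have := hN N (leqnn N); rewrite /= sub0r normrN ger0_norm ?fine_ge0// => /ltW.
  by rewrite -lee_fin fineK// fin_num_measure.
move=> o nA; rewrite leNgt; apply/negP => h; apply: nA; exists n => //; exact: ltW.
Qed.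

Lemma cvgp_of_probability (V : normedModType R) (X : nat -> Omega -> V) (Y : Omega -> V) :
  (forall n, measurable_fun setT (fun o => `|X n o - Y o|)) ->
  cvg_in_probability P X Y -> cvgp (fun n o => `|X n o - Y o|).
Proof.
move=> mX hX e e0; have /fine_cvgP[_ /cvgrPdist_lt/(_ _ e0)] := hX e e0.
rewrite nearE => -[N _ hN]; exists N => n Nn.
have mA : measurable [set o | e <= `|X n o - Y o|] by exact: measurable_ge_set.
exists [set o | e <= `|X n o - Y o|]; split => //.
  have := hN n Nn; rewrite /= sub0r normrN ger0_norm ?fine_ge0// => /ltW.
  by rewrite -lee_fin fineK// fin_num_measure.
by move=> o /= /negP; rewrite -ltNge normr_id => /ltW.
Qed.

Lemma probability_of_cvgp (V : normedModType R) (X : nat -> Omega -> V) (Y : Omega -> V) :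
  (forall n, measurable_fun setT (fun o => `|X n o - Y o|)) ->
  cvgp (fun n o => `|X n o - Y o|) -> cvg_in_probability P X Y.
Proof.
move=> mX hX e e0; apply/fine_cvgP; split.
  by apply: nearW => n; apply: fin_num_measure; exact: measurable_ge_set.
apply/cvgrPdist_le => e' e'0.
have k0 : 0 < Num.min (e / 2) e' by rewrite lt_min divr_gt0.
have [N hN] := hX _ k0; exists N => // n Nn.
have [A [mA PA hA]] := hN n Nn.
rewrite /= sub0r normrN ger0_norm ?fine_ge0//.
have mE : measurable [set o | e <= `|X n o - Y o|] by exact: measurable_ge_set.
rewrite -lee_fin fineK ?fin_num_measure//.
apply: (@le_trans _ _ (P A)).
  apply: le_measure; rewrite ?inE// => o /= eo; apply: contrapT => nA.
  have := hA o nA; rewrite normr_id le_min => /andP[h _]; move: eo h; lra.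
by apply: (le_trans PA); rewrite lee_fin ge_min lexx orbT.
Qed.

End convergence_in_probability.

(** * Joint measurability and integrals along paths *)

Section measurable_path_integral.
Context {R : realType} {d : measure_display} {Omega : measurableType d}.
Variable t : R.
Implicit Types f g : R -> Omega -> R.
Hypothesis t0 : 0 <= t.

(** The process is cut off outside [0, t] because its measurability and path continuity are known
    only there. *)
Definition jmeas f := measurable_fun setT (fun u : Omega * R => f u.2 u.1 * \1_(`[0, t]%classic) u.2).

Lemma measurable_indic_snd (A : set R) : measurable A ->
  measurable_fun setT (fun u : Omega * R => \1_A u.2 : R).
Proof.
by move=> mA; apply: (measurableT_comp (measurable_indic mA)); exact: measurable_snd.
Qed.

Lemma jmeasD f g : jmeas f -> jmeas g -> jmeas (fun s o => f s o + g s o).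
Proof.
move=> mf mg; rewrite /jmeas; under eq_fun do rewrite mulrDl.
exact: measurable_funD.
Qed.

Lemma jmeasM f g : jmeas f -> jmeas g -> jmeas (fun s o => f s o * g s o).
Proof.
move=> mf mg; rewrite /jmeas.
have -> : (fun u : Omega * R => f u.2 u.1 * g u.2 u.1 * \1_(`[0, t]%classic) u.2) =
  (fun u => (f u.2 u.1 * \1_(`[0, t]%classic) u.2) * (g u.2 u.1 * \1_(`[0, t]%classic) u.2)).
  apply/funext => u; rewrite mulrACA; congr (_ * _); rewrite indicE.
  by case: (_ \in _); rewrite ?mulr1 ?mulr0.
exact: measurable_funM.
Qed.

Lemma jmeas_cst (c : R) : jmeas (fun _ _ => c).
Proof. by apply: measurable_funM => //; apply: measurable_indic_snd. Qed.

Lemma jmeasB f g : jmeas f -> jmeas g -> jmeas (fun s o => f s o - g s o).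
Proof.
move=> mf mg; apply: jmeasD => //.
have -> : (fun s o => - g s o) = (fun s o => -1 * g s o) by apply/funext => s; apply/funext => o; rewrite mulN1r.
by apply: jmeasM => //; exact: jmeas_cst.
Qed.

Lemma jmeas_sum (I : Type) (r : seq I) (f : I -> R -> Omega -> R) :
  (forall i, jmeas (f i)) -> jmeas (fun s o => \sum_(i <- r) f i s o).
Proof.
move=> mf; elim: r => [|i r IH].
  by rewrite /jmeas; under eq_fun do rewrite big_nil; exact: jmeas_cst.
rewrite /jmeas; under eq_fun do rewrite big_cons.
exact: (jmeasD (mf i) IH).
Qed.

Lemma jmeas_step (A : set R) (xi : Omega -> R) : measurable A -> measurable_fun setT xi ->
  jmeas (fun s o => \1_A s * xi o).
Proof.
move=> mA mxi; apply: measurable_funM; last exact: measurable_indic_snd.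
by apply: measurable_funM; [exact: measurable_indic_snd|apply: measurableT_comp mxi _; exact: measurable_fst].
Qed.

Lemma node_cover (N : nat) (s : R) : (0 < N)%N -> 0 < s <= t ->
  exists2 k : 'I_N, node t N k < s & s <= node t N k.+1.
Proof.
move=> N0 /andP[s0 st].
have ex : exists n, (s <= node t N n)%R by exists N; rewrite nodeN.
have [[|k] hk mk] := ex_minnP ex.
  by move: hk; rewrite node0 leNgt s0.
have kN : (k < N)%N by apply: mk; rewrite nodeN.
exists (Ordinal kN) => //=; rewrite ltNge; apply/negP => h.
by have := mk _ h; rewrite ltnn.
Qed.

Lemma sum_node_indic (N : nat) (s : R) (a : nat -> R) (k : 'I_N) :
  node t N k < s -> s <= node t N k.+1 ->
  \sum_(j < N) \1_(`]node t N j, node t N j.+1]%classic) s * a j = a k.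
Proof.
move=> h1 h2; rewrite (bigD1 k)//= indicE mem_set ?mul1r; last by rewrite /= in_itv/= h1.
rewrite big1 ?addr0// => j jk; rewrite indicE memNset ?mul0r//= in_itv/= => /andP[g1 g2].
have [kj|kj|kj] := ltngtP k j; last by move/eqP: jk; apply; exact/esym/val_inj.
  by have := node_le N t0 kj; move: h2 g1; lra.
by have := node_le N t0 kj; move: g2 h1; lra.
Qed.

(* A process with continuous paths is the pointwise limit of its left-point
   discretizations, which are jointly measurable. *)
Lemma jmeas_continuous f : (forall s, 0 <= s <= t -> measurable_fun setT (f s)) ->
  (forall o, cont t (f ^~ o)) -> jmeas f.
Proof.
move=> mf cf.
(* The cells are open on the left, so time 0 gets a term of its own. *)
pose g N s o := \1_[set (0 : R)] s * f 0 o + \sum_(j < N.+1) \1_(`]node t N.+1 j, node t N.+1 j.+1]%classic) s * f (node t N.+1 j) o.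
have mg N : jmeas (g N).
  apply: jmeasD.
    by apply: jmeas_step => //; apply: mf; rewrite lexx.
  apply: jmeas_sum => j; apply: jmeas_step => //.
  by apply: mf; apply: node_itv => //; exact: ltnW.
apply: (measurable_fun_cvg mg) => u _; case: u => o s; rewrite /g /=.
have iE : \1_(`[0, t]%classic) s = (s \in `[0, t]%classic)%:R :> R by rewrite indicE.
move: iE; have [sA|sA] := boolP (s \in `[0, t]%classic) => iE; rewrite !iE; last first.
  rewrite mulr0; under eq_cvg do rewrite mulr0; exact: cvg_cst.
rewrite mulr1; under eq_cvg do rewrite mulr1.
move: sA; rewrite inE /= in_itv/= => /andP[s0 st].
move: s0; rewrite le_eqVlt => /orP[/eqP s0|s0].
  rewrite -s0; apply: cvg_near_cst; apply: nearW => N.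
  rewrite indicE mem_set// mul1r big1 ?addr0// => j _.
  rewrite indicE memNset ?mul0r//= in_itv/= => /andP[h _].
  by have := node_ge0 N.+1 j t0; rewrite leNgt h.
have z : \1_[set (0 : R)] s = 0 :> R.
  by rewrite indicE memNset//= => h; rewrite h ltxx in s0.
apply/cvgrPdist_lt => e e0; have [dl dl0 hdl] := heine (cf o) e0.
have [N0 hN0] := near_mesh_lt t0 dl0.
exists N0 => // N /= NN; rewrite z mul0r add0r.
have [|k k1 k2] := @node_cover N.+1 s isT; first by rewrite s0.
rewrite (@sum_node_indic N.+1 s (fun j => f (node t N.+1 j) o) k)//.
apply: hdl; rewrite ?(ltW s0) ?st ?node_itv//; first exact: ltnW.
rewrite gtr0_norm ?subr_gt0//; apply: le_lt_trans (hN0 N.+1 (leq_trans NN (leqnSn _))).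
by rewrite -(nodeS t N.+1 k) lerD2r.
Qed.

(** Tonelli's theorem gives measurability for nonnegative integrands; it is applied to the positive
    and negative parts separately. *)
Lemma measurable_path_integral f : jmeas f -> measurable_fun setT (fun o => path_integral t (f ^~ o)).
Proof.
move=> mf.
pose h (u : Omega * R) : \bar R := (f u.2 u.1 * \1_(`[0, t]%classic) u.2)%:E.
have mh : measurable_fun setT h by exact/measurable_EFinP.
have e o : path_integral t (f ^~ o) = fine (\int[lebesgue_measure]_s h (o, s))%E.
  rewrite /path_integral /Rintegral integral_mkcond; congr fine.
  apply: eq_integral => s _; rewrite /h /= /patch indicE.
  by case: ifP => _; rewrite ?mulr1 ?mulr0.
rewrite (_ : (fun o => _) = (fun o => fine (\int[lebesgue_measure]_s h (o, s))%E)); last by apply/funext => o; exact: e.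
apply: measurableT_comp => //.
under eq_fun do rewrite integralE.
have pos (k : Omega * R -> \bar R) : measurable_fun setT k -> (forall u, 0 <= k u)%E ->
    measurable_fun setT (fun o => \int[@lebesgue_measure R]_s k (o, s))%E.
  by move=> mk k0; exact: measurable_fun_fubini_tonelli_F.
apply: emeasurable_funB.
  have hp := pos (h^\+)%E (measurable_funepos mh) (funepos_ge0 h).
  by refine (eq_ind _ (measurable_fun setT) hp _ _); apply/funext => o; apply: eq_integral => s _; rewrite !funeposE.
have hn := pos (h^\-)%E (measurable_funeneg mh) (funeneg_ge0 h).
by refine (eq_ind _ (measurable_fun setT) hn _ _); apply/funext => o; apply: eq_integral => s _; rewrite !funenegE.
Qed.

End measurable_path_integral.

(** * The squared Frobenius norm against the maximum norm *)

Section sqnorm_theory.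
Context {R : realType}.

Lemma sqnormD_le p q (M N : 'M[R]_(p, q)) : sqnorm (M + N) <= 2 * sqnorm M + 2 * sqnorm N.
Proof.
rewrite /sqnorm !mulr_sumr -big_split/=; apply: ler_sum => i _.
rewrite !mulr_sumr -big_split/=; apply: ler_sum => j _; rewrite mxE.
set a := M i j; set b := N i j.
have : 0 <= (a - b) ^+ 2 by exact: sqr_ge0.
rewrite -subr_ge0; lra.
Qed.

Lemma sqnormN p q (M : 'M[R]_(p, q)) : sqnorm (- M) = sqnorm M.
Proof. by apply: eq_bigr => i _; apply: eq_bigr => j _; rewrite mxE sqrrN. Qed.

Lemma sqnormB_le p q (M N : 'M[R]_(p, q)) : sqnorm (M - N) <= 2 * sqnorm M + 2 * sqnorm N.
Proof. by rewrite -[in X in _ <= X](sqnormN N); exact: sqnormD_le. Qed.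

Lemma sqnorm_entry p q (M : 'M[R]_(p, q)) i j : M i j ^+ 2 <= sqnorm M.
Proof.
rewrite /sqnorm (bigD1 i)//= (bigD1 j)//= -addrA lerDl addr_ge0// sumr_ge0// => k _; first exact: sqr_ge0.
by rewrite sumr_ge0// => l _; exact: sqr_ge0.
Qed.

Lemma sqnorm_le_entries p q (M : 'M[R]_(p, q)) (c : R) : (forall i j, `|M i j| <= c) ->
  sqnorm M <= (p * q)%:R * c ^+ 2.
Proof.
move=> h; apply: (@le_trans _ _ (\sum_(i < p) \sum_(j < q) c ^+ 2)).
  apply: ler_sum => i _; apply: ler_sum => j _; rewrite -[leLHS]real_normK ?num_real//.
  by rewrite lerXn2r ?nnegrE// (le_trans _ (h i j)).
by rewrite sumr_const sumr_const !card_ord -mulrnA mulnC mulr_natl.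
Qed.

Lemma sqnorm_le_norm p q (M : 'M[R]_(p, q)) : sqnorm M <= (p * q)%:R * `|M| ^+ 2.
Proof. by apply: sqnorm_le_entries => i j; exact: mx_norm_entry. Qed.

Lemma sqnorm_small_entry p q (M : 'M[R]_(p, q)) i j (e : R) : 0 <= e -> sqnorm M <= e ^+ 2 -> `|M i j| <= e.
Proof.
move=> e0 h; have := le_trans (sqnorm_entry M i j) h.
by rewrite -real_normK ?num_real// ler_sqr ?nnegrE.
Qed.

Lemma norm_le_sqnorm p q (M : 'M[R]_(p, q)) (e : R) : 0 <= e -> sqnorm M <= e ^+ 2 -> `|M| <= e.
Proof.
move=> e0 h; rewrite -[`|M|]/(mx_norm M) mx_normrE; apply/bigmax_leP; split => // -[i j] _.
exact: sqnorm_small_entry.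
Qed.

Lemma measurable_sqnorm {d} {Omega : measurableType d} p q (M : Omega -> 'M[R]_(p, q)) :
  (forall i j, measurable_fun setT (fun o => M o i j)) -> measurable_fun setT (fun o => sqnorm (M o)).
Proof.
by move=> mM; apply: measurable_sum => i; apply: measurable_sum => j; exact: measurable_funX.
Qed.

Lemma measurable_mx_norm {d} {Omega : measurableType d} p q (M : Omega -> 'M[R]_(p, q)) :
  (forall i j, measurable_fun setT (fun o => M o i j)) -> measurable_fun setT (fun o => `|M o|).
Proof.
move=> mM; have -> : (fun o => `|M o|) = fun o => \big[Num.max/0]_(ij : 'I_p * 'I_q) `|M o ij.1 ij.2|.
  by apply/funext => o; rewrite -[LHS]/(mx_norm (M o)) mx_normrE.
elim: (index_enum _) => [|ij s IH].
  by under eq_fun do rewrite big_nil; exact: measurable_cst.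
under eq_fun do rewrite big_cons.
apply: measurable_maxr => //.
exact: measurableT_comp.
Qed.

End sqnorm_theory.

Section bounded_measurable.
Context {R : realType}.
Variable t : R.
Implicit Types f g : R -> R.

(** The error of a step approximation is not continuous in time, so [cont] does not apply to it.
    This class contains both continuous functions and step functions and still ensures integrability
    on the segment. *)
Definition bmeas f := measurable_fun `[0, t] f /\ exists C, forall s, 0 <= s <= t -> `|f s| <= C.

Lemma bmeasD f g : bmeas f -> bmeas g -> bmeas (fun s => f s + g s).
Proof.
move=> [mf [C hC]] [mg [D hD]]; split; first exact: measurable_funD.
by exists (C + D) => s sA; apply: (le_trans (ler_normD _ _)); rewrite lerD ?hC ?hD.
Qed.

Lemma bmeasM f g : bmeas f -> bmeas g -> bmeas (fun s => f s * g s).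
Proof.
move=> [mf [C hC]] [mg [D hD]]; split; first exact: measurable_funM.
by exists (C * D) => s sA; rewrite normrM ler_pM ?hC ?hD.
Qed.

Lemma bmeas_cst (c : R) : bmeas (fun=> c).
Proof. by split => //; exists `|c|. Qed.

Lemma bmeasB f g : bmeas f -> bmeas g -> bmeas (fun s => f s - g s).
Proof.
move=> bf bg; apply: bmeasD => //.
have -> : (fun s => - g s) = (fun s => -1 * g s) by apply/funext => s; rewrite mulN1r.
by apply: bmeasM => //; exact: bmeas_cst.
Qed.

Lemma bmeas_sum (I : Type) (r : seq I) (f : I -> R -> R) :
  (forall i, bmeas (f i)) -> bmeas (fun s => \sum_(i <- r) f i s).
Proof.
move=> bf; elim: r => [|i r IH].
  by under eq_fun do rewrite big_nil; exact: bmeas_cst.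
by under eq_fun do rewrite big_cons; exact: bmeasD.
Qed.

Lemma bmeas_indic (A : set R) : measurable A -> bmeas (\1_A).
Proof.
move=> mA; split; first exact: measurable_indic.
by exists 1 => s _; rewrite indicE; case: (_ \in _); rewrite ?normr1 ?normr0.
Qed.

Lemma bmeas_cont f : cont t f -> bmeas f.
Proof.
move=> cf; split; last by have [C _ hC] := cont_bounded cf; exists C.
exact: subspace_continuous_measurable_fun.
Qed.

Lemma bmeas_integrable f : bmeas f -> (@lebesgue_measure R).-integrable `[0, t] (EFin \o f).
Proof.
move=> [mf [C hC]]; apply: measurable_bounded_integrable => //.
- have h := lebesgue_measure_itv `[(0 : R), t]; rewrite [X in (X < _)%E]h /=; case: ifP => _; last exact: ltry.
  by rewrite -EFinD ltry.
- exists C; split; rewrite ?num_real// => M CM s /=; rewrite in_itv/= => sA.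
  by apply: (le_trans (hC s sA)); exact: ltW.
Qed.

(** Time 0 is left out of the comparison because step processes, with their left-open cells, vanish
    there whatever they approximate. *)
Lemma le_path_integral f g : bmeas f -> bmeas g -> (forall s, 0 < s <= t -> f s <= g s) ->
  path_integral t f <= path_integral t g.
Proof.
move=> bf bg fg.
have [t0|t0] := ltP t 0.
  by rewrite /path_integral set_itv_ge ?Rintegral_set0// bnd_simp -ltNge.
have sub : `]0, t]%classic `<=` `[0, t]%classic.
  by move=> s /=; rewrite !in_itv/= => /andP[/ltW -> ->].
have iS h : bmeas h -> (@lebesgue_measure R).-integrable `]0, t] (EFin \o h).
  move=> bh; exact: (@integrableS _ _ R (@lebesgue_measure R) `[0, t]%classic `]0, t]%classic (EFin \o h) (measurable_itv _) (measurable_itv _) sub (bmeas_integrable bh)).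
have o h : bmeas h -> path_integral t h = \int[lebesgue_measure]_(s in `]0, t]) h s.
  by move=> bh; rewrite /path_integral -(Rintegral_itv_obnd_cbnd (iS _ bh)).
rewrite !o//.
apply: le_Rintegral; [exact: measurable_itv|exact: iS|exact: iS|].
by move=> s /=; rewrite in_itv/=; exact: fg.
Qed.

Lemma path_integral_bmeasD f g : bmeas f -> bmeas g ->
  path_integral t (fun s => f s + g s) = path_integral t f + path_integral t g.
Proof. by move=> bf bg; rewrite /path_integral RintegralD//; exact: bmeas_integrable. Qed.

Lemma path_integral_bmeasZ (c : R) f : bmeas f ->
  path_integral t (fun s => c * f s) = c * path_integral t f.
Proof. by move=> bf; rewrite /path_integral RintegralZl//; exact: bmeas_integrable. Qed.

End bounded_measurable.

Section cvgp_more.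
Context {R : realType} {d : measure_display} {Omega : measurableType d}.
Variable P : probability Omega R.

Lemma cvgp_sqnorm_norm {p q} (M : nat -> Omega -> 'M[R]_(p, q)) :
  cvgp P (fun k o => sqnorm (M k o)) -> cvgp P (fun k o => `|M k o|).
Proof.
move=> hM e e0; have k0 : 0 < Num.min e (e ^+ 2) by rewrite lt_min e0 exprn_gt0.
have [N hN] := hM _ k0; exists N => n Nn; have [A [mA PA hA]] := hN n Nn.
exists A; split => //; first by apply: (le_trans PA); rewrite lee_fin ge_min lexx.
move=> o nA; rewrite normr_id; apply: norm_le_sqnorm; first exact: ltW.
by have := hA o nA; rewrite ger0_norm ?sqnorm_ge0// le_min => /andP[].
Qed.

Lemma cvgp_norm_sqnorm {p q} (M : nat -> Omega -> 'M[R]_(p, q)) :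
  cvgp P (fun k o => `|M k o|) -> cvgp P (fun k o => sqnorm (M k o)).
Proof.
move=> hM; apply: (@cvgp_le _ _ _ P (fun k o => (p * q)%:R * `|M k o| ^+ 2)); last first.
  exists 0%N => n _ o; rewrite ger0_norm ?sqnorm_ge0// ger0_norm; last by rewrite mulr_ge0// sqr_ge0.
  exact: sqnorm_le_norm.
apply: cvgpZ => e e0; have k0 : 0 < Num.min e 1 by rewrite lt_min e0 ltr01.
have [N hN] := hM _ k0; exists N => n Nn; have [A [mA PA hA]] := hN n Nn.
exists A; split => //; first by apply: (le_trans PA); rewrite lee_fin ge_min lexx.
move=> o nA; have := hA o nA; rewrite normr_id le_min => /andP[h1 h2].
rewrite ger0_norm ?sqr_ge0//; have := normr_ge0 (M n o); nra.
Qed.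

End cvgp_more.

(** * Step approximations of the Ito integral *)

Section ito_identification.
Context {R : realType} {d : measure_display} {Omega : measurableType d}.
Variables (P : probability Omega R) (T : R) (F : R -> set (set Omega)).
Context {r p : nat}.
Variable w : R -> Omega -> 'cV[R]_r.
Hypothesis F_filtration : filtration T F.
Hypothesis w_wiener : wiener_process P T F w.
Variable t : R.
Hypothesis t0 : 0 <= t.
Hypothesis tT : t <= T.
Implicit Types H K : @step_process R d Omega p r.

Lemma step_coef_measurable H i a b : nonanticipative_step F t H -> (i < sp_size H)%N ->
  measurable_fun setT (fun o => sp_coef H i o a b).
Proof.
move=> hH iH; have [sF mF leF] := F_filtration.
have it : 0 <= sp_time H i <= T.
  by rewrite (sp_time_ge0 hH (ltnW iH)) (le_trans (sp_time_le_end hH (ltnW iH))).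
apply: (filtration_smeas_measurable F_filtration it).
by apply/smeasP; [exact: sF|have [_ _ _] := hH; apply].
Qed.

Lemma step_integral_measurable H a b : nonanticipative_step F t H ->
  measurable_fun setT (fun o => step_integral w H o a b).
Proof.
move=> hH; rewrite (ord1 b); under eq_fun do rewrite step_integralE.
apply: measurable_sum => j; apply: measurable_sum => i.
apply: measurable_funM; first exact: step_coef_measurable.
have wm u : 0 <= u <= T -> measurable_fun setT (fun o => w u o j 0).
  by move=> uT; exact: (filtration_smeas_measurable F_filtration uT (wiener_smeas F_filtration w_wiener j uT)).
apply: measurable_funB; apply: wm.
  by rewrite (sp_time_ge0 hH (ltn_ord i)) (le_trans (sp_time_le_end hH (ltn_ord i))).
by rewrite (sp_time_ge0 hH (ltnW (ltn_ord i))) (le_trans (sp_time_le_end hH (ltnW (ltn_ord i)))).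
Qed.

Lemma step_valueE_indic H s o a b :
  step_value H s o a b = \sum_(i < sp_size H) \1_(`]sp_time H i, sp_time H i.+1]%classic) s * sp_coef H i o a b.
Proof. by rewrite /step_value summxE; apply: eq_bigr => i _; rewrite mxE. Qed.

Variable Phi : R -> Omega -> 'M[R]_(p, r).
Hypothesis Phi_adapted : adapted F t Phi.
Hypothesis Phi_cont : continuous_paths t Phi.

Lemma Phi_path a b o : cont t (fun s => Phi s o a b).
Proof. by move/mx_cont : (@Phi_cont o); apply. Qed.

Lemma Phi_measurable s a b : 0 <= s <= t -> measurable_fun setT (fun o => Phi s o a b).
Proof.
move=> /andP[s0 st]; apply: (@filtration_smeas_measurable _ _ _ T F F_filtration s); first by rewrite s0 (le_trans st).
exact: (adapted_smeas F_filtration a b Phi_adapted).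
Qed.

Lemma measurable_path_sqnorm_step H : nonanticipative_step F t H ->
  measurable_fun setT (fun o => path_integral t (fun s => sqnorm (step_value H s o - Phi s o))).
Proof.
move=> hH; apply: (@measurable_path_integral _ _ _ t (fun s o => sqnorm (step_value H s o - Phi s o))).
apply: jmeas_sum => a; apply: jmeas_sum => b.
have h : jmeas t (fun s o => step_value H s o a b - Phi s o a b).
  apply: jmeasB; last first.
    apply: jmeas_continuous => // [s sA|o]; [exact: Phi_measurable|exact: Phi_path].
  have -> : (fun s o => step_value H s o a b) = fun s o => \sum_(i < sp_size H) \1_(`]sp_time H i, sp_time H i.+1]%classic) s * sp_coef H i o a b.
    by apply/funext => s; apply/funext => o; exact: step_valueE_indic.
  by apply: jmeas_sum => i; apply: jmeas_step => //; exact: step_coef_measurable.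
have -> : (fun s o => (step_value H s o - Phi s o) a b ^+ 2) =
  (fun s o => (step_value H s o a b - Phi s o a b) * (step_value H s o a b - Phi s o a b)).
  by apply/funext => s; apply/funext => o; rewrite !mxE expr2.
exact: jmeasM.
Qed.

Lemma bmeas_sqnorm q q' (M : R -> 'M[R]_(q, q')) :
  (forall i j, bmeas t (fun s => M s i j)) -> bmeas t (fun s => sqnorm (M s)).
Proof.
move=> h; apply: bmeas_sum => i; apply: bmeas_sum => j.
by under eq_fun do rewrite expr2; exact: bmeasM.
Qed.

Lemma bmeas_step_value H o a b : bmeas t (fun s => step_value H s o a b).
Proof.
under eq_fun do rewrite step_valueE_indic.
apply: bmeas_sum => i; apply: bmeasM; last exact: bmeas_cst.
exact: bmeas_indic.
Qed.

Lemma bmeas_step_error H o : bmeas t (fun s => sqnorm (step_value H s o - Phi s o)).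
Proof.
apply: bmeas_sqnorm => a b; under eq_fun do rewrite !mxE.
apply: bmeasB; first exact: bmeas_step_value.
by apply: bmeas_cont; exact: Phi_path.
Qed.

Lemma step_sub_energy_le H K o : nonanticipative_step F t H -> nonanticipative_step F t K ->
  step_energy (step_sub t H K) (sp_size (step_sub t H K)) o <=
  2 * path_integral t (fun s => sqnorm (step_value H s o - Phi s o)) +
  2 * path_integral t (fun s => sqnorm (step_value K s o - Phi s o)).
Proof.
move=> hH hK; rewrite -(path_integral_step _ (step_sub_nonanticipative F_filtration t0 tT hH hK)).
have bH := bmeas_step_error H o; have bK := bmeas_step_error K o.
have b2 := bmeas_cst t (2 : R).
rewrite -!path_integral_bmeasZ// -path_integral_bmeasD; [|exact: bmeasM..].
apply: le_path_integral.
- by apply: bmeas_sqnorm => a b; exact: bmeas_step_value.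
- by apply: bmeasD; exact: bmeasM.
move=> s _; rewrite (step_sub_value F_filtration s o t0 tT hH hK).
have -> : step_value H s o - step_value K s o = (step_value H s o - Phi s o) - (step_value K s o - Phi s o).
  by rewrite opprB addrA subrK.
exact: sqnormB_le.
Qed.

Lemma lenglart_max (D : nat -> @step_process R d Omega p r) : (forall k, nonanticipative_step F t (D k)) ->
  cvgp P (fun k o => step_energy (D k) (sp_size (D k)) o) ->
  forall e, 0 < e -> exists N, forall n, (N <= n)%N -> exists A, [/\ measurable A, (P A <= e%:E)%E &
    forall o, ~ A o -> forall i, (i <= sp_size (D n))%N -> sqnorm (step_psum w (D n) i o) <= e].
Proof.
move=> hD hE e e0.
(* With radius sqrt e, Lenglart's bound is eta / e <= e / 2; the other half of e pays for the event
   where the energy exceeds eta. *)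
pose eta := Num.min (e ^+ 2 / 2) (e / 2).
have eta0 : 0 < eta by rewrite lt_min !divr_gt0// exprn_gt0.
have [N hN] := hE _ eta0; exists N => n Nn; have [A [mA PA hA]] := hN n Nn.
have s0 : 0 < Num.sqrt e by rewrite sqrtr_gt0.
have [B [mB PB hB]] := lenglart_stopped F_filtration w_wiener tT (hD n) s0 (ltW eta0).
have se : Num.sqrt e ^+ 2 = e by rewrite sqr_sqrtr// ltW.
exists (A `|` B); split; first exact: measurableU.
  apply: (le_trans (measureU2 _ mA mB)); apply: (le_trans (leeD PA PB)).
  rewrite -EFinD lee_fin se.
  have h1 : eta <= e / 2 by rewrite /eta ge_min lexx orbT.
  have h2 : eta / e <= e / 2 by rewrite ler_pdivrMr// /eta ge_min; apply/orP; left; rewrite le_eqVlt; apply/orP; left; apply/eqP; ring.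
  by lra.
move=> o nAB i iD.
have hAo := hA o (fun h => nAB (or_introl h)).
rewrite -se; apply: ltW; apply: hB => //; first by move=> h; apply: nAB; right.
exact: le_trans (ler_norm _) hAo.
Qed.

(* The difference of two step processes, on different grids, is again a step
   process; its energy is small when both approximate Phi. *)
Lemma ito_identification (I : Omega -> 'cV[R]_p) (K : nat -> @step_process R d Omega p r) :
  ito_integral P F w t Phi I -> (forall k, nonanticipative_step F t (K k)) ->
  cvgp P (fun k o => path_integral t (fun s => sqnorm (step_value (K k) s o - Phi s o))) ->
  cvgp P (fun k o => sqnorm (step_integral w (K k) o - I o)).
Proof.
move=> [_ _ mI [H [hH HPhi HI]]] hK KPhi.
have mI' a b : measurable_fun setT (fun o => I o a b).
  by move=> _ E mE; rewrite setTI; exact: mI.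
have c1 : cvgp P (fun k o => path_integral t (fun s => sqnorm (step_value (H k) s o - Phi s o))).
  have := cvgp_of_probability (V := R^o) _ HPhi.
  move=> h; apply: cvgp_le (h _) _ => [n|].
    apply: measurableT_comp => //; under eq_fun do rewrite subr0.
    exact: measurable_path_sqnorm_step.
  by exists 0%N => n _ o; rewrite subr0 normr_id.
have c2 : cvgp P (fun k o => sqnorm (step_integral w (H k) o - I o)).
  apply: cvgp_norm_sqnorm; apply: cvgp_of_probability HI => n.
  apply: measurable_mx_norm => i j; under eq_fun do rewrite !mxE.
  by apply: measurable_funB => //; exact: step_integral_measurable.
pose D k := step_sub t (H k) (K k).
have hD k : nonanticipative_step F t (D k) by exact: (step_sub_nonanticipative F_filtration t0 tT).
have cE : cvgp P (fun k o => step_energy (D k) (sp_size (D k)) o).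
  apply: (cvgp_le (cvgpD (cvgpZ 2 c1) (cvgpZ 2 KPhi))); exists 0%N => n _ o.
  have e0 : 0 <= step_energy (D n) (sp_size (D n)) o.
    rewrite /step_energy sumr_ge0// => i _; rewrite mulr_ge0 ?sqnorm_ge0// subr_ge0.
    by apply: (sp_time_le (hD n)).
  rewrite ger0_norm//; apply: le_trans (ler_norm _); exact: step_sub_energy_le.
have c3 : cvgp P (fun k o => sqnorm (step_integral w (D k) o)).
  move=> e e0; have [N hN] := lenglart_max hD cE e0; exists N => n Nn.
  have [A [mA PA hA]] := hN n Nn; exists A; split => // o nA.
  rewrite ger0_norm ?sqnorm_ge0//; exact: (hA o nA _ (leqnn _)).
apply: (cvgp_le (cvgpD (cvgpZ 2 c2) (cvgpZ 2 c3))); exists 0%N => n _ o.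
rewrite ger0_norm ?sqnorm_ge0//; apply: le_trans (ler_norm _).
rewrite (step_sub_integral w o (hH n) (hK n)).
have -> : step_integral w (K n) o - I o = (step_integral w (H n) o - I o) - (step_integral w (H n) o - step_integral w (K n) o).
  by rewrite opprB addrAC addrCA subrr addr0.
exact: sqnormB_le.
Qed.

Lemma ito_integral_of_cvgp (I : Omega -> 'cV[R]_p) (K : nat -> @step_process R d Omega p r) :
  (forall a b, measurable_fun setT (fun o => I o a b)) -> (forall k, nonanticipative_step F t (K k)) ->
  cvgp P (fun k o => path_integral t (fun s => sqnorm (step_value (K k) s o - Phi s o))) ->
  cvgp P (fun k o => sqnorm (step_integral w (K k) o - I o)) ->
  ito_integral P F w t Phi I.
Proof.
move=> mI hK KPhi KI; split => //.
  by move=> a b E mE; have := mI a b measurableT E mE; rewrite setTI.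
exists K; split => //.
  apply: (probability_of_cvgp (V := R^o)).
    move=> n; apply: measurableT_comp => //; under eq_fun do rewrite subr0.
    exact: measurable_path_sqnorm_step.
  by apply: (cvgp_le KPhi); exists 0%N => n _ o; rewrite subr0 normr_id.
apply: probability_of_cvgp; last exact: cvgp_sqnorm_norm.
move=> n; apply: measurable_mx_norm => i j; under eq_fun do rewrite !mxE.
by apply: measurable_funB => //; exact: step_integral_measurable.
Qed.

End ito_identification.

(** * Uniform convergence on grids *)

Section uniform_arrays.
Context {R : realType}.
Variables (T : R) (N : nat -> nat).
Hypothesis T0 : 0 <= T.
Hypothesis N_gt0 : forall l, (0 < N l)%N.
Hypothesis N_large : forall l, (l <= N l)%N.
Implicit Types (a b : nat -> nat -> R) (f g h : R -> R).

(** Convergence of a triangular array to the values of h at the left ends of the cells, uniformly in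
    the cell. It is stable under sums and products, so the coefficients of a discrete expansion can
    be treated termwise before [ucvg_riemann] turns their sums into an integral. *)
Definition ucvg a h := forall e, 0 < e -> exists l0, forall l, (l0 <= l)%N ->
  forall j, (j < N l)%N -> `|a l j - h (node T (N l) j)| <= e.

Let node_in l j : (j <= N l)%N -> 0 <= node T (N l) j <= T.
Proof. exact: node_itv. Qed.

Lemma ucvg_cst (c : R) : ucvg (fun _ _ => c) (fun=> c).
Proof. by move=> e e0; exists 0%N => l _ j _; rewrite subrr normr0 ltW. Qed.

Lemma ucvgD a b f g : ucvg a f -> ucvg b g -> ucvg (fun l j => a l j + b l j) (fun s => f s + g s).
Proof.
move=> ha hb e e0; have e20 : 0 < e / 2 by rewrite divr_gt0.
have [l0 h0] := ha _ e20; have [l1 h1] := hb _ e20.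
exists (maxn l0 l1) => l; rewrite geq_max => /andP[k0 k1] j jN.
rewrite opprD addrACA; apply: (le_trans (ler_normD _ _)).
by have := h0 l k0 j jN; have := h1 l k1 j jN; lra.
Qed.

Lemma ucvgM a b f g : cont T f -> cont T g -> ucvg a f -> ucvg b g ->
  ucvg (fun l j => a l j * b l j) (fun s => f s * g s).
Proof.
move=> cf cg ha hb e e0.
have [C C0 hC] := cont_bounded cf; have [D D0 hD] := cont_bounded cg.
(* The error is split as (x - f)(y - g) + (x - f) g + f (y - g). As k <= 1, the product of the two
   errors is at most k, and the total is at most k (1 + D + C). *)
pose k := Num.min 1 (e / (C + D + 1)).
have k0 : 0 < k by rewrite lt_min ltr01 divr_gt0// ltr_wpDl// addr_ge0.
have [l0 h0] := ha _ k0; have [l1 h1] := hb _ k0.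
exists (maxn l0 l1) => l; rewrite geq_max => /andP[p0 p1] j jN.
have tin := node_in (ltnW jN).
set u := node _ _ _; have := h0 l p0 j jN; have := h1 l p1 j jN; rewrite -/u.
set x := a l j; set y := b l j => hy hx.
have fC := hC u tin; have gD := hD u tin.
have -> : x * y - f u * g u = (x - f u) * (y - g u) + (x - f u) * g u + f u * (y - g u) by ring.
apply: (le_trans (ler_normD _ _)); apply: (@le_trans _ _ (k * 1 + k * D + C * k)).
  apply: lerD; last by rewrite normrM ler_pM.
  apply: (le_trans (ler_normD _ _)); apply: lerD; rewrite normrM ler_pM//.
  by apply: (le_trans hy); rewrite /k ge_min lexx.
have -> : k * 1 + k * D + C * k = k * (C + D + 1) by ring.
by rewrite -ler_pdivlMr ?ltr_wpDl ?addr_ge0// /k ge_min lexx orbT.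
Qed.

Lemma ucvgN a f : ucvg a f -> ucvg (fun l j => - a l j) (fun s => - f s).
Proof.
move=> ha e e0; have [l0 h0] := ha e e0; exists l0 => l ll j jN.
by rewrite -opprD normrN; exact: h0.
Qed.

Lemma ucvgB a b f g : ucvg a f -> ucvg b g -> ucvg (fun l j => a l j - b l j) (fun s => f s - g s).
Proof. by move=> ha hb; apply: ucvgD => //; exact: ucvgN. Qed.

Lemma ucvg_eq a b f g : (forall l j, a l j = b l j) -> (forall s, f s = g s) -> ucvg a f -> ucvg b g.
Proof.
move=> ab fg ha e e0; have [l0 h0] := ha e e0; exists l0 => l ll j jN.
by rewrite -ab -fg; exact: h0.
Qed.

Lemma ucvg_sum (I : Type) (r : seq I) (a : I -> nat -> nat -> R) (f : I -> R -> R) :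
  (forall i, ucvg (a i) (f i)) -> ucvg (fun l j => \sum_(i <- r) a i l j) (fun s => \sum_(i <- r) f i s).
Proof.
move=> h; elim: r => [|i r IH].
  by apply: ucvg_eq (ucvg_cst 0) => [l j|s]; rewrite big_nil.
by apply: ucvg_eq (ucvgD (h i) IH) => [l j|s]; rewrite big_cons.
Qed.

Lemma ucvg_node h : ucvg (fun l j => h (node T (N l) j)) h.
Proof. by move=> e e0; exists 0%N => l _ j _; rewrite subrr normr0 ltW. Qed.

Lemma near_mesh (dl : R) : 0 < dl -> exists l0, forall l, (l0 <= l)%N -> T / (N l)%:R < dl.
Proof.
move=> dl0; have [n0 h] := near_mesh_lt T0 dl0; exists n0 => l ll.
by apply: h; exact: leq_trans (N_large l).
Qed.

Lemma ucvg_next h : cont T h -> ucvg (fun l j => h (node T (N l) j.+1)) h.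
Proof.
move=> ch e e0; have [dl dl0 hdl] := heine ch e0.
have [l0 h0] := near_mesh dl0; exists l0 => l ll j jN.
apply/ltW/hdl; rewrite ?node_in//; first exact: ltnW.
by rewrite nodeS ger0_norm ?h0// divr_ge0.
Qed.

Lemma ucvg_mesh : ucvg (fun l _ => T / (N l)%:R) (fun=> 0).
Proof.
move=> e e0; have [l0 h0] := near_mesh e0; exists l0 => l ll j jN.
by rewrite subr0 ger0_norm ?divr_ge0//; apply: ltW; exact: h0.
Qed.

Lemma ucvg_increment h : cont T h ->
  ucvg (fun l j => h (node T (N l) j.+1) - h (node T (N l) j)) (fun=> 0).
Proof.
by move=> ch; apply: ucvg_eq (ucvgB (ucvg_next ch) (ucvg_node h)) => // s; rewrite subrr.
Qed.

Lemma ucvg_add_small a b h : ucvg a h ->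
  (forall e, 0 < e -> exists l0, forall l, (l0 <= l)%N -> forall j, (j < N l)%N -> `|b l j - a l j| <= e) ->
  ucvg b h.
Proof.
move=> ha hb e e0; have e20 : 0 < e / 2 by rewrite divr_gt0.
have [l0 h0] := ha _ e20; have [l1 h1] := hb _ e20.
exists (maxn l0 l1) => l; rewrite geq_max => /andP[k0 k1] j jN.
apply: (le_trans (ler_distD (a l j) _ _)).
by have := h0 l k0 j jN; have := h1 l k1 j jN; lra.
Qed.

(** By the mean value theorem the quotient is dh at some point of the cell, and dh is uniformly
    continuous. *)
Lemma ucvg_quotient (h dh : R -> R) : 0 < T -> cont T h -> cont T dh ->
  (forall t : R, 0 < t < T -> is_derive t 1 h (dh t)) ->
  ucvg (fun l j => (h (node T (N l) j.+1) - h (node T (N l) j)) / (T / (N l)%:R)) dh.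
Proof.
move=> Tpos ch cdh hder e e0; have [dl dl0 hdl] := heine cdh e0.
have [l0 h0] := near_mesh dl0; exists l0 => l ll j jN.
have mesh : 0 < T / (N l)%:R by rewrite divr_gt0// ltr0n.
have lt : node T (N l) j < node T (N l) j.+1 by rewrite -subr_gt0 nodeS.
have /andP[a0 aT] := node_in (ltnW jN); have /andP[b0 bT] := node_in jN.
have [c /andP[ac cb]] : exists2 c, c \in `]node T (N l) j, node T (N l) j.+1[ &
   h (node T (N l) j.+1) - h (node T (N l) j) = dh c * (node T (N l) j.+1 - node T (N l) j).
  apply: MVT => //.
    move=> x; rewrite in_itv/= => /andP[x1 x2]; apply: hder.
    by rewrite (le_lt_trans a0 x1) (lt_le_trans x2 bT).
  apply: continuous_subspaceW ch => x /=; rewrite !in_itv/= => /andP[x1 x2].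
  by rewrite (le_trans a0 x1) (le_trans x2 bT).
rewrite /= in ac cb => ->; rewrite nodeS mulfK ?gt_eqF//.
apply/ltW/hdl; rewrite ?a0 ?aT//.
  by rewrite (ltW (le_lt_trans a0 ac)) (ltW (lt_le_trans cb bT)).
rewrite gtr0_norm ?subr_gt0//; apply: lt_trans (h0 l ll).
by rewrite -(nodeS T (N l) j) ltrD2r.
Qed.

Lemma ucvg_riemann a h : cont T h -> ucvg a h ->
  \sum_(j < N l) a l j * (T / (N l)%:R) @[l --> \oo] --> path_integral T h.
Proof.
move=> ch ha; apply/cvgrPdist_le => e e0.
have e20 : 0 < e / 2 by rewrite divr_gt0.
have e30 : 0 < e / 2 / (T + 1) by rewrite divr_gt0// ltr_wpDl.
have [n0 hn] := riemann_sum T0 ch e20; have [l0 h0] := ha _ e30.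
exists (maxn n0 l0) => // l /=; rewrite geq_max => /andP[k0 k1].
have := hn (N l) (N_gt0 l) (leq_trans k0 (N_large l)) (N l) (leqnn _).
rewrite nodeN// => h1.
have h2 : `|\sum_(i < N l) h (node T (N l) i) * (T / (N l)%:R) - \sum_(j < N l) a l j * (T / (N l)%:R)| <= e / 2.
  rewrite -sumrB; apply: (le_trans (ler_norm_sum _ _ _)).
  apply: (@le_trans _ _ (\sum_(j < N l) e / 2 / (T + 1) * (T / (N l)%:R))).
    apply: ler_sum => j _; rewrite -mulrBl normrM (ger0_norm (divr_ge0 T0 _))//.
    by rewrite ler_wpM2r ?divr_ge0// distrC; exact: h0.
  have N0 : (N l)%:R != 0 :> R by rewrite pnatr_eq0 -lt0n.
  have T1 : T + 1 != 0 by rewrite gt_eqF// ltr_wpDl.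
  have -> : \sum_(j < N l) e / 2 / (T + 1) * (T / (N l)%:R) = e / 2 * (T / (T + 1)).
    by rewrite sumr_const card_ord -mulr_natr; field; rewrite N0 T1.
  rewrite ler_piMr//; first exact: ltW.
  by rewrite ler_pdivrMr ?ltr_wpDl// mul1r lerDl.
by apply: (le_trans (ler_distD _ _ _)); apply: (le_trans (lerD h1 h2)); lra.
Qed.

Definition mucvg p q (a : nat -> nat -> 'M[R]_(p, q)) (h : R -> 'M[R]_(p, q)) :=
  forall i k, ucvg (fun l j => a l j i k) (fun s => h s i k).

Definition mcont p q (h : R -> 'M[R]_(p, q)) := forall i k, cont T (fun s => h s i k).

Lemma mcontD p q (f g : R -> 'M[R]_(p, q)) : mcont f -> mcont g -> mcont (fun s => f s + g s).
Proof. by move=> cf cg i k; under eq_fun do rewrite mxE; exact: contD. Qed.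

Lemma mcontN p q (f : R -> 'M[R]_(p, q)) : mcont f -> mcont (fun s => - f s).
Proof. by move=> cf i k; under eq_fun do rewrite mxE; exact: contN. Qed.

Lemma mcontB p q (f g : R -> 'M[R]_(p, q)) : mcont f -> mcont g -> mcont (fun s => f s - g s).
Proof. by move=> cf cg; apply: mcontD => //; exact: mcontN. Qed.

Lemma mcontM p q q' (f : R -> 'M[R]_(p, q)) (g : R -> 'M[R]_(q, q')) :
  mcont f -> mcont g -> mcont (fun s => f s *m g s).
Proof. by move=> cf cg i k; under eq_fun do rewrite mxE; apply: cont_sum => j; exact: contM. Qed.

Lemma mcont_cst p q (c : 'M[R]_(p, q)) : mcont (fun=> c).
Proof. by move=> i k; exact: cont_cst. Qed.

Lemma mcont_tr p q (f : R -> 'M[R]_(p, q)) : mcont f -> mcont (fun s => (f s)^T).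
Proof. by move=> cf i k; under eq_fun do rewrite mxE; exact: cf. Qed.

Lemma mcontZ p q (c : R) (f : R -> 'M[R]_(p, q)) : mcont f -> mcont (fun s => c *: f s).
Proof. by move=> cf i k; under eq_fun do rewrite mxE; apply: contM => //; exact: cont_cst. Qed.

Lemma cont_inner p (f g : R -> 'cV[R]_p) : mcont f -> mcont g -> cont T (fun s => inner (f s) (g s)).
Proof. by move=> cf cg; apply: cont_sum => i; exact: contM. Qed.

Lemma cont_trace p (f : R -> 'M[R]_p) : mcont f -> cont T (fun s => \tr (f s)).
Proof. by move=> cf; apply: cont_sum => i; exact: cf. Qed.

Lemma cont_sqnorm p q (f : R -> 'M[R]_(p, q)) : mcont f -> cont T (fun s => sqnorm (f s)).
Proof.
move=> cf; apply: cont_sum => i; apply: cont_sum => j.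
by under eq_fun do rewrite expr2; exact: contM.
Qed.

Lemma mucvgD p q (a b : nat -> nat -> 'M[R]_(p, q)) (f g : R -> 'M[R]_(p, q)) : mucvg a f -> mucvg b g ->
  mucvg (fun l j => a l j + b l j) (fun s => f s + g s).
Proof.
by move=> ha hb i k; apply: ucvg_eq (ucvgD (ha i k) (hb i k)) => [l j|s]; rewrite mxE.
Qed.

Lemma mucvgM p q q' (a : nat -> nat -> 'M[R]_(p, q)) (b : nat -> nat -> 'M[R]_(q, q'))
    (f : R -> 'M[R]_(p, q)) (g : R -> 'M[R]_(q, q')) : mcont f -> mcont g ->
  mucvg a f -> mucvg b g -> mucvg (fun l j => a l j *m b l j) (fun s => f s *m g s).
Proof.
move=> cf cg ha hb i k.
apply: (@ucvg_eq _ _ _ _ _ _ (ucvg_sum (index_enum 'I_q)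
  (fun j => ucvgM (cf i j) (cg j k) (ha i j) (hb j k)))) => [l j|s]; by rewrite mxE.
Qed.

Lemma mucvg_node p q (f : R -> 'M[R]_(p, q)) : mucvg (fun l j => f (node T (N l) j)) f.
Proof. by move=> i k; exact: (ucvg_node (fun s => f s i k)). Qed.

Lemma ucvg_inner p (a b : nat -> nat -> 'cV[R]_p) (f g : R -> 'cV[R]_p) : mcont f -> mcont g -> mucvg a f -> mucvg b g ->
  ucvg (fun l j => inner (a l j) (b l j)) (fun s => inner (f s) (g s)).
Proof. by move=> cf cg ha hb; apply: ucvg_sum => i; exact: ucvgM. Qed.

Lemma ucvg_sqnorm p q (a : nat -> nat -> 'M[R]_(p, q)) (f : R -> 'M[R]_(p, q)) : mcont f -> mucvg a f ->
  ucvg (fun l j => sqnorm (a l j)) (fun s => sqnorm (f s)).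
Proof.
move=> cf ha; apply: ucvg_sum => i; apply: ucvg_sum => j.
by apply: ucvg_eq (ucvgM (cf i j) (cf i j) (ha i j) (ha i j)) => [l k|s]; rewrite expr2.
Qed.

End uniform_arrays.

(** * The discrete Gronwall inequality *)

Section gronwall.
Context {R : realType}.

Lemma discrete_gronwall (u : nat -> R) (a c : R) (n : nat) : 0 <= a -> 0 <= c ->
  (forall j, (j <= n)%N -> u j <= a + c * \sum_(i < j) u i) ->
  forall j, (j <= n)%N -> u j <= a * (1 + c) ^+ j.
Proof.
move=> a0 c0 hu.
(* The induction bounds the right-hand side rather than u: passing from j to j + 1 multiplies the
   bound by at most 1 + c. One more index is admissible because u j itself does not occur in it. *)
suff h j : (j <= n.+1)%N -> a + c * \sum_(i < j) u i <= a * (1 + c) ^+ j.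
  by move=> j jn; apply: (le_trans (hu j jn)); apply: h; exact: leqW.
elim: j => [|j IH] jn; first by rewrite big_ord0 mulr0 addr0 expr0 mulr1.
rewrite big_ord_recr/= exprS.
have h1 := IH (ltnW jn); have h2 := hu j jn.
have -> : a * ((1 + c) * (1 + c) ^+ j) = a * (1 + c) ^+ j + c * (a * (1 + c) ^+ j) by ring.
rewrite mulrDr addrA; apply: lerD => //.
by rewrite ler_wpM2l// (le_trans h2).
Qed.

Lemma expr1D_le_expR (c : R) (j : nat) : 0 <= c -> (1 + c) ^+ j <= expR (c *+ j).
Proof.
move=> c0; rewrite -mulr_natl expRM_natl lerXn2r ?nnegrE ?expR_ge0 ?addr_ge0//.
exact: expR_ge1Dx.
Qed.

Lemma mulmx_norm_le p q q' (A : 'M[R]_(p, q)) (B : 'M[R]_(q, q')) :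
  `|A *m B| <= q%:R * `|A| * `|B|.
Proof.
rewrite -[`|A *m B|]/(mx_norm (A *m B)) mx_normrE; apply/bigmax_leP; split.
  by rewrite !mulr_ge0.
move=> [i j] _ /=; rewrite mxE; apply: (le_trans (ler_norm_sum _ _ _)).
apply: (@le_trans _ _ (\sum_(k < q) `|A| * `|B|)).
  by apply: ler_sum => k _; rewrite normrM ler_pM// mx_norm_entry.
by rewrite sumr_const card_ord -mulrA mulr_natl.
Qed.

End gronwall.

Section modulus.
Context {R : realType}.

Lemma finite_modulus (I : finType) (Q : I -> R -> Prop) :
  (forall i a b, a <= b -> Q i b -> Q i a) -> (forall i, exists2 a, 0 < a & Q i a) ->
  exists2 a, 0 < a & forall i, Q i a.
Proof.
move=> mono h.
have /boolp.choice[f hf] : forall i, exists a, 0 < a /\ Q i a.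
  by move=> i; have [a a0 qa] := h i; exists a.
exists (\big[Num.min/1]_i f i) => [|i].
  by apply/bigmin_gtP; split => // i _; have [] := hf i.
by apply: mono (proj2 (hf i)); exact: bigmin_le.
Qed.
End modulus.

Section cvgp_sum.
Context {R : realType} {d : measure_display} {Omega : measurableType d}.
Variable P : probability Omega R.

Lemma cvgp_deterministic (X : nat -> Omega -> R) (c : nat -> R) :
  c k @[k --> \oo] --> (0 : R) -> (forall k o, `|X k o| <= c k) -> cvgp P X.
Proof.
move=> hc hX e e0; have /cvgrPdist_le/(_ _ e0) := hc.
rewrite nearE => -[N _ hN]; exists N => k Nk; exists set0; split => //.
  by rewrite measure0 lee_fin ltW.
move=> o _; apply: (le_trans (hX k o)); have := hN k Nk.
by rewrite /= sub0r normrN; apply: le_trans; exact: ler_norm.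
Qed.

Lemma cvgp_sum (n : nat) (X : nat -> nat -> Omega -> R) : (forall j, (j < n)%N -> cvgp P (X j)) ->
  cvgp P (fun k o => \sum_(j < n) X j k o).
Proof.
elim: n => [|n IH] h.
  by apply: (@cvgp_deterministic _ (fun=> 0)) => [|k o]; [exact: cvg_cst|rewrite big_ord0 normr0].
have h1 := cvgpD (IH (fun j jn => h j (ltnW jn))) (h n (ltnSn n)).
by apply: (cvgp_le h1); exists 0%N => k _ o; rewrite big_ord_recr.
Qed.

Lemma cvgp_ae_eq (X Y : nat -> Omega -> R) : (forall k, {ae P, forall o, X k o = Y k o}) ->
  cvgp P X -> cvgp P Y.
Proof.
move=> XY hX e e0; have [N hN] := hX e e0; exists N => k Nk.
have [A [mA PA hA]] := hN k Nk; have [B [mB PB hB]] := XY k.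
exists (A `|` B); split; first exact: measurableU.
  apply: (le_trans (measureU2 _ mA mB)); apply: (le_trans (leeD PA (_ : (P B <= 0)%E))).
    by rewrite -PB.
  by rewrite adde0.
move=> o nAB; have <- : X k o = Y k o.
  by apply: contrapT => nE; apply: nAB; right; exact: hB.
by apply: hA => Ao; apply: nAB; left.
Qed.

End cvgp_sum.

(** * Step processes on uniform grids *)

Section grid_steps.
Context {R : realType} {d : measure_display} {Omega : measurableType d}.
Variables (P : probability Omega R) (T : R) (F : R -> set (set Omega)).
Context {r p : nat}.
Hypothesis T0 : 0 <= T.
Hypothesis F_filtration : filtration T F.
Implicit Types c : nat -> Omega -> 'M[R]_(p, r).

Definition grid_step (N k : nat) c : @step_process R d Omega p r := StepProcess k (node T N) c.

Lemma grid_step_nonanticipative N k c : (k <= N)%N ->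
  (forall i, (i < k)%N -> forall a b, smeas (F (node T N i)) (fun o => c i o a b)) ->
  nonanticipative_step F (node T N k) (grid_step N k c).
Proof.
move=> kN hc; have [sF _ _] := F_filtration; split => //=; first exact: node0.
  by move=> i _; exact: node_le.
move=> i ik a b; apply/smeasP; last exact: hc.
by apply: sF; apply: node_itv => //; exact: ltnW (leq_trans ik kN).
Qed.

Lemma grid_step_value N k c s o : (0 < N)%N -> (k <= N)%N -> 0 < s <= node T N k ->
  exists2 i, (i < k)%N & (node T N i < s <= node T N i.+1) /\ step_value (grid_step N k c) s o = c i o.
Proof.
move=> N0 kN /andP[s0 sk].
have sT : 0 < s <= T by rewrite s0 (le_trans sk)//; have /andP[] := node_itv T0 kN.
have [i i1 i2] := node_cover N0 sT.
have ik : (i < k)%N.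
  by rewrite ltnNge; apply/negP => ki; have := node_le N T0 ki; move: i1 sk; lra.
exists i => //; split; first by rewrite i1.
rewrite /step_value /= (bigD1 (Ordinal ik))//= indicE mem_set ?scale1r; last by rewrite /= in_itv/= i1.
rewrite big1 ?addr0// => j ji; rewrite indicE memNset ?scale0r//= in_itv/= => /andP[g1 g2].
have [kj|kj|kj] := ltngtP i j; last by move/eqP: ji; apply; apply/val_inj.
  by have := node_le N T0 kj; move: i2 g1; lra.
by have := node_le N T0 kj; move: g2 i1; lra.
Qed.

Lemma path_integral_cst (t c : R) : 0 <= t -> path_integral t (fun=> c) = t * c.
Proof.
move=> t0; rewrite /path_integral (@Rintegral_cst _ _ _ (@lebesgue_measure R) `[0, t]%classic (measurable_itv _)).
have h := lebesgue_measure_itv `[0, t]; rewrite [X in fine X]h/= lte_fin mulrC.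
case: ltgtP t0 => // [tp _|<- _]; first by rewrite /= subr0.
by rewrite !mul0r.
Qed.

Lemma grid_step_error N k c (Phi : R -> 'M[R]_(p, r)) o (e : R) : (0 < N)%N -> (k <= N)%N -> 0 <= e ->
  mcont (node T N k) Phi ->
  (forall i s, (i < k)%N -> node T N i < s <= node T N i.+1 -> sqnorm (c i o - Phi s) <= e) ->
  path_integral (node T N k) (fun s => sqnorm (step_value (grid_step N k c) s o - Phi s)) <= T * e.
Proof.
move=> N0 kN e0 cPhi h; have /andP[t0 tT] := node_itv T0 kN.
apply: (@le_trans _ _ (node T N k * e)); last by rewrite ler_wpM2r.
rewrite -path_integral_cst//; apply: le_path_integral.
- apply: bmeas_sqnorm => a b; under eq_fun do rewrite !mxE.
  by apply: bmeasB; [exact: bmeas_step_value|exact: bmeas_cont].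
- exact: bmeas_cst.
- move=> s st; have [i ik [hi ->]] := grid_step_value c o N0 kN st.
  exact: h.
Qed.

End grid_steps.

(** * Wiener sums at the grid points *)

Section martingale_approximation.
Context {R : realType} {d : measure_display} {Omega : measurableType d}.
Variables (P : probability Omega R) (T : R) (F : R -> set (set Omega)).
Context {r n : nat}.
Variable w : R -> Omega -> 'cV[R]_r.
Hypothesis T0 : 0 <= T.
Hypothesis F_filtration : filtration T F.
Hypothesis w_wiener : wiener_process P T F w.
Variable sigma : R -> 'M[R]_(n, r).
Hypothesis sigma_cont : mcont T sigma.

Lemma mheine p q (h : R -> 'M[R]_(p, q)) : mcont T h -> forall e, 0 < e -> exists2 dl, 0 < dl &
  forall u v, 0 <= u <= T -> 0 <= v <= T -> `|u - v| < dl -> sqnorm (h u - h v) <= e.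
Proof.
move=> ch e e0.
(* Entrywise errors below k give a squared norm of at most p q k^2 <= (p q + 1) k <= e, using k <=
   1. *)
pose k := Num.min 1 (e / ((p * q)%:R + 1)).
have C0 : 0 < (p * q)%:R + 1 :> R by rewrite ltr_wpDl.
have k0 : 0 < k by rewrite lt_min ltr01 divr_gt0.
have [dl dl0 hdl] := @finite_modulus R ('I_p * 'I_q)%type (fun i dl => forall u v, 0 <= u <= T -> 0 <= v <= T ->
   `|u - v| < dl -> `|h u i.1 i.2 - h v i.1 i.2| < k)
  (fun i a b ab hb u v hu hv uv => hb u v hu hv (lt_le_trans uv ab))
  (fun i => heine (ch i.1 i.2) k0).
exists dl => // u v hu hv uv.
apply: (@le_trans _ _ ((p * q)%:R * k ^+ 2)).
  by apply: sqnorm_le_entries => i j; rewrite !mxE; apply/ltW/(hdl (i, j)).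
apply: (@le_trans _ _ (((p * q)%:R + 1) * k)).
  apply: ler_pM; rewrite ?sqr_ge0//; first by rewrite lerDl.
  have k1 : k <= 1 by rewrite /k ge_min lexx.
  by rewrite expr2 ler_piMr// ltW.
by rewrite mulrC -ler_pdivlMr// /k ge_min lexx orbT.
Qed.

Lemma node_refine N l q : node T (N * l.+1) (q * l.+1) = node T N q.
Proof.
rewrite /node !natrM; have [->|N0] := posnP N; first by rewrite mul0r !invr0 !mulr0.
have N1 : N%:R != 0 :> R by rewrite pnatr_eq0 -lt0n.
by rewrite mulrA -mulf_div divff ?mulr1// pnatr_eq0.
Qed.

Lemma node_refine_dist N l i : 0 < T -> (0 < N)%N ->
  `|node T (N * l.+1) i - node T N (i %/ l.+1)| < T / N%:R.
Proof.
move=> Tpos N0; rewrite -(nodeS T N (i %/ l.+1)) -!(node_refine N l).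
have h1 : node T (N * l.+1) (i %/ l.+1 * l.+1) <= node T (N * l.+1) i.
  by apply: node_le => //; exact: leq_trunc_div.
have h2 : node T (N * l.+1) i < node T (N * l.+1) ((i %/ l.+1).+1 * l.+1).
  rewrite /node ltr_pM2r ?invr_gt0 ?ltr0n ?muln_gt0 ?N0// ltr_pM2l// ltr_nat.
  exact: ltn_ceil.
by rewrite ger0_norm; lra.
Qed.

Definition wiener_sum N j o : 'cV[R]_n :=
  \sum_(i < j) sigma (node T N i) *m (w (node T N i.+1) o - w (node T N i) o).

(** Three step processes on the same fine grid of N (l+1) cells: sigma sampled at fine nodes, sigma
    sampled at the start of the enclosing coarse cell, and the difference of the two. The increments
    of the second one telescope inside coarse cells, so its integral is [wiener_sum]. *)
Let refined N l k := grid_step T (N * l.+1) k (fun i (_ : Omega) => sigma (node T (N * l.+1) i)).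
Let coarse N l k := grid_step T (N * l.+1) k (fun i (_ : Omega) => sigma (node T N (i %/ l.+1))).
Let gap N l k := grid_step T (N * l.+1) k
  (fun i (_ : Omega) => sigma (node T (N * l.+1) i) - sigma (node T N (i %/ l.+1))).

Let cst_smeas (t : R) (c : 'M[R]_(n, r)) a b : smeas (F t) (fun _ : Omega => c a b).
Proof. exact: smeas_cst. Qed.

Let step_integral_coarse N l j o : step_integral w (coarse N l (j * l.+1)) o = wiener_sum N j o.
Proof.
rewrite /step_integral /=.
pose f a b := sigma (node T N a) *m (w (node T (N * l.+1) (a * l.+1 + b).+1) o - w (node T (N * l.+1) (a * l.+1 + b)) o).
transitivity (\sum_(k < j * l.+1) f (k %/ l.+1)%N (k %% l.+1)%N).
  by apply: eq_bigr => i _; rewrite /f -divn_eq.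
rewrite sum_divmod//; apply: eq_bigr => i _; rewrite /f -mulmx_sumr; congr (_ *m _).
rewrite -(big_mkord xpredT (fun b => w (node T (N * l.+1) (i * l.+1 + b).+1) o - w (node T (N * l.+1) (i * l.+1 + b)) o)).
under eq_bigr do rewrite -addnS.
by rewrite telescope_sumr// addn0 -mulSnr !node_refine.
Qed.

(* Sums over the refined grids with N (l+1) cells link the two sides: as l grows
   they tend to M at each node, and they differ from [wiener_sum] by integrals of
   step processes whose energy is small uniformly in l. *)
Lemma martingale_approximation (M : R -> Omega -> 'cV[R]_n) : 0 < T ->
  (forall t, 0 <= t <= T -> ito_integral P F w t (fun s _ => sigma s) (M t)) ->
  cvgp P (fun k o => \big[Num.max/0]_(j < k.+2) sqnorm (M (node T k.+1 j) o - wiener_sum k.+1 j o)).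
Proof.
move=> Tpos hM e e0.
(* Radius squared e / 4 and energy e^2 / 8 give probability e / 2 in Lenglart's inequality; e / 4 is
   kept for the passage from fine sums to M. Two squared distances of at most e / 4 combine to at
   most e. *)
have a0 : 0 < Num.sqrt (e / 4) by rewrite sqrtr_gt0 divr_gt0.
have aE : Num.sqrt (e / 4) ^+ 2 = e / 4 by rewrite sqr_sqrtr// divr_ge0// ltW.
have eta0 : 0 < e ^+ 2 / 8 / T by rewrite !divr_gt0// exprn_gt0.
have [dl dl0 hdl] := mheine sigma_cont eta0.
have [N0 hN0] := near_mesh_lt T0 dl0.
exists N0 => k Nk; set N := k.+1.
have mesh : T / N%:R < dl by apply: hN0; exact: leqW.
have e40 : 0 < e / 4 by rewrite divr_gt0.
pose X j l o := sqnorm (step_integral w (refined N l (j * l.+1)) o - M (node T N j) o).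
have cX : cvgp P (fun l o => \sum_(j < N.+1) X j l o).
  apply: cvgp_sum => j jN.
  have tin := node_itv T0 (jN : (j <= N)%N); have /andP[tj0 tjT] := tin.
  have ns l : nonanticipative_step F (node T N j) (refined N l (j * l.+1)).
    rewrite -(node_refine N l); apply: grid_step_nonanticipative => //.
    by rewrite leq_pmul2r.
  have [Phia Phic _ _] := hM _ tin.
  apply: (ito_identification F_filtration w_wiener tj0 tjT Phia Phic (hM _ tin) ns).
  move=> e1 e10; have e1T : 0 < e1 / T by rewrite divr_gt0.
  have [dl1 dl10 hdl1] := mheine sigma_cont e1T.
  have [L hL] := near_mesh_lt T0 dl10.
  exists L => l Ll; exists set0; split => //; first by rewrite measure0 lee_fin ltW.
  move=> o _; rewrite ger0_norm; last first.
    by apply: Rintegral_ge0 => s _; exact: sqnorm_ge0.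
  rewrite -[X in path_integral X](node_refine N l).
  apply: (@le_trans _ _ (T * (e1 / T))); last by rewrite mulrC divfK// gt_eqF.
  have jl : (j * l.+1 <= N * l.+1)%N by rewrite leq_pmul2r.
  rewrite /refined; apply: grid_step_error; rewrite ?muln_gt0 ?(ltW e1T)//.
    rewrite node_refine.
    by move=> i b; exact: (@cont_le _ _ _ _ tjT (@sigma_cont i b)).
  move=> i s ij /andP[s1 s2].
  have iin := node_itv T0 (ltnW (leq_trans ij jl)).
  have /andP[i0 _] := iin; have /andP[_ iT] := node_itv T0 (leq_trans ij jl).
  apply: hdl1 => //; first by rewrite (ltW (le_lt_trans i0 s1)) (le_trans s2).
  rewrite distrC gtr0_norm ?subr_gt0//.
  apply: (@le_lt_trans _ _ (T / (N * l.+1)%:R)); last first.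
    by apply: hL; apply: (leq_trans Ll); apply: (leq_trans (leqnSn l)); rewrite leq_pmull.
  by rewrite -(nodeS T (N * l.+1) i) lerD2r.
(* L may depend on N, because the energy of [gap] is bounded through the coarse mesh alone. *)
have [L hL] := cX _ e40; have [B [mB PB hB]] := hL L (leqnn _).
have nsg : nonanticipative_step F T (gap N L (N * L.+1)).
  rewrite -[X in nonanticipative_step _ X _](nodeN T (N := N * L.+1)) ?muln_gt0//.
  apply: grid_step_nonanticipative => // i _ a b; exact: cst_smeas.
have [A [mA PA hA]] := lenglart_stopped F_filtration w_wiener (lexx T) nsg a0 (ltW (divr_gt0 (exprn_gt0 2 e0) (ltr0n R 8))).
exists (A `|` B); split; first exact: measurableU.
  apply: (le_trans (measureU2 _ mA mB)); apply: (le_trans (leeD PA PB)).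
  rewrite -EFinD lee_fin aE; have -> : e ^+ 2 / 8 / (e / 4) = e / 2 by field; rewrite gt_eqF.
  by lra.
move=> o nAB; have nA : ~ A o by move=> h; apply: nAB; left.
have nB : ~ B o by move=> h; apply: nAB; right.
rewrite ger0_norm; last exact: bigmax_ge_id.
apply: bigmax_le; first exact: ltW.
move=> j _; have jN : (j <= N)%N by have := ltn_ord j.
have en : step_energy (gap N L (N * L.+1)) (sp_size (gap N L (N * L.+1))) o <= e ^+ 2 / 8.
  rewrite /step_energy /=.
  apply: (@le_trans _ _ (\sum_(i < N * L.+1) (e ^+ 2 / 8 / T) * (T / (N * L.+1)%:R))).
    apply: ler_sum => i _; rewrite nodeS ler_wpM2r ?divr_ge0//.
    apply: hdl.
    - by apply: node_itv => //; exact: ltnW.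
    - by apply: node_itv => //; apply: ltnW; rewrite ltn_divLR.
    - by apply: lt_trans mesh; exact: node_refine_dist.
  have D0 : (N * L.+1)%:R != 0 :> R by rewrite pnatr_eq0 muln_eq0.
  rewrite sumr_const card_ord -[leLHS]mulr_natr; move: (N * L.+1)%:R D0 => D D0.
  have -> : e ^+ 2 / 8 / T * (T / D) * D = e ^+ 2 / 8 by field; rewrite D0 gt_eqF.
  exact: lexx.

have jl : (j * L.+1 <= sp_size (gap N L (N * L.+1)))%N by rewrite /= leq_pmul2r.
have := hA o nA en _ jl; rewrite aE.
have -> : step_psum w (gap N L (N * L.+1)) (j * L.+1) o =
   step_integral w (refined N L (j * L.+1)) o - wiener_sum N j o.
  rewrite -(step_integral_coarse N L) /step_psum /step_integral /= -sumrB.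
  by apply: eq_bigr => i _; rewrite mulmxBl.
set a := step_integral _ _ _ => h1.
have h2 : sqnorm (a - M (node T N j) o) <= e / 4.
  apply: le_trans (hB o nB); apply: le_trans (ler_norm _).
  rewrite (bigD1 j)//= /X -/a lerDl sumr_ge0// => i _; exact: sqnorm_ge0.
have -> : M (node T N j) o - wiener_sum N j o = (a - wiener_sum N j o) - (a - M (node T N j) o).
  by rewrite opprB addrCA [a - _ - a]addrAC subrr add0r.
by apply: (le_trans (sqnormB_le _ _)); lra.
Qed.

End martingale_approximation.

(** * Inner products and quadratic forms *)

Section inner_theory.
Context {R : realType}.

Lemma innerE k (u v : 'cV[R]_k) : inner u v = (u^T *m v) 0 0.
Proof. by rewrite mxE; apply: eq_bigr => i _; rewrite mxE. Qed.

Lemma innerC k (u v : 'cV[R]_k) : inner u v = inner v u.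
Proof. by apply: eq_bigr => i _; rewrite mulrC. Qed.

Lemma innerDl k (u v z : 'cV[R]_k) : inner (u + v) z = inner u z + inner v z.
Proof. by rewrite -big_split; apply: eq_bigr => i _; rewrite mxE mulrDl. Qed.

Lemma innerDr k (u v z : 'cV[R]_k) : inner z (u + v) = inner z u + inner z v.
Proof. by rewrite innerC innerDl !(innerC z). Qed.

Lemma innerZl k (c : R) (u v : 'cV[R]_k) : inner (c *: u) v = c * inner u v.
Proof. by rewrite mulr_sumr; apply: eq_bigr => i _; rewrite mxE mulrA. Qed.

Lemma innerZr k (c : R) (u v : 'cV[R]_k) : inner u (c *: v) = c * inner u v.
Proof. by rewrite innerC innerZl innerC. Qed.

Lemma inner0l k (v : 'cV[R]_k) : inner 0 v = 0.
Proof. by apply: big1 => i _; rewrite mxE mul0r. Qed.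

Lemma innerNl k (u v : 'cV[R]_k) : inner (- u) v = - inner u v.
Proof. by rewrite -scaleN1r innerZl mulN1r. Qed.

Lemma innerNr k (u v : 'cV[R]_k) : inner u (- v) = - inner u v.
Proof. by rewrite innerC innerNl innerC. Qed.

Lemma innerBl k (u v z : 'cV[R]_k) : inner (u - v) z = inner u z - inner v z.
Proof. by rewrite innerDl innerNl. Qed.

Lemma innerBr k (u v z : 'cV[R]_k) : inner z (u - v) = inner z u - inner z v.
Proof. by rewrite innerDr innerNr. Qed.

Lemma inner_mull k k' (A : 'M[R]_(k', k)) (u : 'cV[R]_k) (v : 'cV[R]_k') :
  inner (A *m u) v = inner u (A^T *m v).
Proof. by rewrite !innerE trmx_mul mulmxA. Qed.

Lemma inner_mulr k k' (A : 'M[R]_(k', k)) (u : 'cV[R]_k) (v : 'cV[R]_k') :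
  inner v (A *m u) = inner (A^T *m v) u.
Proof. by rewrite inner_mull trmxK. Qed.

Lemma sqnorm_inner k (u : 'cV[R]_k) : sqnorm u = inner u u.
Proof. by apply: eq_bigr => i _; rewrite big_ord1 expr2. Qed.

Lemma inner_quadD k (A : 'M[R]_k) (u v : 'cV[R]_k) : A^T = A ->
  inner (A *m (u + v)) (u + v) = inner (A *m u) u + 2 * inner (A *m u) v + inner (A *m v) v.
Proof.
move=> As; rewrite mulmxDr !(innerDl, innerDr).
have -> : inner (A *m v) u = inner (A *m u) v by rewrite inner_mull As innerC.
by ring.
Qed.

(** The exact expansion of a time-dependent quadratic function over one Euler step x -> x + (h f +
    v). The terms are sorted as in Ito's formula: linear in the noise v, proportional to h, and
    quadratic in v. Time derivatives appear as difference quotients. *)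
Lemma quadratic_taylor k (A A' : 'M[R]_k) (a a' x f v : 'cV[R]_k) (h : R) : A^T = A -> h != 0 ->
  let x' := x + (h *: f + v) in
  2^-1 * inner (A' *m x') x' + inner a' x' - (2^-1 * inner (A *m x) x + inner a x) =
  inner (A *m x + a) v
  + (2^-1 * inner ((h^-1 *: (A' - A)) *m x') x' + inner (h^-1 *: (a' - a)) x'
     + inner (A *m x + a) f + inner (A *m v) f + 2^-1 * h * inner (A *m f) f) * h
  + 2^-1 * inner (A *m v) v.
Proof.
move=> As h0 /=; set x' := x + _.
have e1 : inner (A' *m x') x' = inner (A *m x') x' + inner ((A' - A) *m x') x'.
  by rewrite mulmxBl innerBl addrC subrK.
have e2 : inner a' x' = inner a x' + inner (a' - a) x' by rewrite innerBl addrC subrK.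
have e3 : inner (A *m f) v = inner (A *m v) f by rewrite inner_mull As innerC.
have e4 : inner (A *m x') x' = inner (A *m x) x + 2 * (h * inner (A *m x) f + inner (A *m x) v)
   + (h * (h * inner (A *m f) f) + 2 * (h * inner (A *m v) f) + inner (A *m v) v).
  by rewrite /x' inner_quadD// innerDr innerZr inner_quadD// -scalemxAr !innerZl innerZr e3.
rewrite e1 e2 e4 -scalemxAl !innerZl !(innerDl (A *m x)).
by rewrite /x' !innerDr !innerZr; field.
Qed.

Lemma inner_quad_sum k (A : 'M[R]_k) (u : 'cV[R]_k) :
  inner (A *m u) u = \sum_i \sum_j A i j * (u i 0 * u j 0).
Proof.
apply: eq_bigr => i _; rewrite mxE mulr_suml; apply: eq_bigr => j _.
by rewrite -mulrA (mulrC (u j 0)).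
Qed.

Lemma cvg_seq_sum (I : Type) (t : seq I) (u : I -> nat -> R) (v : I -> R) :
  (forall i, u i l @[l --> \oo] --> v i) ->
  \sum_(i <- t) u i l @[l --> \oo] --> \sum_(i <- t) v i.
Proof.
move=> h; elim: t => [|i t IH].
  by rewrite big_nil; under eq_fun do rewrite big_nil; exact: cvg_cst.
by rewrite big_cons; under eq_fun do rewrite big_cons; exact: cvgD.
Qed.

End inner_theory.

(** * The Euler scheme *)

Section euler_scheme.
Context {R : realType}.
Variable T : R.
Context {n r : nat}.
Variables (G : R -> 'M[R]_n) (g : R -> 'cV[R]_n) (sigma : R -> 'M[R]_(n, r)) (x0 : 'cV[R]_n).

Definition increment (W : R -> 'cV[R]_r) (N j : nat) := W (node T N j.+1) - W (node T N j).

Fixpoint euler (W : R -> 'cV[R]_r) (N j : nat) : 'cV[R]_n := match j with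
  | 0 => x0
  | j'.+1 => euler W N j'
      + ((T / N%:R) *: (G (node T N j') *m euler W N j' + g (node T N j'))
         + sigma (node T N j') *m increment W N j') end.

Lemma eulerE W N j : euler W N j = x0
  + \sum_(i < j) (T / N%:R) *: (G (node T N i) *m euler W N i + g (node T N i))
  + \sum_(i < j) sigma (node T N i) *m increment W N i.
Proof.
elim: j => [|j IH]; first by rewrite !big_ord0 !addr0.
by rewrite [LHS]/= {1}IH !big_ord_recr/= -!addrA; congr (_ + (_ + _)); rewrite addrCA.
Qed.

End euler_scheme.

Section euler_pathwise.
Context {R : realType}.
Variables (T : R) (N : nat -> nat).
Hypothesis T0 : 0 < T.
Hypothesis N_gt0 : forall l, (0 < N l)%N.
Hypothesis N_large : forall l, (l <= N l)%N.
Context {n r : nat}.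
Variables (G : R -> 'M[R]_n) (g : R -> 'cV[R]_n) (sigma : R -> 'M[R]_(n, r)) (x0 : 'cV[R]_n).
Hypothesis G_cont : mcont T G.
Hypothesis g_cont : mcont T g.
Hypothesis sigma_cont : mcont T sigma.
Variables (W : R -> 'cV[R]_r) (y : R -> 'cV[R]_n).
Hypothesis W_cont : mcont T W.
Hypothesis y_cont : mcont T y.

Local Notation X := (euler T G g sigma x0 W).

Let f s := G s *m y s + g s.

Hypothesis euler_consistent : forall e, 0 < e -> exists l0, forall l, (l0 <= l)%N -> forall j, (j <= N l)%N ->
  `|y (node T (N l) j) - x0 - mx_integral (node T (N l) j) f
    - \sum_(i < j) sigma (node T (N l) i) *m increment T W (N l) i| <= e.

Let T00 : 0 <= T := ltW T0.

Lemma finite_threshold (I : finType) (Q : I -> nat -> Prop) :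
  (forall i, exists n0, forall k, (n0 <= k)%N -> Q i k) ->
  exists n0, forall k, (n0 <= k)%N -> forall i, Q i k.
Proof.
move=> /boolp.choice[m hm]; exists (\max_i m i) => k hk i.
by apply: hm; apply: leq_trans hk; exact: leq_bigmax.
Qed.

Lemma mcont_bounded p q (h : R -> 'M[R]_(p, q)) : mcont T h ->
  exists2 C, 0 <= C & forall s, 0 <= s <= T -> `|h s| <= C.
Proof.
move=> ch; have [C C0 hC] := cont_bounded (cont_sqnorm ch).
exists (C + 1) => [|s sT]; first by rewrite addr_ge0.
apply: norm_le_sqnorm; first by rewrite addr_ge0.
apply: (le_trans (le_trans (ler_norm _) (hC s sT))); nra.
Qed.

Lemma mx_riemann p q (h : R -> 'M[R]_(p, q)) : mcont T h -> forall e, 0 < e ->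
  exists N0, forall k, (0 < k)%N -> (N0 <= k)%N -> forall j, (j <= k)%N ->
  `|mx_integral (node T k j) h - \sum_(i < j) (T / k%:R) *: h (node T k i)| <= e.
Proof.
move=> ch e e0.
have [N0 hN] := @finite_threshold ('I_p * 'I_q)%type (fun u k => (0 < k)%N -> forall j, (j <= k)%N ->
  `|path_integral (node T k j) (fun s => h s u.1 u.2) - \sum_(i < j) h (node T k i) u.1 u.2 * (T / k%:R)| <= e)
  (fun u => let: ex_intro m hm := riemann_sum T00 (ch u.1 u.2) e0 in
     ex_intro _ m (fun k mk k0 => hm k k0 mk)).
exists N0 => k k0 kN j jk.
rewrite -[`|_|]/(mx_norm _) mx_normrE; apply/bigmax_leP; split; first exact: ltW.
move=> [a b] _ /=; rewrite !mxE summxE.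
under eq_bigr do rewrite mxE mulrC.
exact: (hN k kN (a, b) k0 j jk).
Qed.

(** A statement about a single path. The sums of sigma dW in the scheme cancel against those in
    [euler_consistent], so the error satisfies a linear recursion with two small sources: the
    Riemann sum of the drift and the consistency error. *)
Lemma euler_cvg e : 0 < e -> exists l0, forall l, (l0 <= l)%N -> forall j, (j <= N l)%N ->
  `|X (N l) j - y (node T (N l) j)| <= e.
Proof.
move=> e0.
have [K K0 hK] := mcont_bounded G_cont.
have cf : mcont T f by apply: mcontD => //; exact: mcontM.
(* The Gronwall factor over the whole grid; n K bounds the action of G in the maximum norm. Each of
   the two sources gets half of e / E. *)
pose E := expR (T * (n%:R * K)); have E0 : 0 < E by exact: expR_gt0.
have a0 : 0 < e / E / 2 by rewrite !divr_gt0.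
have [N0 hN0] := mx_riemann cf a0; have [l1 hl1] := euler_consistent a0.
exists (maxn N0 l1) => l; rewrite geq_max => /andP[lN0 ll1] j jN.
set k := N l; have k0 : (0 < k)%N := N_gt0 l.
have kN0 : (N0 <= k)%N := leq_trans lN0 (N_large l).
pose c := T / k%:R * (n%:R * K).
have c0 : 0 <= c by rewrite /c !mulr_ge0// invr_ge0.
have h := @discrete_gronwall R (fun i => `|X k i - y (node T k i)|) (e / E) c k (ltW (divr_gt0 e0 E0)) c0.
apply: (le_trans (h _ j jN)) => [i ik|]; last first.
  apply: (@le_trans _ _ (e / E * E)); last by rewrite divfK ?gt_eqF.
  apply: ler_wpM2l; first by apply/ltW/divr_gt0.
  apply: (le_trans (expr1D_le_expR _ c0)).
  rewrite ler_expR -[c *+ j]mulr_natr /c.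
  have -> : T / k%:R * (n%:R * K) * j%:R = T * (n%:R * K) * (j%:R / k%:R) by ring.
  by rewrite ler_piMr ?mulr_ge0// ler_pdivrMr ?ltr0n// mul1r ler_nat.
rewrite eulerE.
have -> : x0 + \sum_(i0 < i) (T / k%:R) *: (G (node T k i0) *m X k i0 + g (node T k i0)) +
   \sum_(i0 < i) sigma (node T k i0) *m increment T W k i0 - y (node T k i) =
   \sum_(i0 < i) (T / k%:R) *: (G (node T k i0) *m (X k i0 - y (node T k i0)))
   - (mx_integral (node T k i) f - \sum_(i0 < i) (T / k%:R) *: f (node T k i0))
   - (y (node T k i) - x0 - mx_integral (node T k i) f - \sum_(i0 < i) sigma (node T k i0) *m increment T W k i0).
  have -> : \sum_(i0 < i) (T / k%:R) *: (G (node T k i0) *m X k i0 + g (node T k i0)) =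
    \sum_(i0 < i) (T / k%:R) *: (G (node T k i0) *m (X k i0 - y (node T k i0))) + \sum_(i0 < i) (T / k%:R) *: f (node T k i0).
    rewrite -big_split/=; apply: eq_bigr => i0 _; rewrite -scalerDr; congr (_ *: _).
    by rewrite mulmxBr /f addrA subrK.
  by apply/matrixP => a b; rewrite !mxE; ring.
have h1 := hN0 k k0 kN0 i ik; have h2 := hl1 l ll1 i ik.
have h3 : `|\sum_(i0 < i) (T / k%:R) *: (G (node T k i0) *m (X k i0 - y (node T k i0)))|
   <= c * \sum_(i0 < i) `|X k i0 - y (node T k i0)|.
  apply: (le_trans (ler_norm_sum _ _ _)); rewrite mulr_sumr; apply: ler_sum => i0 _.
  rewrite normrZ ger0_norm ?divr_ge0// /c -!mulrA !ler_wpM2l ?invr_ge0//.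
  apply: (le_trans (mulmx_norm_le _ _)); rewrite -mulrA ler_wpM2l// ler_wpM2r//.
  by apply: hK; apply: node_itv => //; exact: ltnW (leq_trans (ltn_ord i0) ik).
apply: (le_trans (ler_normB _ _)); apply: (le_trans (lerD (ler_normB _ _) (lexx _))).
rewrite /k in h1 h3 *.
have -> : e / E = e / E / 2 + e / E / 2 by lra.
by apply: (le_trans (lerD (lerD h3 h1) h2)); rewrite -addrA addrC.
Qed.

Lemma euler_mucvg : mucvg T N (fun l j => X (N l) j) y.
Proof.
move=> i k e e0; have [l0 h0] := euler_cvg e0; exists l0 => l ll j jN.
apply: le_trans (h0 l ll j (ltnW jN)).
by have := mx_norm_entry (X (N l) j - y (node T (N l) j)) i k; rewrite !mxE.
Qed.

Lemma euler_mucvg_next : mucvg T N (fun l j => X (N l) j.+1) y.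
Proof.
move=> i k; apply: ucvg_add_small (ucvg_next T00 N_large (@y_cont i k)) _.
move=> e e0; have [l0 h0] := euler_cvg e0; exists l0 => l ll j jN.
apply: le_trans (h0 l ll j.+1 jN).
by have := mx_norm_entry (X (N l) j.+1 - y (node T (N l) j.+1)) i k; rewrite !mxE.
Qed.

Variables (Pi dPi : R -> 'M[R]_n) (s ds : R -> 'cV[R]_n).
Hypothesis Pi_cont : mcont T Pi.
Hypothesis dPi_cont : mcont T dPi.
Hypothesis s_cont : mcont T s.
Hypothesis ds_cont : mcont T ds.
Hypothesis Pi_sym : forall t, 0 <= t <= T -> (Pi t)^T = Pi t.
Hypothesis Pi_der : forall i j (t : R), 0 < t < T -> is_derive t 1 (fun u => Pi u i j) (dPi t i j).
Hypothesis s_der : forall i j (t : R), 0 < t < T -> is_derive t 1 (fun u => s u i j) (ds t i j).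

(** The data of Ito's formula for V(t, z) = <Pi z, z> / 2 + <s, z>. [ito_gradient] is sigma^T
    applied to the gradient of V, [ito_quadratic] is sigma^T (Hess V) sigma, and [ito_drift] is the
    time derivative plus the generator of dz = (G z + g) dt + sigma dW. [quadratic_defect] is the
    error in replacing dW dW^T by dt times the identity. *)
Definition ito_potential t z := 2^-1 * inner (Pi t *m z) z + inner (s t) z.
Definition ito_quadratic t := (sigma t)^T *m Pi t *m sigma t.
Definition ito_gradient t z := (sigma t)^T *m (Pi t *m z + s t).
Definition ito_drift t z := 2^-1 * inner (dPi t *m z) z + inner (ds t) z
  + inner (Pi t *m z + s t) (G t *m z + g t) + 2^-1 * \tr (ito_quadratic t).
Definition quadratic_defect k j := \sum_a \sum_b ito_quadratic (node T k j) a b *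
  (increment T W k j a 0 * increment T W k j b 0 - (a == b)%:R * (T / k%:R)).

Local Notation dt k := (T / k%:R).

(** The coefficient of dt in the expansion of one step. The first four terms tend to [ito_drift];
    the last two carry a factor dW or dt and vanish in the limit. *)
Let brace k j :=
   2^-1 * inner ((dt k)^-1 *: (Pi (node T k j.+1) - Pi (node T k j)) *m X k j.+1) (X k j.+1)
   + inner ((dt k)^-1 *: (s (node T k j.+1) - s (node T k j))) (X k j.+1)
   + inner (Pi (node T k j) *m X k j + s (node T k j)) (G (node T k j) *m X k j + g (node T k j))
   + 2^-1 * \tr (ito_quadratic (node T k j))
   + inner (Pi (node T k j) *m (sigma (node T k j) *m increment T W k j)) (G (node T k j) *m X k j + g (node T k j))
   + 2^-1 * dt k * inner (Pi (node T k j) *m (G (node T k j) *m X k j + g (node T k j))) (G (node T k j) *m X k j + g (node T k j)).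

Let ito_step k j : (0 < k)%N -> (j < k)%N ->
  ito_potential (node T k j.+1) (X k j.+1) - ito_potential (node T k j) (X k j) =
  inner (ito_gradient (node T k j) (X k j)) (increment T W k j) + brace k j * dt k
  + 2^-1 * quadratic_defect k j.
Proof.
move=> k0 jk.
have dt0 : dt k != 0 by rewrite mulf_neq0 ?invr_neq0 ?gt_eqF ?ltr0n.
have tin := node_itv T00 (ltnW jk).
rewrite /brace /ito_potential /ito_gradient.
have qd : quadratic_defect k j = inner (ito_quadratic (node T k j) *m increment T W k j) (increment T W k j)
   - dt k * \tr (ito_quadratic (node T k j)).
  rewrite inner_quad_sum /quadratic_defect /mxtrace mulr_sumr -sumrB; apply: eq_bigr => a _.
  rewrite -[X in _ = _ - X](_ : \sum_b ito_quadratic (node T k j) a b * ((a == b)%:R * dt k) = _).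
    by rewrite -sumrB; apply: eq_bigr => b _; rewrite mulrBr.
  rewrite (bigD1 a)//= eqxx mul1r big1 ?addr0 1?mulrC// => b ba.
  by rewrite eq_sym (negbTE ba) mul0r mulr0.
rewrite qd /ito_quadratic -!mulmxA !(inner_mull (sigma _)^T) !trmxK.
have := quadratic_taylor (Pi (node T k j.+1)) (s (node T k j)) (s (node T k j.+1)) (X k j)
  (G (node T k j) *m X k j + g (node T k j)) (sigma (node T k j) *m increment T W k j) (Pi_sym tin) dt0.
rewrite /= => ->; ring.
Qed.

(** Summing [ito_step] telescopes the potential, so the noise sum equals the change of potential
    minus a Riemann sum of [brace] minus half the quadratic defects. The only input about W of a
    probabilistic nature is that these defects cancel in the limit. *)
Lemma discrete_ito :
  \sum_(j < N l) quadratic_defect (N l) j @[l --> \oo] --> (0 : R) ->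
  \sum_(j < N l) inner (ito_gradient (node T (N l) j) (X (N l) j)) (increment T W (N l) j) @[l --> \oo]
  --> ito_potential T (y T) - ito_potential 0 x0 - path_integral T (fun t => ito_drift t (y t)).
Proof.
move=> hQ.
have cX := euler_mucvg; have cX' := euler_mucvg_next.
have cff : mucvg T N (fun l j => G (node T (N l) j) *m X (N l) j + g (node T (N l) j)) (fun t => G t *m y t + g t).
  by apply: mucvgD; [apply: mucvgM => //; exact: mucvg_node|exact: mucvg_node].
have ff_cont : mcont T (fun t => G t *m y t + g t) by apply: mcontD => //; exact: mcontM.
have sW : mucvg T N (fun l j => increment T W (N l) j) (fun=> 0).
  move=> a b; apply: ucvg_eq (ucvg_increment T00 N_large (@W_cont a b)) => [l j|t]; by rewrite !mxE.
have quo p q (h dh : R -> 'M[R]_(p, q)) : mcont T h -> mcont T dh ->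
   (forall i j (t : R), 0 < t < T -> is_derive t 1 (fun u => h u i j) (dh t i j)) ->
   mucvg T N (fun l j => (dt (N l))^-1 *: (h (node T (N l) j.+1) - h (node T (N l) j))) dh.
  move=> ch cdh hder a b.
  apply: ucvg_eq (ucvg_quotient T00 N_gt0 N_large T0 (ch a b) (cdh a b) (hder a b)) => [l j|t//].
  by rewrite !mxE mulrC.
have cP := quo _ _ _ _ Pi_cont dPi_cont Pi_der.
have cs := quo _ _ _ _ s_cont ds_cont s_der.
have ic := @cont_inner R T.
have cc : cont T (fun=> 2^-1) by exact: cont_cst.
have u2 : ucvg T N (fun _ _ => 2^-1) (fun=> 2^-1) by exact: ucvg_cst.
have q_cont : mcont T ito_quadratic by apply: mcontM => //; apply: mcontM => //; exact: mcont_tr.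
have tr_cont : cont T (fun t => \tr (ito_quadratic t)) by exact: cont_trace.
have e1_cont : mcont T (fun t => dPi t *m y t) by exact: mcontM.
have e2_cont : mcont T (fun t => Pi t *m y t + s t) by apply: mcontD => //; exact: mcontM.
have c0 : mcont T (fun=> 0 : 'cV[R]_r) by exact: mcont_cst.
have sW' : mucvg T N (fun l j => Pi (node T (N l) j) *m (sigma (node T (N l) j) *m increment T W (N l) j))
    (fun t => Pi t *m (sigma t *m 0)).
  by apply: mucvgM => //; [exact: mcontM|exact: mucvg_node|apply: mucvgM => //; exact: mucvg_node].
have f1 : cont T (fun t => inner (dPi t *m y t) (y t)) by exact: ic.
have f2 : cont T (fun t => inner (ds t) (y t)) by exact: ic.
have f3 : cont T (fun t => inner (Pi t *m y t + s t) (G t *m y t + g t)) by exact: ic.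
have drift_cont : cont T (fun t => ito_drift t (y t)).
  by apply: contD; [apply: contD; [apply: contD => //; exact: contM|]|exact: contM].
have cbrace : ucvg T N (fun l j => brace (N l) j) (fun t => ito_drift t (y t)).
  apply: (@ucvg_eq _ _ _ _ _ (fun t => 2^-1 * inner (dPi t *m y t) (y t) + inner (ds t) (y t)
     + inner (Pi t *m y t + s t) (G t *m y t + g t) + 2^-1 * \tr (ito_quadratic t)
     + inner (Pi t *m (sigma t *m 0)) (G t *m y t + g t)
     + 2^-1 * 0 * inner (Pi t *m (G t *m y t + g t)) (G t *m y t + g t)) _ (fun _ _ => erefl)).
    by move=> t; rewrite !mulmx0 inner0l /ito_drift; ring.
  apply: ucvgD; first apply: ucvgD; first apply: ucvgD; first apply: ucvgD; first apply: ucvgD.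
  - by apply: ucvgM => //; apply: ucvg_inner => //; exact: mucvgM.
  - exact: ucvg_inner.
  - apply: ucvg_inner => //; apply: mucvgD; last exact: mucvg_node.
    by apply: mucvgM => //; exact: mucvg_node.
  - by apply: ucvgM => //; exact: ucvg_node.
  - by apply: ucvg_inner => //; apply: mcontM => //; exact: mcontM.
  - apply: ucvgM => //; first exact: cont_cst.
    + by apply: ic => //; exact: mcontM.
    + by apply: ucvgM => //; [exact: cont_cst|exact: ucvg_mesh].
    + apply: ucvg_inner => //; first exact: mcontM.
      by apply: mucvgM => //; exact: mucvg_node.
have hb := ucvg_riemann T00 N_gt0 N_large drift_cont cbrace.
have hV : ito_potential T (X (N l) (N l)) @[l --> \oo] --> ito_potential T (y T).
  have cXT i : X (N l) (N l) i 0 @[l --> \oo] --> y T i 0.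
    apply/cvgrPdist_le => e e0; have [l0 h0] := euler_cvg e0.
    exists l0 => // l /= ll; have := h0 l ll (N l) (leqnn _); rewrite nodeN//; apply: le_trans.
    by have := mx_norm_entry (X (N l) (N l) - y T) i 0; rewrite !mxE distrC.
  have cin p (a b : nat -> 'cV[R]_p) (a' b' : 'cV[R]_p) : (forall i, a l i 0 @[l --> \oo] --> a' i 0) ->
      (forall i, b l i 0 @[l --> \oo] --> b' i 0) -> inner (a l) (b l) @[l --> \oo] --> inner a' b'.
    by move=> ha hb'; apply: cvg_seq_sum => i; apply: cvgM; [exact: ha|exact: hb'].
  apply: cvgD; last by apply: cin => // i; exact: cvg_cst.
  apply: cvgMr; apply: cin => // i; rewrite mxE.
  rewrite (_ : (fun l => _) = (fun l => \sum_j Pi T i j * X (N l) (N l) j 0)); last by apply/funext => l; rewrite mxE.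
  by apply: cvg_seq_sum => j; apply: cvgMr; exact: cXT.
have -> : (fun l => \sum_(j < N l) inner (ito_gradient (node T (N l) j) (X (N l) j)) (increment T W (N l) j)) =
  (fun l => (ito_potential T (X (N l) (N l)) - ito_potential 0 x0 - \sum_(j < N l) brace (N l) j * dt (N l))
     - 2^-1 * \sum_(j < N l) quadratic_defect (N l) j).
  apply/funext => l.
  have -> : ito_potential T (X (N l) (N l)) - ito_potential 0 x0 =
    \sum_(j < N l) (ito_potential (node T (N l) j.+1) (X (N l) j.+1) - ito_potential (node T (N l) j) (X (N l) j)).
    rewrite -(big_mkord xpredT (fun j => ito_potential (node T (N l) j.+1) (X (N l) j.+1) - ito_potential (node T (N l) j) (X (N l) j))).
    by rewrite telescope_sumr// node0 nodeN.
  under [X in _ = X - _ - _]eq_bigr => j _ do rewrite (ito_step (N_gt0 l) (ltn_ord j)).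
  by rewrite !big_split/= -mulr_sumr addrAC addrK addrK.
rewrite -[X in _ --> X]subr0 -[X in _ --> _ - X](mulr0 2^-1).
apply: cvgB; last by apply: cvgMr.
by apply: cvgB => //; apply: cvgB => //; exact: cvg_cst.
Qed.

End euler_pathwise.

(** * Matrix-valued maps measurable with respect to a family of events *)

Definition msmeas {d} {Omega : measurableType d} {R : realType} {p q} (K : set (set Omega))
  (M : Omega -> 'M[R]_(p, q)) := forall i j, smeas K (fun o => M o i j).

Section msmeas_theory.
Context {d} {Omega : measurableType d} {R : realType}.
Variable K : set (set Omega).

Lemma msmeas_cst p q (c : 'M[R]_(p, q)) : msmeas K (fun=> c).
Proof. by move=> i j; exact: (@smeas_cst _ _ _ K). Qed.

Lemma msmeasD p q (f g : Omega -> 'M[R]_(p, q)) : msmeas K f -> msmeas K g -> msmeas K (fun o => f o + g o).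
Proof. by move=> mf mg i j; under eq_fun do rewrite mxE; exact: smeasD. Qed.

Lemma msmeasB p q (f g : Omega -> 'M[R]_(p, q)) : msmeas K f -> msmeas K g -> msmeas K (fun o => f o - g o).
Proof. by move=> mf mg i j; under eq_fun do rewrite !mxE; exact: smeasB. Qed.

Lemma msmeasM p q q' (f : Omega -> 'M[R]_(p, q)) (g : Omega -> 'M[R]_(q, q')) :
  msmeas K f -> msmeas K g -> msmeas K (fun o => f o *m g o).
Proof. by move=> mf mg i j; under eq_fun do rewrite mxE; apply: smeas_sum => k; exact: smeasM. Qed.

Lemma msmeas_mull p q q' (A : 'M[R]_(p, q)) (g : Omega -> 'M[R]_(q, q')) :
  msmeas K g -> msmeas K (fun o => A *m g o).
Proof. by apply: msmeasM; exact: msmeas_cst. Qed.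

Lemma msmeasZ p q (c : R) (f : Omega -> 'M[R]_(p, q)) : msmeas K f -> msmeas K (fun o => c *: f o).
Proof. by move=> mf i j; under eq_fun do rewrite mxE; apply: smeasM => //; exact: (@smeas_cst _ _ _ K). Qed.

Lemma msmeas_tr p q (f : Omega -> 'M[R]_(p, q)) : msmeas K f -> msmeas K (fun o => (f o)^T).
Proof. by move=> mf i j; under eq_fun do rewrite mxE; exact: mf. Qed.

Lemma smeas_inner p (f g : Omega -> 'cV[R]_p) : msmeas K f -> msmeas K g -> smeas K (fun o => inner (f o) (g o)).
Proof. by move=> mf mg; apply: smeas_sum => i; exact: smeasM. Qed.

End msmeas_theory.

(** * Expectations of nonnegative functions *)

Section expectation.
Context {R : realType} {d : measure_display} {Omega : measurableType d}.
Variable P : probability Omega R.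
Implicit Types f h : Omega -> R.

Lemma expect_le f h : measurable_fun setT f -> measurable_fun setT h ->
  (forall o, 0 <= f o) -> (forall o, f o <= h o) -> (\int[P]_o (f o)%:E <= \int[P]_o (h o)%:E)%E.
Proof.
move=> mf mh f0 fh; apply: ge0_le_integral => //=; try exact/measurable_EFinP.
- by move=> o _; rewrite lee_fin (le_trans (f0 o)).
- by move=> o _; rewrite lee_fin.
Qed.

Lemma expectD f h : measurable_fun setT f -> measurable_fun setT h ->
  (forall o, 0 <= f o) -> (forall o, 0 <= h o) ->
  (\int[P]_o (f o + h o)%:E = \int[P]_o (f o)%:E + \int[P]_o (h o)%:E)%E.
Proof.
move=> mf mh f0 h0; under eq_integral do rewrite EFinD.
rewrite ge0_integralD//; try exact/measurable_EFinP.
- by move=> o _; rewrite lee_fin.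
- by move=> o _; rewrite lee_fin.
Qed.

Lemma expectZ (c : R) f : measurable_fun setT f -> (forall o, 0 <= f o) -> 0 <= c ->
  (\int[P]_o (c * f o)%:E = c%:E * \int[P]_o (f o)%:E)%E.
Proof.
move=> mf f0 c0; under eq_integral do rewrite EFinM.
rewrite ge0_integralZl_EFin//; try exact/measurable_EFinP.
by move=> o _; rewrite lee_fin.
Qed.

Lemma expect_sum (I : Type) (t : seq I) (f : I -> Omega -> R) : (forall i, measurable_fun setT (f i)) ->
  (forall i o, 0 <= f i o) -> (\int[P]_o (\sum_(i <- t) f i o)%:E = \sum_(i <- t) \int[P]_o (f i o)%:E)%E.
Proof.
move=> mf f0; under eq_integral do rewrite -sumEFin.
rewrite ge0_integral_sum// => [i|i o _]; first exact/measurable_EFinP.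
by rewrite lee_fin.
Qed.

End expectation.

(** * Linear stochastic differential equations *)

Section linear_sde.
Context {R : realType} {d : measure_display} {Omega : measurableType d}.
Variables (P : probability Omega R) (T : R) (F : R -> set (set Omega)).
Context {r n : nat}.
Variable w : R -> Omega -> 'cV[R]_r.
Hypothesis T0 : 0 < T.
Hypothesis F_filtration : filtration T F.
Hypothesis w_wiener : wiener_process P T F w.
Variables (G : R -> 'M[R]_n) (g : R -> 'cV[R]_n) (sigma : R -> 'M[R]_(n, r)) (x0 : 'cV[R]_n).
Hypothesis G_cont : mcont T G.
Hypothesis g_cont : mcont T g.
Hypothesis sigma_cont : mcont T sigma.

Let T00 : 0 <= T := ltW T0.

Local Notation X N j o := (euler T G g sigma x0 (w ^~ o) N j).
Local Notation dw N j o := (increment T (w ^~ o) N j).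

Let w_cont o : mcont T (w ^~ o).
Proof. by have [_ wc _ _] := w_wiener; apply/mx_cont; exact: wc. Qed.

Lemma increment_smeas N j : (0 < N)%N -> (j < N)%N -> msmeas (F (node T N j.+1)) (fun o => dw N j o).
Proof.
move=> N0 jN a b; rewrite (ord1 b).
have /andP[j0 jT] := node_itv T00 (ltnW jN); have j1 := node_itv T00 jN.
apply: msmeasB => i k; rewrite (ord1 k); first exact: (wiener_smeas F_filtration w_wiener).
apply: (filtration_smeas_le F_filtration j0 (node_le N T00 (leqnSn j))); first by have /andP[] := j1.
by apply: (wiener_smeas F_filtration w_wiener); rewrite j0.
Qed.

Lemma euler_smeas N j : (0 < N)%N -> (j <= N)%N -> msmeas (F (node T N j)) (fun o => X N j o).
Proof.
move=> N0; elim: j => [|j IH] jN /=; first exact: msmeas_cst.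
have /andP[j0 jT] := node_itv T00 (ltnW jN); have /andP[j10 j1T] := node_itv T00 jN.
have h : msmeas (F (node T N j.+1)) (fun o => X N j o).
  move=> a b; apply: (filtration_smeas_le F_filtration j0 (node_le N T00 (leqnSn j)) j1T).
  exact: (IH (ltnW jN)).
apply: msmeasD => //; apply: msmeasD; last by apply: msmeas_mull; exact: increment_smeas.
by apply: msmeasZ; apply: msmeasD; [exact: msmeas_mull|exact: msmeas_cst].
Qed.

Section quadratic_variation.
Variable Pi : R -> 'M[R]_n.
Hypothesis Pi_cont : mcont T Pi.
Hypothesis Pi_sym : forall t, 0 <= t <= T -> (Pi t)^T = Pi t.

Local Notation q N j o := (quadratic_defect T sigma (w ^~ o) Pi N j).

Lemma quadratic_defect_smeas N i j : (0 < N)%N -> (i < j)%N -> (j <= N)%N ->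
  smeas (F (node T N j)) (fun o => q N i o).
Proof.
move=> N0 ij jN; apply: smeas_sum => a; apply: smeas_sum => b.
apply: smeasM; first exact: (@smeas_cst _ _ _ (F _)).
have /andP[i0 _] := node_itv T00 (leq_trans ij jN); have /andP[_ jT] := node_itv T00 jN.
have h := increment_smeas N0 (leq_trans ij jN).
apply: (filtration_smeas_le F_filtration i0 (node_le N T00 ij) jT).
by apply: smeasB; [apply: smeasM; exact: h|exact: (@smeas_cst _ _ _ (F _))].
Qed.

(** The defects are centred given the past, hence orthogonal, and each has second moment 2 dt^2
    |q|^2, where q is [ito_quadratic] at the node. The sum thus has second moment of order T^2 / N,
    and Chebyshev's inequality concludes. *)
Lemma quadratic_variation_cvgp : cvgp P (fun k o => \sum_(j < k.+1) q k.+1 j o).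
Proof.
have qc : mcont T (ito_quadratic sigma Pi).
  by apply: mcontM => //; apply: mcontM => //; exact: mcont_tr.
have [C C0 hC] := cont_bounded (cont_sqnorm qc).
have bound N j : (0 < N)%N -> (j <= N)%N ->
    (\int[P]_o ((\sum_(i < j) q N i o) ^+ 2)%:E <= (2 * (T / N%:R) ^+ 2 * C * j%:R)%:E)%E.
  move=> N0; elim: j => [|j IH] jN.
    by under eq_integral do rewrite big_ord0 expr0n/=; rewrite integral0 mulr0.
  have tin := node_itv T00 (ltnW jN); have /andP[j0 jT] := tin; have /andP[j10 j1T] := node_itv T00 jN.
  have sS : smeas (F (node T N j)) (fun o => \sum_(i < j) q N i o).
    by apply: smeas_sum => i; apply: quadratic_defect_smeas => //; exact: ltnW.
  have Ksym a b : ito_quadratic sigma Pi (node T N j) a b = ito_quadratic sigma Pi (node T N j) b a.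
    have E : (ito_quadratic sigma Pi (node T N j))^T = ito_quadratic sigma Pi (node T N j).
      by rewrite /ito_quadratic !trmx_mul trmxK Pi_sym// mulmxA.
    by rewrite -{1}E mxE.
  have := integral_wiener_quadratic F_filtration w_wiener j0 (node_le N T00 (leqnSn j)) j1T Ksym sS.
  rewrite nodeS => e.
  under eq_integral do rewrite big_ord_recr/= /quadratic_defect /increment.
  have -> : (\int[P]_o ((\sum_(i < j) q N i o + \sum_a \sum_b ito_quadratic sigma Pi (node T N j) a b *
     ((w (node T N j.+1) o - w (node T N j) o) a 0 * (w (node T N j.+1) o - w (node T N j) o) b 0 - (a == b)%:R * (T / N%:R))) ^+ 2)%:E =
     \int[P]_o ((\sum_(i < j) q N i o) ^+ 2 + 2 * (T / N%:R) ^+ 2 * \sum_i \sum_j0 ito_quadratic sigma Pi (node T N j) i j0 ^+ 2)%:E)%E.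
    rewrite -e; apply: eq_integral => o _; congr ((_ + _) ^+ 2)%:E.
    by apply: eq_bigr => a _; apply: eq_bigr => b _; rewrite !mxE.
  under eq_integral do rewrite EFinD.
  have k0 : 0 <= 2 * (T / N%:R) ^+ 2 * sqnorm (ito_quadratic sigma Pi (node T N j)).
    by rewrite mulr_ge0 ?sqnorm_ge0// mulr_ge0// sqr_ge0.
  rewrite ge0_integralD//=.
  - rewrite integral_cst//= (@probability_setT _ _ _ P) mule1 -[j.+1%:R]natr1 mulrDr mulr1 EFinD; apply: leeD.
      exact: IH (ltnW jN).
    rewrite lee_fin ler_wpM2l ?mulr_ge0 ?sqr_ge0//.
    exact: le_trans (ler_norm _) (hC _ tin).
  - by move=> o _; rewrite lee_fin sqr_ge0.
  - apply/measurable_EFinP; apply: measurable_funX.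
    exact: (filtration_smeas_measurable F_filtration tin).
move=> e e0.
have e30 : 0 < e ^+ 3 by rewrite exprn_gt0.
(* Chebyshev's bound 2 T C (T / N) / e^2 is at most e once 2 T C (T / N) <= e^3; the added 1 keeps
   the denominator positive. *)
have k0 : 0 < e ^+ 3 / (2 * T * C + 1) by rewrite divr_gt0// ltr_wpDl// !mulr_ge0.
have [N0 hN0] := near_mesh_lt T00 k0; exists N0 => k kN.
have mS : measurable_fun setT (fun o => \sum_(j < k.+1) q k.+1 j o).
  apply: (filtration_smeas_measurable F_filtration (node_itv T00 (leqnn k.+1))).
  by apply: smeas_sum => i; exact: quadratic_defect_smeas.
exists [set o | e ^+ 2 <= (\sum_(j < k.+1) q k.+1 j o) ^+ 2]; split.
- by apply: measurable_ge_set; exact: measurable_funX.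
- apply: (le_trans (markov_ge0 (measurable_funX 2 mS) (fun o => sqr_ge0 _) (exprn_gt0 2 e0) (bound k.+1 k.+1 isT (leqnn _)))).
  have -> : 2 * (T / k.+1%:R) ^+ 2 * C * k.+1%:R = 2 * T * C * (T / k.+1%:R).
    have : k.+1%:R != 0 :> R by []. 
    by move: (k.+1%:R) => D D0; field.
  rewrite lee_fin ler_pdivrMr ?exprn_gt0// -exprS.
  have := hN0 _ (leqW kN); rewrite ltr_pdivlMr ?ltr_wpDl ?mulr_ge0// => /ltW h.
  apply: le_trans h; rewrite mulrC; apply: ler_wpM2l; first exact: divr_ge0.
  by rewrite lerDl.
- move=> o /= /negP; rewrite -ltNge => h; apply: ltW; rewrite -(@ltr_pXn2r _ 2)// ?nnegrE ?ltW//.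
  by rewrite real_normK ?num_real.
Qed.

End quadratic_variation.

Variable x : R -> Omega -> 'cV[R]_n.
Hypothesis x_adapted : adapted F T x.
Hypothesis x_cont : continuous_paths T x.
Hypothesis x_eq : forall t, 0 <= t <= T ->
  exists2 M : Omega -> 'cV[R]_n, ito_integral P F w t (fun s _ => sigma s) M
  & {ae P, forall o, x t o = x0 + mx_integral t (fun s => G s *m x s o + g s) + M o}.

Let y_cont o : mcont T (x ^~ o).
Proof. by apply/mx_cont; exact: x_cont. Qed.

Let consistency k j o := x (node T k j) o - x0 - mx_integral (node T k j) (fun s => G s *m x s o + g s)
    - \sum_(i < j) sigma (node T k i) *m dw k i o.

(** At the nodes the equation for x identifies the consistency error with M minus the Wiener sum.
    The equation holds almost surely for each fixed time, and the countably many exceptional sets of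
    the nodes are merged. *)
Lemma euler_consistency_cvgp :
  cvgp P (fun k o => \big[Num.max/0]_(j < k.+2) sqnorm (consistency k.+1 j o)).
Proof.
have [M hM] : exists M : R -> Omega -> 'cV[R]_n, forall t, 0 <= t <= T ->
    ito_integral P F w t (fun s _ => sigma s) (M t) /\
    {ae P, forall o, x t o = x0 + mx_integral t (fun s => G s *m x s o + g s) + M t o}.
  have /boolp.choice[M hM] : forall t, exists M : Omega -> 'cV[R]_n, 0 <= t <= T ->
      ito_integral P F w t (fun s _ => sigma s) M /\
      {ae P, forall o, x t o = x0 + mx_integral t (fun s => G s *m x s o + g s) + M o}.
    move=> t; have [tT|tT] := boolP (0 <= t <= T); last by exists (fun=> 0).
    by have [M h1 h2] := x_eq tT; exists M.
  by exists M.
apply: cvgp_ae_eq (martingale_approximation T00 F_filtration w_wiener sigma_cont T0 (fun t tT => (hM t tT).1)) => k.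
have h : {ae P, forall o, forall j, (j <= k.+1)%N -> x (node T k.+1 j) o = x0 +
    mx_integral (node T k.+1 j) (fun s => G s *m x s o + g s) + M (node T k.+1 j) o}.
  apply: ae_foralln => j; have [jk|jk] := leqP j k.+1; last by apply: aeW.
  by apply: filterS (hM _ (node_itv T00 jk)).2 => o ->.
apply: filterS h => o h; apply: eq_bigr => j _.
rewrite /consistency h; last by have := ltn_ord j.
by congr sqnorm; apply/matrixP => a b; rewrite !mxE; ring.
Qed.

Variables (Pi dPi : R -> 'M[R]_n) (s ds : R -> 'cV[R]_n).
Hypothesis Pi_cont : mcont T Pi.
Hypothesis dPi_cont : mcont T dPi.
Hypothesis s_cont : mcont T s.
Hypothesis ds_cont : mcont T ds.
Hypothesis Pi_sym : forall t, 0 <= t <= T -> (Pi t)^T = Pi t.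
Hypothesis Pi_der : forall i j (t : R), 0 < t < T -> is_derive t 1 (fun u => Pi u i j) (dPi t i j).
Hypothesis s_der : forall i j (t : R), 0 < t < T -> is_derive t 1 (fun u => s u i j) (ds t i j).

(** Ito's formula solved for its stochastic integral. It is defined for every outcome from the path
    of x alone, so its measurability follows from that of x. *)
Definition ito_remainder (o : Omega) : R :=
  ito_potential Pi s T (x T o) - ito_potential Pi s 0 x0
  - path_integral T (fun t => ito_drift G g sigma Pi dPi s ds t (x t o)).

Definition gradient_process t o := ito_gradient sigma Pi s t (x t o).
Definition euler_gradient N j o := ito_gradient sigma Pi s (node T N j) (X N j o).
(** The coefficients are taken along the Euler scheme and not along x: the sums in [discrete_ito]
    and in the discrete density are then exactly integrals of this step process. The transpose makes
    the integrand a row. *)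
Definition gradient_step N : @step_process R d Omega 1 r :=
  grid_step T N N (fun j o => (euler_gradient N j o)^T).

Lemma euler_gradient_smeas N j : (0 < N)%N -> (j <= N)%N -> msmeas (F (node T N j)) (euler_gradient N j).
Proof.
move=> N0 jN; apply: msmeas_mull; apply: msmeasD; last exact: msmeas_cst.
by apply: msmeas_mull; exact: euler_smeas.
Qed.

Lemma gradient_process_cont o : mcont T (gradient_process ^~ o).
Proof. by apply: mcontM; [exact: mcont_tr|apply: mcontD => //; exact: mcontM]. Qed.

Lemma gradient_process_smeas t : 0 <= t <= T -> msmeas (F t) (gradient_process t).
Proof.
move=> /andP[t0 tT]; apply: msmeas_mull; apply: msmeasD; last exact: msmeas_cst.
by apply: msmeas_mull => a b; exact: (adapted_smeas F_filtration a b x_adapted).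
Qed.

Lemma gradient_step_nonanticipative N : (0 < N)%N -> nonanticipative_step F T (gradient_step N).
Proof.
move=> N0; rewrite -[t in nonanticipative_step F t _](nodeN T N0).
apply: grid_step_nonanticipative => // i iN; apply: msmeas_tr.
by apply: euler_gradient_smeas => //; exact: ltnW.
Qed.

Lemma gradient_step_integral N o : step_integral w (gradient_step N) o 0 0 =
  \sum_(j < N) inner (euler_gradient N j o) (dw N j o).
Proof.
rewrite /step_integral /= summxE; apply: eq_bigr => j _.
by rewrite innerE.
Qed.

(** A single subsequence along which the consistency errors and the summed quadratic defects both
    vanish almost surely. On each such path the three limits are deterministic consequences. *)
Lemma euler_subsequence : exists2 phi : nat -> nat, (forall l, (l <= phi l)%N) &
  {ae P, forall o,
    step_integral w (gradient_step (phi l).+1) o 0 0 @[l --> \oo] --> ito_remainder o /\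
    path_integral T (fun t => sqnorm (step_value (gradient_step (phi l).+1) t o - (gradient_process t o)^T))
      @[l --> \oo] --> (0 : R) /\
    \sum_(j < (phi l).+1) sqnorm (euler_gradient (phi l).+1 j o) * (T / (phi l).+1%:R) @[l --> \oo]
      --> path_integral T (fun t => sqnorm (gradient_process t o))}.
Proof.
have nq : cvgp P (fun k o => `|\sum_(j < k.+1) quadratic_defect T sigma (w ^~ o) Pi k.+1 j|).
  apply: cvgp_le (quadratic_variation_cvgp Pi_cont Pi_sym) _.
  by exists 0%N => k _ o; rewrite normr_id.
have [phi hphi ae] := cvgp_subseq (cvgpD euler_consistency_cvgp nq).
exists phi => //; apply: filterS ae => o ho.
pose N l := (phi l).+1.
have N_gt0 l : (0 < N l)%N by [].
have N_large l : (l <= N l)%N by exact: leqW.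
have cons e : 0 < e -> exists l0, forall l, (l0 <= l)%N -> forall j, (j <= N l)%N ->
    `|consistency (N l) j o| <= e.
  move=> e0; have /cvgrPdist_le/(_ _ (exprn_gt0 2 e0)) := ho.
  rewrite nearE => -[l0 _ hl]; exists l0 => l ll j jN.
  apply: norm_le_sqnorm; first exact: ltW.
  have := hl l ll; rewrite /= sub0r normrN => h.
  apply: le_trans (le_trans (ler_norm _) h).
  rewrite -[leLHS]addr0; apply: lerD => //.
  exact: (le_bigmax _ (fun j : 'I_(phi l).+2 => sqnorm (consistency (phi l).+1 j o)) (Ordinal (jN : (j < (phi l).+2)%N))).
have qv : \sum_(j < N l) quadratic_defect T sigma (w ^~ o) Pi (N l) j @[l --> \oo] --> (0 : R).
  apply/cvgrPdist_le => e e0; have /cvgrPdist_le/(_ _ e0) := ho.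
  rewrite nearE => -[l0 _ hl]; exists l0 => // l ll; have := hl l ll.
  rewrite /= !sub0r !normrN; apply: le_trans; apply: le_trans (ler_norm _).
  by rewrite lerDr; exact: bigmax_ge_id.
split.
  under eq_fun do rewrite gradient_step_integral.
  exact: (discrete_ito T0 N_gt0 N_large G_cont g_cont sigma_cont (@w_cont o) (@y_cont o) cons
    Pi_cont dPi_cont s_cont ds_cont Pi_sym Pi_der s_der qv).
have cX := euler_mucvg T0 N_gt0 N_large G_cont g_cont (@y_cont o) cons.
have cg : mucvg T N (fun l j => euler_gradient (N l) j o) (gradient_process ^~ o).
  apply: mucvgM => //; [exact: mcont_tr|by apply: mcontD => //; exact: mcontM|exact: mucvg_node|].
  by apply: mucvgD; [apply: mucvgM => //; exact: mucvg_node|exact: mucvg_node].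
split; last first.
  exact: (ucvg_riemann T00 N_gt0 N_large (cont_sqnorm (@gradient_process_cont o))
    (ucvg_sqnorm T00 (@gradient_process_cont o) cg)).
apply/cvgrPdist_le => e e0.
(* The error splits into scheme against x at the node, and x at the node against x inside the cell.
   Doubling each of the two squared bounds e / (4 T) gives e / T, which integrates to e. *)
have k0 : 0 < e / 4 / T by rewrite !divr_gt0.
have [dl dl0 hdl] := mheine (@gradient_process_cont o) k0.
have [l0 hl0] := near_mesh T00 N_large dl0.
have k1 : 0 < Num.min 1 (e / 4 / T / (r%:R + 1)).
  by rewrite lt_min ltr01 divr_gt0// ltr_wpDl.
have [l1 hl1] := @finite_threshold 'I_r (fun i l => forall j, (j < N l)%N ->
   `|euler_gradient (N l) j o i 0 - gradient_process (node T (N l) j) o i 0| <= Num.min 1 (e / 4 / T / (r%:R + 1)))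
   (fun i => cg i 0 _ k1).
exists (maxn l0 l1) => // l /=; rewrite geq_max => /andP[ll0 ll1].
rewrite sub0r normrN ger0_norm; last by apply: Rintegral_ge0 => t _; exact: sqnorm_ge0.
rewrite -[t in path_integral t](nodeN T (N_gt0 l)).
apply: (@le_trans _ _ (T * (e / T))); last by rewrite mulrC divfK// gt_eqF.
apply: (@grid_step_error _ _ _ _ _ _ T00 (N l) (N l) _ (fun t => (gradient_process t o)^T)) => //.
- by rewrite divr_ge0 ?ltW.
- by rewrite nodeN//; apply: mcont_tr; exact: gradient_process_cont.
- move=> j t jN /andP[t1 t2].
  have tr p q (A B : 'M[R]_(p, q)) : sqnorm (A^T - B^T) = sqnorm (A - B).
    by rewrite /sqnorm exchange_big/=; apply: eq_bigr => a _; apply: eq_bigr => b _; rewrite !mxE.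
  rewrite tr.
  have /andP[j0 jT] := node_itv T00 (ltnW jN); have /andP[j10 j1T] := node_itv T00 jN.
  have h1 : sqnorm (gradient_process (node T (N l) j) o - gradient_process t o) <= e / 4 / T.
    apply: hdl; rewrite ?j0 ?jT// ?(le_trans j0 (ltW t1)) ?(le_trans t2 j1T)//.
    rewrite distrC gtr0_norm ?subr_gt0//; apply: le_lt_trans (hl0 l ll0).
    by rewrite -(nodeS T (N l) j) lerD2r.
  have h2 : sqnorm (euler_gradient (N l) j o - gradient_process (node T (N l) j) o) <= e / 4 / T.
    have := hl1 l ll1; set m := Num.min _ _ => hm.
    have m0 : 0 <= m by exact: ltW.
    apply: (@le_trans _ _ ((r * 1)%:R * m ^+ 2)).
      have entry (A B : 'cV[R]_r) i : (A - B) i 0 = A i 0 - B i 0 by rewrite !mxE.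
      by apply: sqnorm_le_entries => i a; rewrite (ord1 a) entry; exact: hm.
    apply: (@le_trans _ _ ((r%:R + 1) * m)).
      apply: ler_pM; rewrite ?sqr_ge0// ?muln1 ?lerDl//.
      have m1 : m <= 1 by rewrite /m ge_min lexx.
      by rewrite expr2 ler_piMr.
    by rewrite mulrC -ler_pdivlMr ?ltr_wpDl// /m ge_min lexx orbT.
  have -> : euler_gradient (N l) j o - gradient_process t o =
    (euler_gradient (N l) j o - gradient_process (node T (N l) j) o) + (gradient_process (node T (N l) j) o - gradient_process t o).
    by rewrite addrA subrK.
  apply: (le_trans (sqnormD_le _ _)).
  have -> : e / T = 4 * (e / 4 / T) by field; rewrite gt_eqF.
  by move: h1 h2; set z := e / 4 / T; lra.
Qed.

Lemma ito_remainder_measurable : measurable_fun setT ito_remainder.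
Proof.
have TT : 0 <= T <= T by rewrite T00 lexx.
have mx t : 0 <= t <= T -> msmeas (F t) (x t).
  by move=> /andP[t0 tT] a b; exact: (adapted_smeas F_filtration a b x_adapted).
apply: measurable_funB.
  apply: measurable_funB; last exact: measurable_cst.
  apply: (filtration_smeas_measurable F_filtration TT); apply: smeasD.
    apply: smeasM; first exact: (@smeas_cst _ _ _ (F T)).
    by apply: smeas_inner; [apply: msmeas_mull|]; exact: mx.
  by apply: smeas_inner; [exact: msmeas_cst|exact: mx].
apply: (@measurable_path_integral _ _ _ T (fun t o => ito_drift G g sigma Pi dPi s ds t (x t o))).
apply: jmeas_continuous => [//|t tT|o].
  apply: (filtration_smeas_measurable F_filtration tT).
  apply: smeasD; last exact: (@smeas_cst _ _ _ (F t)).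
  apply: smeasD.
    apply: smeasD.
      apply: smeasM; first exact: (@smeas_cst _ _ _ (F t)).
      by apply: smeas_inner; [apply: msmeas_mull|]; exact: mx.
    by apply: smeas_inner; [exact: msmeas_cst|exact: mx].
  apply: smeas_inner; (apply: msmeasD; [apply: msmeas_mull; exact: mx|exact: msmeas_cst]).
have c2 : cont T (fun=> 2^-1) by exact: cont_cst.
apply: contD; last first.
  by apply: contM => //; apply: cont_trace; apply: mcontM => //; apply: mcontM => //; exact: mcont_tr.
apply: contD.
  apply: contD; last exact: cont_inner.
  by apply: contM => //; apply: cont_inner => //; exact: mcontM.
by apply: cont_inner; (apply: mcontD => //; exact: mcontM).
Qed.

Let gradient_tr_adapted : adapted F T (fun t o => (gradient_process t o)^T).
Proof.
have [sF _ _] := F_filtration => t tT i j.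
by apply/smeasP; [exact: sF|exact: (msmeas_tr (gradient_process_smeas tT))].
Qed.

Let gradient_tr_paths : continuous_paths T (fun t o => (gradient_process t o)^T).
Proof. by move=> o; apply/mx_cont; apply: mcont_tr; exact: gradient_process_cont. Qed.

(** Both claims come from one sequence of step processes, whose integrals converge to
    [ito_remainder] almost surely, hence in probability. By [ito_identification] the same integrals
    converge to any other version of the Ito integral, so the two limits agree almost surely. *)
Theorem ito_integral_gradient :
  ito_integral P F w T (fun t o => (gradient_process t o)^T) (fun o => const_mx (ito_remainder o)) /\
  (forall I : Omega -> 'cV[R]_1, ito_integral P F w T (fun t o => (gradient_process t o)^T) I ->
    {ae P, forall o, I o 0 0 = ito_remainder o}).
Proof.
have [phi hphi hae] := euler_subsequence.
pose K l := gradient_step (phi l).+1.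
have hK l : nonanticipative_step F T (K l) by exact: gradient_step_nonanticipative.
have mJ : measurable_fun setT ito_remainder := ito_remainder_measurable.
have c1 : cvgp P (fun l o => path_integral T (fun t => sqnorm (step_value (K l) t o - (gradient_process t o)^T))).
  apply: ae_cvgp; last by apply: filterS hae => o [_ []].
  by move=> l; exact: (measurable_path_sqnorm_step F_filtration T00 (lexx T) gradient_tr_adapted gradient_tr_paths).
have c2 : cvgp P (fun l o => sqnorm (step_integral w (K l) o - const_mx (ito_remainder o))).
  apply: ae_cvgp.
    move=> l; apply: measurable_sqnorm => a b; under eq_fun do rewrite !mxE.
    apply: measurable_funB => //.
    exact: (step_integral_measurable F_filtration w_wiener (lexx T)).
  apply: filterS hae => o [h _].
  have -> : (fun l => sqnorm (step_integral w (K l) o - const_mx (ito_remainder o))) =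
    (fun l => (step_integral w (K l) o 0 0 - ito_remainder o) ^+ 2).
    by apply/funext => l; rewrite /sqnorm !big_ord1 !mxE.
  have h0 : step_integral w (K l) o 0 0 - ito_remainder o @[l --> \oo] --> (0 : R).
    by apply/subr_cvg0.
  under eq_fun do rewrite expr2; rewrite -(mulr0 (0 : R)); exact: cvgM.
split.
  apply: (ito_integral_of_cvgp F_filtration w_wiener T00 (lexx T) gradient_tr_adapted gradient_tr_paths _ hK c1 c2).
  by move=> a b; under eq_fun do rewrite mxE.
move=> I hI.
have c3 := ito_identification F_filtration w_wiener T00 (lexx T) gradient_tr_adapted gradient_tr_paths hI hK c1.
have c4 : cvgp P (fun=> fun o => sqnorm (const_mx (ito_remainder o) - I o)).
  apply: (cvgp_le (cvgpD (cvgpZ 2 c3) (cvgpZ 2 c2))); exists 0%N => l _ o.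
  rewrite ger0_norm ?sqnorm_ge0//; apply: le_trans (ler_norm _).
  have -> : const_mx (ito_remainder o) - I o = (step_integral w (K l) o - I o) - (step_integral w (K l) o - const_mx (ito_remainder o)).
    by rewrite opprB addrCA [step_integral _ _ _ - _ - _]addrAC subrr add0r.
  exact: sqnormB_le.
apply: filterS (cvgp_cst_eq0 c4) => o.
rewrite /sqnorm !big_ord1 !mxE => /eqP; rewrite sqrf_eq0 subr_eq0 => /eqP h.
exact/esym.
Qed.

(** * The exponential martingale *)

Section exponential_martingale.
Variable delta : R.

Local Notation gam N j o := (euler_gradient N j o).

Definition log_density N j o := \sum_(i < j) (delta * inner (gam N i o) (dw N i o)
  - delta ^+ 2 / 2 * sqnorm (gam N i o) * (T / N%:R)).
Definition density N j o := expR (log_density N j o).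
(** The discrete integral of delta gamma against dw - delta gamma dt, the noise that is centred
    under the weight [density]. *)
Definition tilted_sum N j o :=
  delta * \sum_(i < j) (inner (gam N i o) (dw N i o) - delta * sqnorm (gam N i o) * (T / N%:R)).
Definition energy_sum N j o := \sum_(i < j) sqnorm (gam N i o) * (T / N%:R).

Lemma log_densityE N j o : log_density N j o = tilted_sum N j o + delta ^+ 2 / 2 * energy_sum N j o.
Proof.
rewrite /log_density /tilted_sum /energy_sum !mulr_sumr -big_split; apply: eq_bigr => i _ /=.
by move: (T / N%:R) => h; field.
Qed.

Let gam_smeas N i j : (0 < N)%N -> (i <= j)%N -> (j <= N)%N -> msmeas (F (node T N j)) (fun o => gam N i o).
Proof.
move=> N0 ij jN a b.
have /andP[i0 _] := node_itv T00 (leq_trans ij jN); have /andP[_ jT] := node_itv T00 jN.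
apply: (filtration_smeas_le F_filtration i0 (node_le N T00 ij) jT).
exact: (euler_gradient_smeas N0 (leq_trans ij jN)).
Qed.

Let dw_smeas N i j : (0 < N)%N -> (i < j)%N -> (j <= N)%N -> msmeas (F (node T N j)) (fun o => dw N i o).
Proof.
move=> N0 ij jN a b.
have /andP[i0 _] := node_itv T00 (leq_trans ij jN); have /andP[_ jT] := node_itv T00 jN.
apply: (filtration_smeas_le F_filtration i0 (node_le N T00 ij) jT).
exact: (increment_smeas N0 (leq_trans ij jN)).
Qed.

Let log_density_smeas N j : (0 < N)%N -> (j <= N)%N -> smeas (F (node T N j)) (log_density N j).
Proof.
move=> N0 jN; apply: smeas_sum => i.
have g1 := gam_smeas N0 (ltnW (ltn_ord i)) jN.
apply: smeasB; apply: smeasM; try exact: (@smeas_cst _ _ _ (F _)).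
  by apply: smeas_inner => //; exact: dw_smeas.
by apply: smeasM; [exact: (@smeas_cst _ _ _ (F _))|exact: smeas_sqnorm].
Qed.

Let density_smeas N j : (0 < N)%N -> (j <= N)%N -> smeas (F (node T N j)) (density N j).
Proof. by move=> N0 jN; apply: smeas_expR; exact: log_density_smeas. Qed.

Let tilted_sum_smeas N j : (0 < N)%N -> (j <= N)%N -> smeas (F (node T N j)) (tilted_sum N j).
Proof.
move=> N0 jN; apply: smeasM; first exact: (@smeas_cst _ _ _ (F _)).
apply: smeas_sum => i; have g1 := gam_smeas N0 (ltnW (ltn_ord i)) jN.
apply: smeasB; first by apply: smeas_inner => //; exact: dw_smeas.
apply: smeasM; last exact: (@smeas_cst _ _ _ (F _)).
by apply: smeasM; [exact: (@smeas_cst _ _ _ (F _))|exact: smeas_sqnorm].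
Qed.

Let energy_sum_smeas N i j : (0 < N)%N -> (i <= j.+1)%N -> (j <= N)%N -> smeas (F (node T N j)) (energy_sum N i).
Proof.
move=> N0 ij jN; apply: smeas_sum => k.
apply: smeasM; last exact: (@smeas_cst _ _ _ (F _)).
by apply: smeas_sqnorm; apply: gam_smeas => //; exact: leq_trans (ltn_ord k) ij.
Qed.

Let node_smeas_measurable N j (f : Omega -> R) : (j <= N)%N -> smeas (F (node T N j)) f -> measurable_fun setT f.
Proof. by move=> jN; exact: (filtration_smeas_measurable F_filtration (node_itv T00 jN)). Qed.

(** Girsanov's theorem for one step of the scheme: integrating out the last factor of the density
    gives the increment the mean delta gamma dt, while V, y and c, known at node j, are
    untouched. *)
Lemma integral_density_step N j (V y : Omega -> R) (c : 'I_r -> Omega -> R) : (0 < N)%N -> (j < N)%N ->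
  smeas (F (node T N j)) V -> (forall o, 0 <= V o) -> smeas (F (node T N j)) y ->
  (forall a, smeas (F (node T N j)) (c a)) ->
  (\int[P]_o (density N j.+1 o * V o * (y o + \sum_a c a o * dw N j o a 0) ^+ 2)%:E =
   \int[P]_o (density N j o * V o * ((y o + (T / N%:R) * \sum_a c a o * (delta * gam N j o a 0)) ^+ 2
     + (T / N%:R) * \sum_a c a o ^+ 2))%:E)%E.
Proof.
move=> N0 jN mV V0 my mc.
have /andP[j0 jT] := node_itv T00 (ltnW jN); have /andP[_ j1T] := node_itv T00 jN.
have mY : smeas (F (node T N j)) (fun o => density N j o * V o).
  by apply: smeasM => //; apply: density_smeas => //; exact: ltnW.
have mal a : smeas (F (node T N j)) (fun o => delta * gam N j o a 0).
  by apply: smeasM; [exact: (@smeas_cst _ _ _ (F _))|exact: (gam_smeas N0 (leqnn j) (ltnW jN))].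
have Y0 o : 0 <= density N j o * V o by rewrite mulr_ge0 ?expR_ge0.
have := integral_wiener_tilt F_filtration w_wiener j0 (node_le N T00 (leqnSn j)) j1T mY my mal mc Y0.
rewrite nodeS => <-; apply: eq_integral => o _; congr EFin.
rewrite /density /log_density big_ord_recr/= expRD -!mulrA; congr (_ * _).
rewrite mulrCA; congr (_ * (expR _ * (_ + _) ^+ 2)).
  transitivity (\sum_a (delta * (gam N j o a 0 * dw N j o a 0)
      - delta * (delta * (2^-1 * (gam N j o a 0 ^+ 2 * (T / N%:R)))))).
    by rewrite sumrB -!mulr_sumr -mulr_suml sum_sqnorm_cV.
  by apply: eq_bigr => a _; rewrite [dw _ _ _ _ _]mxE [(- _ : 'cV_r) _ _]mxE; move: (T / N%:R) => h; field.
by apply: eq_bigr => a _; rewrite !mxE.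
Qed.

(** The martingale property of the density, tested against V known at node j: the case y = 1, c = 0
    of the previous lemma. *)
Lemma integral_density_smeas N j (V : Omega -> R) : (0 < N)%N -> (j < N)%N ->
  smeas (F (node T N j)) V -> (forall o, 0 <= V o) ->
  (\int[P]_o (density N j.+1 o * V o)%:E = \int[P]_o (density N j o * V o)%:E)%E.
Proof.
move=> N0 jN mV V0.
have := @integral_density_step N j V (fun=> 1) (fun _ _ => 0) N0 jN mV V0
  (@smeas_cst _ _ _ (F _) _) (fun=> @smeas_cst _ _ _ (F _) _) => h.
transitivity (\int[P]_o (density N j.+1 o * V o * (1 + \sum_a 0 * dw N j o a 0) ^+ 2)%:E)%E.
  by apply: eq_integral => o _; rewrite big1 ?addr0 ?expr1n ?mulr1// => a _; rewrite mul0r.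
rewrite h; apply: eq_integral => o _; rewrite !big1 ?mulr0 ?addr0 ?expr1n ?mulr1// => a _; first by rewrite expr0n.
by rewrite mul0r.
Qed.

Lemma integral_density N j : (0 < N)%N -> (j <= N)%N -> (\int[P]_o (density N j o)%:E = 1)%E.
Proof.
move=> N0; elim: j => [|j IH] jN.
  under eq_integral do rewrite /density /log_density big_ord0 expR0.
  by rewrite integral_cst//= (@probability_setT _ _ _ P) mule1.
rewrite -(IH (ltnW jN)).
have := @integral_density_smeas N j (fun=> 1) N0 jN (@smeas_cst _ _ _ (F _) _) (fun=> ler01).
by under eq_integral do rewrite mulr1; move=> ->; under eq_integral do rewrite mulr1.
Qed.

Lemma linear_growth p (A : R -> 'M[R]_(p, n)) (a : R -> 'cV[R]_p) : mcont T A -> mcont T a ->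
  exists2 C, 0 <= C & forall t z, 0 <= t <= T -> sqnorm (A t *m z + a t) <= C * (1 + sqnorm z).
Proof.
move=> cA ca; have [K K0 hK] := mcont_bounded cA; have [L L0 hL] := cont_bounded (cont_sqnorm ca).
pose D := 2 * p%:R * (n%:R * K) ^+ 2.
have D0 : 0 <= D by rewrite !mulr_ge0 ?sqr_ge0.
exists (D + 2 * L) => [|t z tT]; first by rewrite addr_ge0// mulr_ge0.
have z0 := sqnorm_ge0 z.
have h1 : sqnorm (A t *m z) <= p%:R * (n%:R * K) ^+ 2 * sqnorm z.
  apply: (le_trans (sqnorm_le_norm _)); rewrite muln1 -mulrA; apply: ler_wpM2l => //.
  apply: (@le_trans _ _ ((n%:R * K * `|z|) ^+ 2)).
    rewrite lerXn2r ?nnegrE ?mulr_ge0//; apply: (le_trans (mulmx_norm_le _ _)).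
    by rewrite ler_wpM2r// ler_wpM2l// hK.
  rewrite exprMn ler_wpM2l ?sqr_ge0//.
  have e : Num.sqrt (sqnorm z) ^+ 2 = sqnorm z by rewrite sqr_sqrtr.
  rewrite -[leRHS]e lerXn2r ?nnegrE ?sqrtr_ge0//.
  by apply: norm_le_sqnorm; rewrite ?sqrtr_ge0// e.
have h2 : sqnorm (a t) <= L := le_trans (ler_norm _) (hL t tT).
apply: (le_trans (sqnormD_le _ _)).
have : 2 * sqnorm (A t *m z) <= D * sqnorm z 
  by rewrite /D -!(mulrA 2) ler_wpM2l.
by have := mulr_ge0 L0 z0; nra.
Qed.

(** Under the density the scheme follows the drift G + delta sigma sigma^T Pi with a correspondingly
    changed vector. It stays affine with bounded coefficients, so second moments grow by a factor of
    at most 1 + h c per step, and (1 + h c)^N <= exp(T c) independently of N. *)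
Lemma density_moment : exists2 C, 0 <= C & forall N j, (0 < N)%N -> (j <= N)%N ->
  (\int[P]_o (density N j o * (1 + sqnorm (X N j o)))%:E <= C%:E)%E.
Proof.
pose A t := G t + delta *: (sigma t *m ((sigma t)^T *m Pi t)).
pose a t := g t + delta *: (sigma t *m ((sigma t)^T *m s t)).
have cA : mcont T A by apply: mcontD => //; apply: mcontZ; apply: mcontM => //; apply: mcontM => //; exact: mcont_tr.
have ca : mcont T a by apply: mcontD => //; apply: mcontZ; apply: mcontM => //; apply: mcontM => //; exact: mcont_tr.
have [K K0 hK] := linear_growth cA ca; have [L L0 hL] := cont_bounded (cont_sqnorm sigma_cont).
(* From |x + h v|^2 <= (1 + h) |x|^2 + h (1 + h) |v|^2 with |v|^2 <= K (1 + |x|^2) and h <= T; the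
   noise adds at most h L. *)
pose c := 1 + (1 + T) * K + L.
have c0 : 0 <= c by rewrite !addr_ge0// mulr_ge0// addr_ge0.
exists ((1 + sqnorm x0) * expR (T * c)) => [|N j N0 jN].
  by rewrite mulr_ge0 ?expR_ge0// addr_ge0// sqnorm_ge0.
pose h := T / N%:R; have h0 : 0 <= h by exact: divr_ge0.
have N1 : (0 : R) < N%:R by rewrite ltr0n.
have hT : h <= T by rewrite /h ler_pdivrMr// ler_peMr// ler1n.
apply: (@le_trans _ _ ((1 + sqnorm x0) * (1 + h * c) ^+ j)%:E); last first.
  rewrite lee_fin ler_wpM2l ?addr_ge0 ?sqnorm_ge0//.
  apply: (le_trans (expr1D_le_expR _ (mulr_ge0 h0 c0))); rewrite ler_expR -[_ *+ j]mulr_natr mulrAC ler_wpM2r//.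
  by rewrite /h mulrAC ler_pdivrMr// ler_wpM2l// ler_nat.
elim: j jN => [|j IH] jN.
  under eq_integral do rewrite /density /log_density big_ord0 expR0 mul1r /=.
  by rewrite integral_cst//= (@probability_setT _ _ _ P) mule1 expr0 mulr1.
have jN' := ltnW jN; have tin := node_itv T00 jN'.
have mX1 : msmeas (F (node T N j.+1)) (fun o => X N j.+1 o) by exact: euler_smeas.
have mX : msmeas (F (node T N j)) (fun o => X N j o) by exact: euler_smeas.
have mD1 : measurable_fun setT (density N j.+1) by apply: (node_smeas_measurable jN); exact: density_smeas.
have mD : measurable_fun setT (density N j) by apply: (node_smeas_measurable jN'); exact: density_smeas.
have D0 k o : 0 <= density N k o by exact: expR_ge0.
pose y o := X N j o + h *: (G (node T N j) *m X N j o + g (node T N j)).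
have my : msmeas (F (node T N j)) y.
  by apply: msmeasD => //; apply: msmeasZ; apply: msmeasD; [exact: msmeas_mull|exact: msmeas_cst].
(* y is the conditional mean of the next state under P, z the one under the density; [zE] says that
   the drift shift carries one to the other. *)
pose z o := X N j o + h *: (A (node T N j) *m X N j o + a (node T N j)).
have zE o i : y o i 0 + h * \sum_a0 sigma (node T N j) i a0 * (delta * gam N j o a0 0) = z o i 0.
  have -> : \sum_a0 sigma (node T N j) i a0 * (delta * gam N j o a0 0) = (delta *: (sigma (node T N j) *m gam N j o)) i 0.
    by rewrite [RHS]mxE [t in _ * t]mxE mulr_sumr; apply: eq_bigr => b _; ring.
  have -> : z o = y o + h *: (delta *: (sigma (node T N j) *m gam N j o)).
    rewrite /z /y -[in RHS]addrA -[in RHS]scalerDr; congr (_ + _ *: _).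
    rewrite /A /a /euler_gradient /ito_gradient mulmxDl.
    rewrite addrACA; congr (_ + _); rewrite -scalemxAl -scalerDr; congr (_ *: _).
    by rewrite !mulmxDr !mulmxA.
  by rewrite [RHS]mxE [t in _ = _ + t]mxE.
have mz : msmeas (F (node T N j)) z.
  by apply: msmeasD => //; apply: msmeasZ; apply: msmeasD; [exact: msmeas_mull|exact: msmeas_cst].
pose sg i := \sum_a0 sigma (node T N j) i a0 ^+ 2.
have step i : (\int[P]_o (density N j.+1 o * (X N j.+1 o i 0) ^+ 2)%:E =
    \int[P]_o (density N j o * ((z o i 0) ^+ 2 + h * sg i))%:E)%E.
  have := @integral_density_step N j (fun=> 1) (fun o => y o i 0) (fun a0 _ => sigma (node T N j) i a0) N0 jN
   (@smeas_cst _ _ _ (F _) _) (fun=> ler01) (my i 0) (fun=> @smeas_cst _ _ _ (F _) _) => e.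
  transitivity (\int[P]_o (density N j.+1 o * 1 *
       (y o i 0 + \sum_a0 sigma (node T N j) i a0 * dw N j o a0 0) ^+ 2)%:E)%E.
    apply: eq_integral => o _; rewrite mulr1; congr (_ * _ ^+ 2)%:E.
    by rewrite /= addrA [LHS]mxE [t in _ + t]mxE.
  by rewrite e; apply: eq_integral => o _; rewrite mulr1 zE.
have sqn1 (v : 'cV[R]_n) : 1 + sqnorm v = 1 + \sum_i v i 0 ^+ 2 by rewrite sum_sqnorm_cV.
have -> : (\int[P]_o (density N j.+1 o * (1 + sqnorm (X N j.+1 o)))%:E =
    \int[P]_o (density N j.+1 o + \sum_i density N j.+1 o * (X N j.+1 o i 0) ^+ 2)%:E)%E.
  by apply: eq_integral => o _; rewrite sqn1 mulrDr mulr1 mulr_sumr.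
have mX1i i : measurable_fun setT (fun o => density N j.+1 o * (X N j.+1 o i 0) ^+ 2).
  apply: measurable_funM => //; apply: measurable_funX; exact: (node_smeas_measurable jN (mX1 i 0)).
have mzi i : measurable_fun setT (fun o => density N j o * ((z o i 0) ^+ 2 + h * sg i)).
  apply: measurable_funM => //; apply: measurable_funD => //.
  by apply: measurable_funX; exact: (node_smeas_measurable jN' (mz i 0)).
have zi0 i o : 0 <= density N j o * ((z o i 0) ^+ 2 + h * sg i).
  by rewrite mulr_ge0// addr_ge0 ?sqr_ge0// mulr_ge0// sumr_ge0// => b _; exact: sqr_ge0.
rewrite expectD//; last 2 first.
- by apply: measurable_sum.
- by move=> o; apply: sumr_ge0 => i _; rewrite mulr_ge0 ?sqr_ge0.
rewrite expect_sum//; last by move=> i o; rewrite mulr_ge0 ?sqr_ge0.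
under eq_bigr do rewrite step.
rewrite -expect_sum// (integral_density N0 jN) -(integral_density N0 jN') -expectD//; last 2 first.
- by apply: measurable_sum.
- by move=> o; apply: sumr_ge0.
have mXs : measurable_fun setT (fun o => density N j o * (1 + sqnorm (X N j o))).
  apply: measurable_funM => //; apply: measurable_funD => //.
  by apply: measurable_sqnorm => a0 b0; exact: (node_smeas_measurable jN' (mX a0 b0)).
have Xs0 o : 0 <= density N j o * (1 + sqnorm (X N j o)) by rewrite mulr_ge0// addr_ge0// sqnorm_ge0.
have hc0 : 0 <= 1 + h * c by rewrite addr_ge0// mulr_ge0.
apply: (@le_trans _ _ (\int[P]_o ((1 + h * c) * (density N j o * (1 + sqnorm (X N j o))))%:E)%E).
  apply: expect_le => [|||o].
  - by apply: measurable_funD => //; apply: measurable_sum.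
  - exact: measurable_funM.
  - by move=> o; rewrite addr_ge0// sumr_ge0.
  rewrite -mulr_sumr -[leLHS](_ : density N j o * (1 + (sqnorm (z o) + h * sqnorm (sigma (node T N j)))) = _); last first.
    by rewrite mulrDr mulr1 big_split/= -mulr_sumr sum_sqnorm_cV.
  rewrite mulrCA; apply: ler_wpM2l => //.
  set v := A (node T N j) *m X N j o + a (node T N j).
  have hv : sqnorm v <= K * (1 + sqnorm (X N j o)) by exact: hK.
  have hs : sqnorm (sigma (node T N j)) <= L := le_trans (ler_norm _) (hL _ tin).
  have hz : sqnorm (z o) <= (1 + h) * sqnorm (X N j o) + h * (1 + h) * sqnorm v.
    rewrite /z -/v !sum_sqnorm_cV !mulr_sumr -big_split; apply: ler_sum => i _ /=.
    have -> : (X N j o + h *: v) i 0 = X N j o i 0 + h * v i 0 by rewrite mxE [t in _ + t]mxE.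
    have := mulr_ge0 h0 (sqr_ge0 (X N j o i 0 - v i 0)).
    by move: (X N j o i 0) (v i 0) => p q; nra.
  have X0 := sqnorm_ge0 (X N j o).
  apply: (le_trans (_ : _ <= 1 + ((1 + h) * sqnorm (X N j o) + h * (1 + T) * (K * (1 + sqnorm (X N j o))) + h * L))).
    rewrite lerD2l lerD//; last by rewrite ler_wpM2l.
    apply: (le_trans hz); rewrite lerD2l; apply: ler_pM => //; last first.
      by rewrite ler_wpM2l// lerD2l.
      exact: sqnorm_ge0.
    by rewrite mulr_ge0// addr_ge0.
  rewrite /c; move: X0 (mulr_ge0 h0 L0) (h0); move: (sqnorm (X N j o)) => q q0 hL0 h0'.
  by have := mulr_ge0 hL0 q0; nra.
rewrite expectZ// exprS mulrCA EFinM; apply: lee_wpmul2l; first by rewrite lee_fin.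
exact: IH.
Qed.

Lemma density_gradient_bound : exists2 C, 0 <= C & forall N j, (0 < N)%N -> (j <= N)%N ->
  (\int[P]_o (density N j o * sqnorm (gam N j o))%:E <= C%:E)%E.
Proof.
have cA : mcont T (fun t => (sigma t)^T *m Pi t) by apply: mcontM => //; exact: mcont_tr.
have ca : mcont T (fun t => (sigma t)^T *m s t) by apply: mcontM => //; exact: mcont_tr.
have [K K0 hK] := linear_growth cA ca; have [C C0 hC] := density_moment.
exists (K * C) => [|N j N0 jN]; first exact: mulr_ge0.
have mD : measurable_fun setT (density N j) by apply: (node_smeas_measurable jN); exact: density_smeas.
have mXs : measurable_fun setT (fun o => density N j o * (1 + sqnorm (X N j o))).
  apply: measurable_funM => //; apply: measurable_funD => //.
  by apply: measurable_sqnorm => a b; exact: (node_smeas_measurable jN (euler_smeas N0 jN a b)).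
have D0 o : 0 <= density N j o by exact: expR_ge0.
apply: (@le_trans _ _ (\int[P]_o (K * (density N j o * (1 + sqnorm (X N j o))))%:E)%E).
  apply: expect_le => [|||o].
  - apply: measurable_funM => //; apply: measurable_sqnorm => a b.
    exact: (node_smeas_measurable jN (gam_smeas N0 (leqnn j) jN a b)).
  - exact: measurable_funM.
  - by move=> o; rewrite mulr_ge0 ?sqnorm_ge0.
  rewrite mulrCA; apply: ler_wpM2l => //.
  rewrite /euler_gradient /ito_gradient mulmxDr mulmxA; apply: hK; exact: node_itv.
rewrite expectZ//; last by move=> o; rewrite mulr_ge0// addr_ge0// sqnorm_ge0.
by rewrite EFinM; apply: lee_wpmul2l; [rewrite lee_fin|exact: hC].
Qed.

(* Under Z, the sum U is a martingale with variance delta^2 E[Z W]. *)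
Lemma density_truncation : exists2 D, 0 <= D & forall N L, (0 < N)%N -> 1 <= L ->
  ((1 - D / L)%:E <= \int[P]_o (Num.min (density N N o) (expR L))%:E)%E.
Proof.
have [C C0 hC] := density_gradient_bound.
(* When Z > e^L, the quantity (4 U^2 + delta^2 W) / L is at least 1. The term in U contributes 4 and
   the term in W contributes 1, each times delta^2 C T / L. *)
exists (5 * (delta ^+ 2 * (C * T))) => [|N L N0 L1].
  by rewrite mulr_ge0// mulr_ge0 ?sqr_ge0// mulr_ge0.
pose h := T / N%:R; have h0 : 0 <= h by exact: divr_ge0.
have hN : h * N%:R = T by rewrite /h divfK// pnatr_eq0 -lt0n.
have mD j : (j <= N)%N -> measurable_fun setT (density N j).
  by move=> jN; apply: (node_smeas_measurable jN); exact: density_smeas.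
have mU j : (j <= N)%N -> measurable_fun setT (fun o => density N j o * tilted_sum N j o ^+ 2).
  move=> jN; apply: measurable_funM; first exact: mD.
  by apply: measurable_funX; apply: (node_smeas_measurable jN); exact: tilted_sum_smeas.
have mW i j : (j <= N)%N -> (i <= j.+1)%N -> measurable_fun setT (fun o => density N j o * energy_sum N i o).
  move=> jN ij; apply: measurable_funM; first exact: mD.
  by apply: (node_smeas_measurable jN); exact: energy_sum_smeas.
have mg j : (j <= N)%N -> measurable_fun setT (fun o => density N j o * sqnorm (gam N j o)).
  move=> jN; apply: measurable_funM; first exact: mD.
  by apply: measurable_sqnorm => a b; exact: (node_smeas_measurable jN (gam_smeas N0 (leqnn j) jN a b)).
have D0 j o : 0 <= density N j o by exact: expR_ge0.
have W0 j o : 0 <= energy_sum N j o by apply: sumr_ge0 => i _; rewrite mulr_ge0// sqnorm_ge0.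
have Dg0 j o : 0 <= density N j o * sqnorm (gam N j o) by rewrite mulr_ge0 ?sqnorm_ge0.
have bU j : (j <= N)%N -> (\int[P]_o (density N j o * tilted_sum N j o ^+ 2)%:E <= (delta ^+ 2 * (C * (h * j%:R)))%:E)%E.
  elim: j => [|j IH] jN.
    under eq_integral do rewrite /tilted_sum big_ord0 mulr0 expr0n/= mulr0.
    by rewrite integral0 !mulr0.
  have jN' := ltnW jN.
  have mg1 : msmeas (F (node T N j)) (fun o => gam N j o) by exact: gam_smeas.
  have := @integral_density_step N j (fun=> 1)
    (fun o => tilted_sum N j o - delta ^+ 2 * sqnorm (gam N j o) * h) (fun a o => delta * gam N j o a 0) N0 jN
    (@smeas_cst _ _ _ (F _) _) (fun=> ler01).
  have my : smeas (F (node T N j)) (fun o => tilted_sum N j o - delta ^+ 2 * sqnorm (gam N j o) * h).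
    apply: smeasB; first exact: tilted_sum_smeas.
    apply: smeasM; last exact: (@smeas_cst _ _ _ (F _)).
    by apply: smeasM; [exact: (@smeas_cst _ _ _ (F _))|exact: smeas_sqnorm].
  move=> /(_ my (fun a => smeasM (@smeas_cst _ _ _ (F _) _) (mg1 a 0))) e.
  have -> : (\int[P]_o (density N j.+1 o * tilted_sum N j.+1 o ^+ 2)%:E =
    \int[P]_o (density N j o * tilted_sum N j o ^+ 2 + (delta ^+ 2 * h) * (density N j o * sqnorm (gam N j o)))%:E)%E.
    transitivity (\int[P]_o (density N j.+1 o * 1 * (tilted_sum N j o - delta ^+ 2 * sqnorm (gam N j o) * h +
         \sum_a delta * gam N j o a 0 * dw N j o a 0) ^+ 2)%:E)%E.
      apply: eq_integral => o _; rewrite mulr1; congr (_ * _ ^+ 2)%:E.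
      rewrite /tilted_sum big_ord_recr/= mulrDr -addrA; congr (_ + _).
      have -> : \sum_a delta * gam N j o a 0 * dw N j o a 0 = delta * inner (gam N j o) (dw N j o).
        by rewrite /inner mulr_sumr; apply: eq_bigr => a _; rewrite mulrA.
      by rewrite -/h; ring.
    rewrite e; apply: eq_integral => o _; rewrite -/h mulr1; congr EFin.
    have e1 : \sum_a (delta * gam N j o a 0) ^+ 2 = delta ^+ 2 * sqnorm (gam N j o).
      by rewrite sum_sqnorm_cV mulr_sumr; apply: eq_bigr => a _; rewrite exprMn.
    have -> : \sum_a delta * gam N j o a 0 * (delta * gam N j o a 0) = delta ^+ 2 * sqnorm (gam N j o).
      by rewrite -e1; apply: eq_bigr => a _; rewrite expr2.
    by ring.
  rewrite expectD//; first last.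
  - by move=> o; rewrite mulr_ge0// mulr_ge0// sqr_ge0.
  - by move=> o; rewrite mulr_ge0// sqr_ge0.
  - by apply: measurable_funM => //; exact: mg.
  - exact: mU.
  rewrite expectZ//; [|exact: mg|by rewrite mulr_ge0// sqr_ge0].
  have -> : delta ^+ 2 * (C * (h * j.+1%:R)) = delta ^+ 2 * (C * (h * j%:R)) + delta ^+ 2 * h * C.
    by rewrite -[j.+1%:R]natr1; ring.
  rewrite EFinD; apply: leeD; first exact: IH.
  by rewrite [leRHS]EFinM; apply: lee_wpmul2l; [rewrite lee_fin mulr_ge0// sqr_ge0|exact: hC].
have bW j : (j <= N)%N -> (\int[P]_o (density N j o * energy_sum N j o)%:E <= (C * (h * j%:R))%:E)%E.
  elim: j => [|j IH] jN.
    under eq_integral do rewrite /energy_sum big_ord0 mulr0.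
    by rewrite integral0 !mulr0.
  have jN' := ltnW jN.
  (* The energy up to index j + 1 involves gamma only up to node j, so the last factor of the
     density integrates to 1. *)
  rewrite integral_density_smeas//; last exact: energy_sum_smeas.
  have -> : (\int[P]_o (density N j o * energy_sum N j.+1 o)%:E =
    \int[P]_o (density N j o * energy_sum N j o + h * (density N j o * sqnorm (gam N j o)))%:E)%E.
    apply: eq_integral => o _; congr EFin; rewrite /energy_sum big_ord_recr/= -/h; ring.
  rewrite expectD//; first last.
  - by move=> o; rewrite mulr_ge0.
  - by move=> o; rewrite mulr_ge0.
  - by apply: measurable_funM => //; exact: mg.
  - exact: mW.
  rewrite expectZ//; last exact: mg.
  have -> : C * (h * j.+1%:R) = C * (h * j%:R) + h * C by rewrite -[j.+1%:R]natr1; ring.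
  rewrite EFinD; apply: leeD; first exact: IH.
  by rewrite [leRHS]EFinM; apply: lee_wpmul2l; [rewrite lee_fin|exact: hC].
have L0 : 0 < L := lt_le_trans ltr01 L1.
have mm : measurable_fun setT (fun o => Num.min (density N N o) (expR L)).
  by apply: measurable_minr => //; exact: mD.
have k1 : 0 <= 4 / L by rewrite divr_ge0// ltW.
have k2 : 0 <= delta ^+ 2 / L by rewrite divr_ge0 ?sqr_ge0// ltW.
have m0 o : 0 <= Num.min (density N N o) (expR L) by rewrite le_min D0 expR_ge0.
have mU' : measurable_fun setT (fun o => 4 / L * (density N N o * tilted_sum N N o ^+ 2)).
  by apply: measurable_funM => //; exact: mU.
have mW' : measurable_fun setT (fun o => delta ^+ 2 / L * (density N N o * energy_sum N N o)).
  by apply: measurable_funM => //; exact: mW.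
have DU0 o : 0 <= density N N o * tilted_sum N N o ^+ 2 by rewrite mulr_ge0// sqr_ge0.
have DW0 o : 0 <= density N N o * energy_sum N N o by rewrite mulr_ge0.
have main : (1 <= \int[P]_o (Num.min (density N N o) (expR L)
    + (4 / L * (density N N o * tilted_sum N N o ^+ 2) + delta ^+ 2 / L * (density N N o * energy_sum N N o)))%:E)%E.
  rewrite -(integral_density N0 (leqnn N)); apply: expect_le => [||//|o]; first exact: mD.
    by apply: measurable_funD => //; exact: measurable_funD.
  have [le|gt] := leP (density N N o) (expR L).
    by rewrite lerDl addr_ge0// mulr_ge0.
  apply: (@le_trans _ _ (4 / L * (density N N o * tilted_sum N N o ^+ 2) + delta ^+ 2 / L * (density N N o * energy_sum N N o))); last first.
    by rewrite lerDr expR_ge0.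
  have -> : 4 / L * (density N N o * tilted_sum N N o ^+ 2) + delta ^+ 2 / L * (density N N o * energy_sum N N o) =
     density N N o * ((4 * tilted_sum N N o ^+ 2 + delta ^+ 2 * energy_sum N N o) / L).
    by field; rewrite gt_eqF.
  rewrite ler_peMr// ler_pdivlMr// mul1r.
  (* log Z = U + delta^2 W / 2 > L forces 2 U > L or delta^2 W > L. *)
  move: gt; rewrite /density ltr_expR log_densityE => gt.
  have dW : 0 <= delta ^+ 2 * energy_sum N N o by rewrite mulr_ge0// sqr_ge0.
  move: gt dW L1; move: (tilted_sum N N o) (delta ^+ 2) (energy_sum N N o) => U d2 W gt dW L1.
  have [l|l] := leP L (d2 * W).
    by apply: (le_trans l); rewrite lerDr mulr_ge0// sqr_ge0.
  apply: (@le_trans _ _ (4 * U ^+ 2)); last by rewrite lerDl.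
  have U2 : L <= 2 * U by lra.
  nra.
move: main; rewrite expectD//; first last.
- by move=> o; rewrite addr_ge0// mulr_ge0.
- exact: measurable_funD.
rewrite expectD//; first last.
- by move=> o; rewrite mulr_ge0.
- by move=> o; rewrite mulr_ge0.
rewrite expectZ//; last exact: mU.
rewrite expectZ//; last exact: mW.
move=> main; rewrite EFinB leeBlDr//; apply: (le_trans main); apply: leeD => //.
have -> : 5 * (delta ^+ 2 * (C * T)) / L = 4 / L * (delta ^+ 2 * (C * (h * N%:R))) + delta ^+ 2 / L * (C * (h * N%:R)).
  by rewrite hN; field; rewrite gt_eqF.
rewrite EFinD; apply: leeD; rewrite [leRHS]EFinM; apply: lee_wpmul2l; rewrite ?lee_fin//.
- exact: bU.
- exact: bW.
Qed.

Lemma exponential_measurable : measurable_fun setT (fun o => expR (delta * ito_remainder o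
  - delta ^+ 2 / 2 * path_integral T (fun t => sqnorm (gradient_process t o)))).
Proof.
apply: measurableT_comp; first exact: measurable_expR.
apply: measurable_funB; apply: measurable_funM => //; first exact: ito_remainder_measurable.
apply: (@measurable_path_integral _ _ _ T (fun t o => sqnorm (gradient_process t o))).
apply: jmeas_continuous => [//|t tT|o]; last by apply: cont_sqnorm; exact: gradient_process_cont.
by apply: measurable_sqnorm => a b; apply: (filtration_smeas_measurable F_filtration tT); exact: gradient_process_smeas.
Qed.

(** For each truncation level the discrete densities converge boundedly along the subsequence, so 1
    - D / (k+1) <= E[min(Z, e^(k+1))] <= 1. Letting k grow, monotone convergence gives E[Z] <= 1 and
    the lower bounds give E[Z] >= 1. *)
Theorem integral_exponential :
  (\int[P]_o (expR (delta * ito_remainder o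
     - delta ^+ 2 / 2 * path_integral T (fun t => sqnorm (gradient_process t o))))%:E = 1)%E.
Proof.
have [phi hphi hae] := euler_subsequence; have [D D0 hD] := density_truncation.
pose Z o := expR (delta * ito_remainder o - delta ^+ 2 / 2 * path_integral T (fun t => sqnorm (gradient_process t o))).
change (\int[P]_o (Z o)%:E = 1)%E.
have mZ : measurable_fun setT Z := exponential_measurable.
pose N l := (phi l).+1.
have mDl l : measurable_fun setT (density (N l) (N l)).
  by apply: (node_smeas_measurable (leqnn _)); exact: density_smeas.
have Dcvg : {ae P, forall o, density (N l) (N l) o @[l --> \oo] --> Z o}.
  apply: filterS hae => o [h1 [_ h3]].
  apply: (@continuous_cvg _ _ _ _ _ _ expR); first exact: continuous_expR.
  have -> : (fun l => log_density (N l) (N l) o) = (fun l => delta * step_integral w (gradient_step (N l)) o 0 0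
     - delta ^+ 2 / 2 * \sum_(j < N l) sqnorm (gam (N l) j o) * (T / (N l)%:R)).
    apply/funext => l; rewrite gradient_step_integral /log_density sumrB !mulr_sumr; congr (_ - _).
    by apply: eq_bigr => j _; rewrite [RHS]mulrA.
  by apply: cvgB; apply: cvgMr.
pose f k o := Num.min (Z o) (expR k.+1%:R).
have f0 k o : 0 <= f k o by rewrite le_min !expR_ge0.
have mf k : measurable_fun setT (f k) by exact: measurable_minr.
have bounds k : ((1 - D / k.+1%:R)%:E <= \int[P]_o (f k o)%:E <= 1)%E.
  pose fl l o := (Num.min (density (N l) (N l) o) (expR k.+1%:R))%:E.
  have mfl l : measurable_fun setT (fl l) by apply/measurable_EFinP; exact: measurable_minr.
  have cmin o : density (N l) (N l) o @[l --> \oo] --> Z o -> fl l o @[l --> \oo] --> (f k o)%:E.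
    move=> h; apply: cvg_EFin; first exact: nearW.
    apply/cvgrPdist_le => e e0; have /cvgrPdist_le/(_ _ e0) := h.
    rewrite !nearE => -[l0 _ hl]; exists l0 => // l ll; apply: le_trans (hl l ll).
    rewrite /f /=; set a := density _ _ _; set b := expR _.
    rewrite !minElt.
    by case: ltP => h1; case: ltP => h2; rewrite !ler_norml; have := ler_norm (Z o - a);
      have := ler_norm (a - Z o); rewrite (distrC a) => ? ?; apply/andP; split; lra.
  have flb : {ae P, forall o l, setT o -> (`|fl l o| <= (EFin \o cst (expR k.+1%:R)) o)%E}.
    apply: aeW => o l _; rewrite /fl /= lee_fin ger0_norm ?le_min ?expR_ge0//.
    by rewrite ge_min lexx orbT.
  have [_ _ cv] := @dominated_convergence _ _ _ P setT measurableT fl (fun o => (f k o)%:E) (EFin \o cst (expR k.+1%:R))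
    mfl ((measurable_EFinP _ _).2 (mf k)) (filterS (fun o h _ => cmin o h) Dcvg)
    (finite_measure_integrable_cst P _ measurableT) flb.
  have flE l : ((1 - D / k.+1%:R)%:E <= \int[P]_o fl l o <= 1)%E.
    apply/andP; split; first by apply: hD => //; rewrite ler1n.
    rewrite -(integral_density (isT : (0 < N l)%N) (leqnn _)); apply: expect_le => //.
    - exact: measurable_minr.
    - by move=> o; rewrite le_min !expR_ge0.
    - by move=> o; rewrite ge_min lexx.
  rewrite -(cvg_lim _ cv)//; apply/andP; split.
    by apply: lime_ge; [apply: cvgP; exact: cv|apply: nearW => l /=; have /andP[] := flE l].
  by apply: lime_le; [apply: cvgP; exact: cv|apply: nearW => l /=; have /andP[] := flE l].
(* For each outcome the truncation is inactive as soon as e^(k+1) exceeds Z. *)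
have fZ o : f k o @[k --> \oo] --> Z o.
  apply: cvg_near_cst; have := @nbhs_infty_gtr R (Z o).
  rewrite !nearE => -[k0 _ hk]; exists k0 => // k kk; apply/min_idPl.
  have := hk k kk => /= /ltW h; apply: (le_trans h).
  apply: (@le_trans _ _ (1 + k.+1%:R)); last exact: expR_ge1Dx.
  by rewrite -[leLHS]add0r lerD// ler_nat.
have cvf : (\int[P]_o (f k o)%:E @[k --> \oo] --> \int[P]_o (Z o)%:E)%E.
  have -> : (\int[P]_o (Z o)%:E = \int[P]_o (limn (fun k => (f k o)%:E)))%E.
    apply: eq_integral => o _; apply/esym/cvg_lim => //.
    by apply: cvg_EFin; [exact: nearW|exact: fZ].
  apply: cvg_monotone_convergence => //.
  - by move=> k; exact/measurable_EFinP.
  - by move=> k o _; rewrite lee_fin.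
  - move=> o _ k l kl; have e : expR (k.+1%:R : R) <= expR l.+1%:R by rewrite ler_expR ler_nat.
    by rewrite lee_fin /f le_min !ge_min lexx e orbT.
have le1 : (\int[P]_o (Z o)%:E <= 1)%E.
  rewrite -(cvg_lim _ cvf)//; apply: lime_le; first by apply: cvgP; exact: cvf.
  by apply: nearW => k; have /andP[] := bounds k.
have ge k : ((1 - D / k.+1%:R)%:E <= \int[P]_o (Z o)%:E)%E.
  have /andP[h _] := bounds k; apply: (le_trans h); apply: expect_le => // o.
  by rewrite ge_min lexx.
have fin : (\int[P]_o (Z o)%:E)%E \is a fin_num.
  rewrite ge0_fin_numE; first by apply: (le_lt_trans le1); exact: ltry.
  by apply: integral_ge0 => o _; rewrite lee_fin expR_ge0.
move: le1 ge; rewrite -(fineK fin) => le1 ge; congr EFin; apply/eqP; rewrite eq_le -lee_fin le1 /=.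
apply/ler_addgt0Pr => e e0; have [k0 hk] := near_mesh_lt D0 e0.
move: (ge k0) (hk k0.+1 (leqnSn _)); rewrite lee_fin.
by move: (fine _) (D / _) => z q; lra.
Qed.

End exponential_martingale.
End linear_sde.

(** * Change of measure *)

Section density_measure.
Context {R : realType} {d : measure_display} {Omega : measurableType d}.
Variables (P : probability Omega R) (Z : Omega -> R).
Hypothesis Z_meas : measurable_fun setT Z.
Hypothesis Z_gt0 : forall o, 0 < Z o.
Hypothesis Z_int : (\int[P]_o (Z o)%:E = 1)%E.

Definition density_measure (A : set Omega) : \bar R := (\int[P]_(o in A) (Z o)%:E)%E.

Let dm0 : density_measure set0 = 0%E.
Proof. by rewrite /density_measure integral_set0. Qed.

Let dm_ge0 A : (0 <= density_measure A)%E.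
Proof. by apply: integral_ge0 => o _; rewrite lee_fin ltW. Qed.

Let dm_sigma : semi_sigma_additive density_measure.
Proof.
apply: semi_sigma_additive_nng_induced; first exact/measurable_EFinP.
by move=> o; rewrite lee_fin ltW.
Qed.

HB.instance Definition _ := isMeasure.Build _ _ _ density_measure dm0 dm_ge0 dm_sigma.

Let dmT : density_measure setT = 1%E := Z_int.

HB.instance Definition _ := Measure_isProbability.Build _ _ _ density_measure dmT.

(** Equivalence rests on Z > 0 everywhere: an event with zero integral of Z must be P-null. The
    derivative is identified with Z because both have the same integral over every event. *)
Lemma density_probability : exists Phat : probability Omega R,
  equivalent_measures P Phat /\ RN_derivative P Phat Z.
Proof.
pose Phat : probability Omega R := density_measure.
have mZ A : measurable_fun A (EFin \o Z) by apply/measurable_EFinP; exact: measurable_funTS.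
have dom : Phat `<< P.
  apply/null_content_dominatesP => A mA PA0; rewrite /= /density_measure.
  have : (\int[P]_(o in A) `|(EFin \o Z) o| = 0)%E.
    by apply/(ae_eq_integral_abs P mA (mZ A)); exists A; split => // o /= h; apply: contrapT => nA; apply: h.
  by under eq_integral do rewrite gee0_abs ?lee_fin ?ltW//.
exists Phat; split; first split => //.
  apply/null_content_dominatesP => A mA; rewrite /= /density_measure => h.
  have : (\int[P]_(o in A) `|(EFin \o Z) o| = 0)%E.
    by under eq_integral do rewrite gee0_abs ?lee_fin ?ltW//.
  move/(ae_eq_integral_abs P mA (mZ A)) => [N [mN N0 hN]].
  apply: (subset_measure0 mA mN _ N0) => o Ao; apply: hN => /(_ Ao) /= [] e.
  by have := Z_gt0 o; rewrite e ltxx.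
split => //; apply: integral_ae_eq => //.
- exact: Radon_Nikodym_integrable.
- by move=> E _ mE; rewrite -Radon_Nikodym_integral.
Qed.

End density_measure.

(** * The Riccati equation *)

Section riccati_symmetry.
Context {R : realType}.

Lemma is_derive_mx_entry p q (y : R -> 'M[R]_(p, q)) (t : R) (dy : 'M[R]_(p, q)) i j :
  is_derive t 1 y dy -> is_derive t 1 (fun u => y u i j) (dy i j).
Proof.
move=> hy; have dv : derivable y t 1 by exact: ex_derive.
apply: DeriveDef; first exact: (derivable_mxP _ _ _).1.
by have := derive_mx dv; rewrite derive_val => ->; rewrite mxE.
Qed.

Lemma sqnorm_mulmx_le p q q' (A : 'M[R]_(p, q)) (B : 'M[R]_(q, q')) :
  sqnorm (A *m B) <= (p * q')%:R * (q%:R * `|A|) ^+ 2 * `|B| ^+ 2.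
Proof.
apply: (le_trans (sqnorm_le_norm _)); rewrite -mulrA ler_wpM2l// -exprMn.
by rewrite lerXn2r ?nnegrE ?mulr_ge0// mulmx_norm_le.
Qed.

Lemma sqr_norm_le_sqnorm p q (A : 'M[R]_(p, q)) : `|A| ^+ 2 <= sqnorm A.
Proof.
have e : Num.sqrt (sqnorm A) ^+ 2 = sqnorm A by rewrite sqr_sqrtr ?sqnorm_ge0.
rewrite -[leRHS]e lerXn2r ?nnegrE ?sqrtr_ge0//.
by apply: norm_le_sqnorm; rewrite ?sqrtr_ge0// e.
Qed.

(* For K large, exp(K t) |D t|^2 is nondecreasing; it vanishes at T. *)
Lemma linear_ode_zero (T : R) n (D E1 E2 : R -> 'M[R]_n) : mcont T D -> mcont T E1 -> mcont T E2 ->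
  (forall i j (t : R), 0 < t < T -> is_derive t 1 (fun u => D u i j) ((E1 t *m D t + D t *m E2 t) i j)) ->
  D T = 0 -> forall t, 0 <= t <= T -> D t = 0.
Proof.
move=> cD c1 c2 hD DT t tT.
have T0 : 0 <= T by case/andP: tT => /le_trans; apply.
have [K1 K10 hK1] := mcont_bounded c1; have [K2 K20 hK2] := mcont_bounded c2.
pose c := (n * n)%:R * (n%:R * K1) ^+ 2; pose c' := (n * n)%:R * (n%:R * K2) ^+ 2.
have cc0 : 0 <= c by rewrite mulr_ge0 ?sqr_ge0.
have cc'0 : 0 <= c' by rewrite mulr_ge0 ?sqr_ge0.
(* The derivative of |D|^2 is 2 <D, D'> >= - |D|^2 - |D'|^2, and |D'|^2 <= (2 c + 2 c') |D|^2. *)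
pose K := 1 + 2 * c + 2 * c'.
pose dD u := E1 u *m D u + D u *m E2 u.
have dDle u : 0 <= u <= T -> sqnorm (dD u) <= (2 * c + 2 * c') * sqnorm (D u).
  move=> uT; apply: (le_trans (sqnormD_le _ _)).
  have h1 : sqnorm (E1 u *m D u) <= c * sqnorm (D u).
    apply: (le_trans (sqnorm_mulmx_le _ _)); apply: ler_pM; rewrite ?mulr_ge0 ?sqr_ge0 ?sqr_norm_le_sqnorm//.
    by rewrite ler_wpM2l// lerXn2r ?nnegrE ?mulr_ge0// ler_wpM2l// hK1.
  have h2 : sqnorm (D u *m E2 u) <= c' * sqnorm (D u).
    apply: (le_trans (sqnorm_mulmx_le _ _)).
    have -> : (n * n)%:R * (n%:R * `|D u|) ^+ 2 * `|E2 u| ^+ 2 = (n * n)%:R * (n%:R * `|E2 u|) ^+ 2 * `|D u| ^+ 2 by ring.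
    apply: ler_pM; rewrite ?mulr_ge0 ?sqr_ge0 ?sqr_norm_le_sqnorm//.
    by rewrite ler_wpM2l// lerXn2r ?nnegrE ?mulr_ge0// ler_wpM2l// hK2.
  by lra.
pose phi u := expR (K * u) * sqnorm (D u).
have cphi : cont T phi.
  apply: contM; last exact: cont_sqnorm.
  by apply: continuous_subspaceT => u; apply: continuous_comp; [exact: mulrl_continuous|exact: continuous_expR].
have dphi u : 0 < u < T -> is_derive u 1 phi
   (expR (K * u) * (K * sqnorm (D u) + 2 * \sum_i \sum_j D u i j * dD u i j)).
  move=> uT.
  have h1 : is_derive u 1 (fun u => expR (K * u)) (expR (K * u) * K).
    apply: (@is_derive1_comp _ expR ( *%R K)).
    have h := @is_deriveZ R R R id K u 1 1 (is_derive_id u (1 : R)).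
    apply: (@is_derive_eq _ _ _ _ _ _ _ _ h).
    by rewrite /GRing.scale/= mulr1.
  have h2 : is_derive u 1 (fun u => sqnorm (D u)) (2 * \sum_i \sum_j D u i j * dD u i j).
    have -> : (fun u => sqnorm (D u)) = \sum_(i < n) \sum_(j < n) (fun u => D u i j) * (fun u => D u i j).
      apply/funext => v; rewrite fct_sumE; apply: eq_bigr => i _; rewrite fct_sumE.
      by apply: eq_bigr => j _; rewrite expr2.
    have e : \sum_i \sum_j (D u i j *: dD u i j + D u i j *: dD u i j : R) = 2 * \sum_i \sum_j D u i j * dD u i j.
      rewrite mulr_sumr; apply: eq_bigr => i _; rewrite mulr_sumr; apply: eq_bigr => j _.
      by rewrite /GRing.scale/=; ring.
    rewrite -e; apply: is_derive_sum => i; apply: is_derive_sum => j.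
    by apply: is_deriveM; exact: hD.
  apply: (@is_derive_eq _ _ _ _ _ _ _ _ (is_deriveM h1 h2)).
  by rewrite /GRing.scale/=; ring.
have mono : {in `[0, T]%R &, {homo phi : x y / x <= y >-> x <= y}}.
  apply: (@ger0_derive1_le_cc R phi 0 T); last exact: cphi.
  - by move=> u; rewrite in_itv/= => uT; exact: (@ex_derive _ _ _ _ _ _ _ (dphi u uT)).
  - move=> u; rewrite in_itv/= => uT; rewrite derive1E; rewrite (@derive_val _ _ _ _ _ _ _ (dphi u uT)).
    apply: mulr_ge0; first exact: expR_ge0.
    have uT' : 0 <= u <= T by case/andP: uT => /ltW -> /ltW ->.
    have h1 : - (2 * \sum_i \sum_j D u i j * dD u i j) <= sqnorm (D u) + sqnorm (dD u).
      rewrite -mulrN -sumrN mulr_sumr -big_split; apply: ler_sum => i _ /=.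
      rewrite -sumrN mulr_sumr -big_split; apply: ler_sum => j _ /=.
      by have := sqr_ge0 (D u i j + dD u i j); nra.
    by have := dDle u uT'; rewrite /K; lra.
have := mono t T; rewrite !in_itv/= tT lexx T0 => /(_ isT isT); case/andP: (tT) => _ -> /(_ isT).
rewrite /phi DT sqnorm0 mulr0 => h.
have h0 : sqnorm (D t) <= 0 by move: h; rewrite pmulr_rle0// expR_gt0.
apply/matrixP => i j; rewrite mxE; apply/eqP; rewrite -sqrf_eq0 eq_le sqr_ge0 andbT.
exact: le_trans (sqnorm_entry (D t) i j) h0.
Qed.

End riccati_symmetry.

Section matrix_entries.
Context {R : realType} {p q : nat}.
Implicit Types U V : 'M[R]_(p, q).

(** Versions of [mxE] for one operation each; unlike [mxE] they leave matrix products folded, as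
    atoms for [ring]. *)
Lemma mxDE U V i j : (U + V) i j = U i j + V i j. Proof. exact: mxE. Qed.

Lemma mxNE U i j : (- U) i j = - U i j. Proof. exact: mxE. Qed.

Lemma mxZE (c : R) U i j : (c *: U) i j = c * U i j. Proof. exact: mxE. Qed.

End matrix_entries.

Section riccati.
Context {R : realType}.
Variables (T : R) (r n m : nat).
Variables (A : 'M[R]_n) (B : 'M[R]_(n, m)) (b : R -> 'cV[R]_n) (sigma : R -> 'M[R]_(n, r)).
Variables (Q : 'M[R]_n) (S : 'M[R]_(n, m)) (Rm : 'M[R]_m) (eta : 'cV[R]_n) (zeta : 'cV[R]_m) (delta : R).
Variables (Pi : R -> 'M[R]_n) (s : R -> 'cV[R]_n).

Definition riccati_rhs (t : R) (Y : 'M[R]_n) : 'M[R]_n :=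
  - (Y *m A + A^T *m Y - (Y *m B + S) *m invmx Rm *m (B^T *m Y + S^T) + Q
     + delta *: (Y *m sigma t *m (sigma t)^T *m Y)).

Definition offset_rhs (t : R) (y : 'cV[R]_n) : 'cV[R]_n :=
  - ((A^T - Pi t *m B *m invmx Rm *m B^T - S *m invmx Rm *m B^T
      + delta *: (Pi t *m sigma t *m (sigma t)^T)) *m y
     + Pi t *m (b t + B *m invmx Rm *m zeta) + S *m invmx Rm *m zeta - eta).

Definition feedback t z := - (invmx Rm *m (S^T *m z - zeta + B^T *m (Pi t *m z + s t))).
Definition closed_loop_matrix t := A - B *m invmx Rm *m (S^T + B^T *m Pi t).
Definition closed_loop_vector t := b t - B *m invmx Rm *m (B^T *m s t - zeta).

Hypothesis Q_sym : Q^T = Q.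
Hypothesis Rm_sym : Rm^T = Rm.
Hypothesis Rm_inv : Rm \in unitmx.

Let Ri_sym : (invmx Rm)^T = invmx Rm.
Proof. by rewrite trmx_inv Rm_sym. Qed.

Lemma closed_loopE t z :
  A *m z + B *m feedback t z + b t = closed_loop_matrix t *m z + closed_loop_vector t.
Proof.
rewrite /feedback /closed_loop_matrix /closed_loop_vector.
rewrite !(mulmxDr, mulmxDl, mulmxN, mulNmx, opprD, opprK, mulmxA).
by apply/matrixP => i j; rewrite !(mxDE, mxNE); ring.
Qed.

(** Pi and its transpose solve the same equation. A quadratic term splits as P M P - P' M P' = P M
    (P - P') + (P - P') M P' with P' the transpose, so the difference D solves a linear equation D'
    = E1 D + D E2 whose coefficients contain the known Pi, and D vanishes at T. *)
Lemma riccati_symmetric : mcont T sigma -> mcont T Pi -> (Pi T)^T = Pi T ->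
  (forall i j (t : R), 0 < t < T -> is_derive t 1 (fun u => Pi u i j) (riccati_rhs t (Pi t) i j)) ->
  forall t, 0 <= t <= T -> (Pi t)^T = Pi t.
Proof.
move=> cs cP PT hP t tT.
pose D u := Pi u - (Pi u)^T.
pose Sg u := sigma u *m (sigma u)^T.
pose E1 u := - (A^T - (Pi u *m B + S) *m invmx Rm *m B^T + delta *: (Pi u *m Sg u)).
pose E2 u := - (A - B *m invmx Rm *m (B^T *m (Pi u)^T + S^T) + delta *: (Sg u *m (Pi u)^T)).
have cst := @mcont_cst R T.
have cPt : mcont T (fun u => (Pi u)^T) by exact: mcont_tr.
have cSg : mcont T Sg by apply: mcontM => //; exact: mcont_tr.
suff : D t = 0 by move=> /subr0_eq.
apply: (@linear_ode_zero R T n D E1 E2) => //.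
- exact: mcontB.
- apply: mcontN; apply: mcontD; last by apply: mcontZ; exact: mcontM.
  apply: mcontB => //; apply: mcontM => //; apply: mcontM => //; apply: mcontD => //; exact: mcontM.
- apply: mcontN; apply: mcontD; last by apply: mcontZ; exact: mcontM.
  apply: mcontB => //; apply: mcontM => //; apply: mcontD => //; exact: mcontM.
- move=> i j u uT.
  have -> : (E1 u *m D u + D u *m E2 u) i j = riccati_rhs u (Pi u) i j - riccati_rhs u (Pi u) j i.
    have <- : (riccati_rhs u (Pi u))^T i j = riccati_rhs u (Pi u) j i by rewrite mxE.
    have -> (U V : 'M[R]_n) : U i j - V i j = (U - V) i j by rewrite !mxE.
    congr (fun_of_matrix _ i j); rewrite /riccati_rhs /E1 /E2 /D /Sg.
    have tD p q (U V : 'M[R]_(p, q)) : (U + V)^T = U^T + V^T by exact: linearD.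
    have tN p q (U : 'M[R]_(p, q)) : (- U)^T = - U^T by exact: linearN.
    have tZ p q (k : R) (U : 'M[R]_(p, q)) : (k *: U)^T = k *: U^T by exact: linearZ.
    rewrite !(tD, tN, tZ, trmx_mul, trmxK, Q_sym, Ri_sym).
    rewrite !(mulmxDr, mulmxDl, mulmxN, mulNmx, opprD, opprK, mulmxA, =^~ scalemxAl, =^~ scalemxAr, scalerDr, scalerN).
    by apply/matrixP => a c; rewrite !(mxDE, mxNE, mxZE); ring.
  have -> : (fun v => D v i j) = (fun v => Pi v i j) - (fun v => Pi v j i).
    by apply/funext => v; rewrite !mxE.
  by apply: is_deriveB; exact: hP.
- by rewrite /D PT subrr.
Qed.

(** Running cost, twice the drift of the potential and delta |gamma|^2 add up to a quantity free of
    the state z. With u = - R^-1 (L z + k) the terms in u collapse to - <R^-1 (L z + k), L z + k>;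
    the Riccati equation then cancels what is quadratic in z and the offset equation what is linear
    in z. *)
Lemma completion_of_squares t z : (Pi t)^T = Pi t ->
  let u := feedback t z in
  inner (Q *m z) z + 2 * inner (S *m u) z + inner (Rm *m u) u - 2 * inner eta z - 2 * inner zeta u
  + 2 * ito_drift closed_loop_matrix closed_loop_vector sigma Pi (fun t => riccati_rhs t (Pi t)) s
      (fun t => offset_rhs t (s t)) t z
  + delta * sqnorm (ito_gradient sigma Pi s t z) =
  2 * inner (s t) (b t) - inner (invmx Rm *m (B^T *m s t - zeta)) (B^T *m s t - zeta)
  + \tr (Pi t *m sigma t *m (sigma t)^T) + delta * sqnorm ((sigma t)^T *m s t).
Proof.
move=> Ps u; rewrite /ito_drift -closed_loopE -/u.
set p := Pi t; set k := B^T *m s t - zeta; set L := B^T *m p + S^T; set Ri := invmx Rm.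
set y := s t; set Sg := sigma t.
have uE : u = - (Ri *m (L *m z + k)).
  rewrite /u /feedback /L /k -/p -/y; congr (- (_ *m _)).
  rewrite !(mulmxDr, mulmxDl, mulmxA).
  by apply/matrixP => i j; rewrite !(mxDE, mxNE); ring.
have Rs : inner (Rm *m u) u = inner (Ri *m (L *m z + k)) (L *m z + k).
  by rewrite uE mulmxN innerNl innerNr opprK mulmxA mulmxV// mul1mx innerC.
(* Symmetry of Pi makes the two outer factors of the quadratic Riccati term transposes of each
   other. *)
have pB : p *m B + S = L^T by rewrite /L linearD/= trmx_mul !trmxK Ps.
have dPiE : inner (riccati_rhs t p *m z) z = - (2 * inner (p *m z) (A *m z) - inner (Ri *m (L *m z)) (L *m z)
    + inner (Q *m z) z + delta * sqnorm (Sg^T *m (p *m z))).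
  rewrite /riccati_rhs sqnorm_inner mulNmx innerNl pB -/L -/Ri; congr (- _).
  have h3 : inner (L^T *m Ri *m L *m z) z = inner (Ri *m (L *m z)) (L *m z).
    by rewrite -!mulmxA (inner_mull L^T) trmxK.
  rewrite -h3; move: (L^T *m Ri *m L) => M3.
  rewrite !(mulmxDl, mulNmx, innerDl, innerNl) -scalemxAl innerZl; congr (_ - _ + _ + _ * _).
  - rewrite -!mulmxA (inner_mull A^T) trmxK (inner_mull p) Ps -/p innerC; ring.
  - by rewrite -/Sg -!mulmxA (inner_mull p) Ps -/p (inner_mull Sg).
have dsE : inner (offset_rhs t y) z = - inner y (A *m z) + inner (Ri *m k) (L *m z)
    - delta * inner (Sg^T *m y) (Sg^T *m (p *m z)) - inner (b t) (p *m z) + inner eta z.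
  rewrite /offset_rhs -/p -/Ri -/Sg.
  have -> : (A^T - p *m B *m Ri *m B^T - S *m Ri *m B^T + delta *: (p *m Sg *m Sg^T)) *m y + p *m (b t + B *m Ri *m zeta) + S *m Ri *m zeta - eta
    = A^T *m y - L^T *m (Ri *m k) + delta *: (p *m (Sg *m (Sg^T *m y))) + p *m b t - eta.
    rewrite -pB /k -/y.
    rewrite !(mulmxDr, mulmxDl, mulmxN, mulNmx, opprD, opprK, mulmxA, =^~ scalemxAl, =^~ scalemxAr, scalerDr, scalerN).
    by apply/matrixP => i j; rewrite !(mxDE, mxNE, mxZE); ring.
  rewrite innerNl !(innerDl, innerNl) innerZl.
  rewrite (inner_mull A^T) trmxK (inner_mull L^T) trmxK (inner_mull p) Ps -/p (inner_mull Sg) (inner_mull p) Ps -/p.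
  ring.
have uE1 : inner (S *m u) z = inner u (S^T *m z) by rewrite inner_mull.
have uE2 : inner (p *m z + y) (B *m u) = inner (B^T *m (p *m z + y)) u by rewrite inner_mulr.
have vE : S^T *m z - zeta + B^T *m (p *m z + y) = L *m z + k.
  rewrite /L /k !(mulmxDr, mulmxDl, mulmxA).
  by apply/matrixP => i j; rewrite !(mxDE, mxNE); ring.
(* All terms linear in u pair it with L z + k, which is - R u. *)
have uv : inner u (S^T *m z) - inner zeta u + inner (B^T *m (p *m z + y)) u = - inner (Ri *m (L *m z + k)) (L *m z + k).
  by rewrite -vE [inner zeta u]innerC [inner (B^T *m _) u]innerC -innerBr -innerDr vE uE innerNl.
have expand : inner (Ri *m (L *m z + k)) (L *m z + k) = inner (Ri *m (L *m z)) (L *m z)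
   + 2 * inner (Ri *m k) (L *m z) + inner (Ri *m k) k.
  rewrite inner_quadD; last exact: Ri_sym.
  by congr (_ + 2 * _ + _); rewrite inner_mull Ri_sym innerC.
have gE : sqnorm (ito_gradient sigma Pi s t z) = sqnorm (Sg^T *m (p *m z))
   + 2 * inner (Sg^T *m y) (Sg^T *m (p *m z)) + sqnorm (Sg^T *m y).
  rewrite /ito_gradient -/p -/y -/Sg !sqnorm_inner mulmxDr !(innerDl, innerDr).
  by rewrite [inner (Sg^T *m (p *m z)) (Sg^T *m y)]innerC; ring.
have trE : \tr (ito_quadratic sigma Pi t) = \tr (p *m Sg *m Sg^T).
  by rewrite /ito_quadratic -mulmxA mxtrace_mulC.
rewrite gE trE -/p -/y dPiE dsE uE1 Rs.
have e1 : inner (p *m z + y) (A *m z + B *m u + b t) = inner (p *m z) (A *m z) + inner y (A *m z)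
   + inner (B^T *m (p *m z + y)) u + inner (b t) (p *m z) + inner y (b t).
  rewrite !innerDr uE2 !innerDl [inner (b t) _]innerC; ring.
rewrite e1.
move: uv expand.
move: (inner u (S^T *m z)) (inner zeta u) (inner (B^T *m (p *m z + y)) u) (inner (Ri *m (L *m z + k)) (L *m z + k)).
move=> c1 c2 c3 c4 uv expand.
have -> : c3 = - c4 - c1 + c2 by rewrite -uv; ring.
by rewrite expand; field.
Qed.

End riccati.

Theorem lemma3 (R : realType) (d : measure_display) (Omega : measurableType d)
    (P : probability Omega R) (T : R) (F : R -> set (set Omega))
    (r n m : nat) (w : R -> Omega -> 'cV[R]_r)
    (A : 'M[R]_n) (B : 'M[R]_(n, m)) (b : R -> 'cV[R]_n)
    (sigma : R -> 'M[R]_(n, r)) (x0 : 'cV[R]_n)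
    (Q : 'M[R]_n) (S : 'M[R]_(n, m)) (Rm : 'M[R]_m) (Qhat : 'M[R]_n)
    (eta : 'cV[R]_n) (zeta : 'cV[R]_m) (delta : R)
    (Pi : R -> 'M[R]_n) (s : R -> 'cV[R]_n) (x : R -> Omega -> 'cV[R]_n)
    (T_gt0 : 0 < T) (delta_gt0 : 0 < delta)
    (F_filtration : filtration T F) (w_wiener : wiener_process P T F w)
    (b_cont : {within `[0, T], continuous b})
    (sigma_cont : {within `[0, T], continuous sigma})
    (Q_sym : Q^T = Q) (Rm_sym : Rm^T = Rm) (Qhat_sym : Qhat^T = Qhat)
    (Rm_inv : Rm \in unitmx)
    (Pi_ode : ode_solution T (fun t Y =>
       - (Y *m A + A^T *m Y
          - (Y *m B + S) *m invmx Rm *m (B^T *m Y + S^T)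
          + Q + delta *: (Y *m sigma t *m (sigma t)^T *m Y))) Pi)
    (Pi_T : Pi T = Qhat)
    (s_ode : ode_solution T (fun t y =>
       - ((A^T - Pi t *m B *m invmx Rm *m B^T - S *m invmx Rm *m B^T
           + delta *: (Pi t *m sigma t *m (sigma t)^T)) *m y
          + Pi t *m (b t + B *m invmx Rm *m zeta)
          + S *m invmx Rm *m zeta - eta)) s)
    (s_T : s T = 0) :
  let ustar : R -> Omega -> 'cV[R]_m := fun t omega =>
    - (invmx Rm *m (S^T *m x t omega - zeta
                    + B^T *m (Pi t *m x t omega + s t))) in
  let Cstar : R :=
    delta / 2 * path_integral T (fun t =>
      2 * inner (s t) (b t)
      - inner (invmx Rm *m (B^T *m s t - zeta)) (B^T *m s t - zeta)
      + \tr (Pi t *m sigma t *m (sigma t)^T))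
    + delta ^+ 2 / 2 * path_integral T (fun t => sqnorm ((sigma t)^T *m s t))
    + delta / 2 * inner (Pi 0 *m x0) x0
    + delta * inner (s 0) x0 in
  let gamma : R -> Omega -> 'cV[R]_r := fun t omega =>
    (sigma t)^T *m (Pi t *m x t omega + s t) in
  let Z : Omega -> R := fun omega =>
    expR (delta * cost T Q S Rm Qhat eta zeta ustar x omega - Cstar) in
  state_process P T F w A B b sigma x0 ustar x ->
  (exists Phat : probability Omega R,
     equivalent_measures P Phat /\ RN_derivative P Phat Z) /\
  (exists I : Omega -> 'cV[R]_1,
     ito_integral P F w T (fun t omega => (gamma t omega)^T) I) /\
  (forall I : Omega -> 'cV[R]_1,
     ito_integral P F w T (fun t omega => (gamma t omega)^T) I ->
     {ae P, forall omega,
        Z omega = expR (- (delta ^+ 2 / 2)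
                          * path_integral T (fun t => sqnorm (gamma t omega))
                        + delta * I omega 0 0)}).
Proof.
move=> ustar Cstar gamma Z [x_adapted x_paths x_sde].
have T00 : 0 <= T := ltW T_gt0.
case: Pi_ode => /mx_cont Pi_cont Pi_der; case: s_ode => /mx_cont s_cont s_der.
move: b_cont sigma_cont => /mx_cont b_mcont /mx_cont sigma_mcont.
pose dPi t := riccati_rhs A B sigma Q S Rm delta t (Pi t).
pose ds t := offset_rhs A B b sigma S Rm eta zeta delta Pi t (s t).
pose G := closed_loop_matrix A B S Rm Pi.
pose g := closed_loop_vector B b Rm zeta s.
have cst := @mcont_cst R T.
have sigmaT_cont : mcont T (fun t => (sigma t)^T) by exact: mcont_tr.
have PiB_cont : mcont T (fun t => Pi t *m B + S) by apply: mcontD => //; exact: mcontM.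
have L_cont : mcont T (fun t => B^T *m Pi t + S^T) by apply: mcontD => //; exact: mcontM.
have k_cont : mcont T (fun t => B^T *m s t - zeta) by apply: mcontB => //; exact: mcontM.
have PiS_cont : mcont T (fun t => Pi t *m sigma t *m (sigma t)^T) by apply: mcontM => //; exact: mcontM.
have dPi_cont : mcont T dPi.
  apply: mcontN; apply: mcontD; last by apply: mcontZ; exact: mcontM.
  apply: mcontD => //; apply: mcontB; last by apply: mcontM => //; exact: mcontM.
  by apply: mcontD; exact: mcontM.
have ds_cont : mcont T ds.
  apply: mcontN; apply: mcontB => //; apply: mcontD => //; apply: mcontD; last first.
    by apply: mcontM => //; exact: mcontD.
  apply: mcontM => //; apply: mcontD; last exact: mcontZ.
  apply: mcontB => //; apply: mcontB => //; apply: mcontM => //; apply: mcontM => //; exact: mcontM.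
have G_cont : mcont T G.
  by apply: mcontB => //; apply: mcontM => //; apply: mcontD => //; exact: mcontM.
have g_cont : mcont T g by apply: mcontB => //; exact: mcontM.
have Pi_der' i j t : 0 < t < T -> is_derive t 1 (fun u => Pi u i j) (dPi t i j).
  by move=> /Pi_der; exact: is_derive_mx_entry.
have s_der' i j t : 0 < t < T -> is_derive t 1 (fun u => s u i j) (ds t i j).
  by move=> /s_der; exact: is_derive_mx_entry.
have Pi_sym t : 0 <= t <= T -> (Pi t)^T = Pi t.
  apply: (riccati_symmetric Q_sym Rm_sym sigma_mcont Pi_cont _ Pi_der').
  by rewrite Pi_T.
(* Inserting the feedback turns the controlled equation into a linear one with matrix G and vector
   g. *)
have x_eq t : 0 <= t <= T -> exists2 M : Omega -> 'cV[R]_n, ito_integral P F w t (fun s _ => sigma s) M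
    & {ae P, forall o, x t o = x0 + mx_integral t (fun s => G s *m x s o + g s) + M o}.
  move=> tT; have [M hM ae] := x_sde t tT; exists M => //; apply: filterS ae => o ->.
  congr (_ + mx_integral t _ + _); apply/funext => u.
  exact: (closed_loopE A B b S Rm zeta Pi s u (x u o)).
pose J := ito_remainder T G g sigma x0 x Pi dPi s ds.
pose E o := delta * J o - delta ^+ 2 / 2 * path_integral T (fun t => sqnorm (gamma t o)).
(* An identity for every outcome, not only almost surely, since cost and remainder are both
   evaluated along the given path. *)
have ZE o : Z o = expR (E o).
  congr expR.
  have y_cont : mcont T (x ^~ o) by apply/mx_cont; exact: x_paths.
  have u_cont : mcont T (ustar ^~ o).
    apply: mcontN; apply: mcontM => //; apply: mcontD; first by apply: mcontB => //; exact: mcontM.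
    by apply: mcontM => //; apply: mcontD => //; exact: mcontM.
  have c2 : cont T (fun=> 2) by exact: cont_cst.
  have ch : cont T (fun=> 2^-1) by exact: cont_cst.
  have cd : cont T (fun=> delta) by exact: cont_cst.
  pose run t := inner (Q *m x t o) (x t o) + 2 * inner (S *m ustar t o) (x t o)
     + inner (Rm *m ustar t o) (ustar t o) - 2 * inner eta (x t o) - 2 * inner zeta (ustar t o).
  pose dr t := ito_drift G g sigma Pi dPi s ds t (x t o).
  pose gg t := sqnorm (gamma t o).
  pose c1 t := 2 * inner (s t) (b t) - inner (invmx Rm *m (B^T *m s t - zeta)) (B^T *m s t - zeta)
      + \tr (Pi t *m sigma t *m (sigma t)^T).
  pose cs t := sqnorm ((sigma t)^T *m s t).
  have run_cont : cont T run.
    apply: contB; last by apply: contM => //; exact: cont_inner.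
    apply: contB; last by apply: contM => //; exact: cont_inner.
    apply: contD; last by apply: cont_inner => //; exact: mcontM.
    apply: contD; first by apply: cont_inner => //; exact: mcontM.
    by apply: contM => //; apply: cont_inner => //; exact: mcontM.
  have dr_cont : cont T dr.
    apply: contD; last first.
      by apply: contM => //; apply: cont_trace; apply: mcontM => //; exact: mcontM.
    apply: contD.
      apply: contD; last exact: cont_inner.
      by apply: contM => //; apply: cont_inner => //; exact: mcontM.
    by apply: cont_inner; (apply: mcontD => //; exact: mcontM).
  have gg_cont : cont T gg.
    by apply: cont_sqnorm; apply: mcontM => //; apply: mcontD => //; exact: mcontM.
  have c1_cont : cont T c1.
    apply: contD; last exact: cont_trace.
    by apply: contB; [apply: contM => //; exact: cont_inner|apply: cont_inner => //; exact: mcontM].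
  have cs_cont : cont T cs by apply: cont_sqnorm; exact: mcontM.
  (* The pointwise completion of squares, integrated over [0, T]; all integrands are continuous in
     time. *)
  have balance : path_integral T run + 2 * path_integral T dr + delta * path_integral T gg =
      path_integral T c1 + delta * path_integral T cs.
    have c2dr : cont T (fun t => 2 * dr t) by exact: contM.
    have cdgg : cont T (fun t => delta * gg t) by exact: contM.
    have cdcs : cont T (fun t => delta * cs t) by exact: contM.
    have csum : cont T (fun t => run t + 2 * dr t) by exact: contD.
    rewrite -!path_integralZ// -!path_integralD//; apply: eq_path_integral => t /Pi_sym Pit.
    exact: (completion_of_squares A B b sigma Q S eta zeta delta s Rm_sym Rm_inv (x t o) Pit).
  (* The terminal conditions make the potential at T equal to the terminal cost; the potential at 0
     supplies the terms of [Cstar] in x0. *)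
  rewrite /E /J /ito_remainder /Cstar /cost /ito_potential Pi_T s_T inner0l.
  rewrite -/(path_integral T run).
  change (delta * (2^-1 * path_integral T run + 2^-1 * inner (Qhat *m x T o) (x T o))
    - (delta / 2 * path_integral T c1 + delta ^+ 2 / 2 * path_integral T cs
       + delta / 2 * inner (Pi 0 *m x0) x0 + delta * inner (s 0) x0) =
    delta * (2^-1 * inner (Qhat *m x T o) (x T o) + 0 - (2^-1 * inner (Pi 0 *m x0) x0 + inner (s 0) x0)
      - path_integral T dr) - delta ^+ 2 / 2 * path_integral T gg).
  have -> : path_integral T run = path_integral T c1 + delta * path_integral T cs - 2 * path_integral T dr
    - delta * path_integral T gg by rewrite -balance; ring.
  by field.
have ZfE : Z = fun o => expR (E o) by apply/funext.
have Z_meas : measurable_fun setT Z.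
  rewrite ZfE; exact: (exponential_measurable T_gt0 F_filtration x0 G_cont g_cont sigma_mcont x_adapted x_paths
    Pi_cont dPi_cont s_cont ds_cont).
have Z_gt0 o : 0 < Z o by exact: expR_gt0.
have Z_int : (\int[P]_o (Z o)%:E = 1)%E.
  under eq_integral do rewrite ZE.
  exact: (integral_exponential T_gt0 F_filtration w_wiener G_cont g_cont sigma_mcont x_adapted x_paths x_eq
    Pi_cont dPi_cont s_cont ds_cont Pi_sym Pi_der' s_der').
have [ex uniq] := ito_integral_gradient T_gt0 F_filtration w_wiener G_cont g_cont sigma_mcont x_adapted x_paths x_eq
    Pi_cont dPi_cont s_cont ds_cont Pi_sym Pi_der' s_der'.
split; first exact: density_probability.
split; first by exists (fun o => const_mx (J o)).
move=> I hI; apply: filterS (uniq I hI) => o IE.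
by rewrite ZE IE /E -/J; congr expR; rewrite mulNr addrC.
Qed.
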